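(* For a compact topological Clifford semigroup $S$ the following conditions are equivalent: (1) $S$ belongs to the class $\mathcal H$; (2) $S$ belongs to the class $\mathcal H_0$; (3) $S$ is a topological inverse semigroup with zero-dimensional idempotent semilattice $E$; (4) $S$ embeds into the product $\prod_{e\in E}H_e^0$; (5) $S$ embeds into the hypersemigroup $\exp(G)$ of the compact topological group $G=\prod_{e\in E}\widetilde H_e$, where for each idempotent $e\in E$, $\widetilde H_e$ is a non-trivial compact topological group containing the maximal group $H_e$.
   Context: A topological semigroup is a topological space endowed with a continuous semigroup operation. Topological groups are Tychonoff. A topological semigroup $S_1$ embeds into a topological semigroup $S_2$ if there is a semigroup homomorphism $S_1\to S_2$ that is a topological embedding. Products carry the Tychonoff topology and the coordinatewise operation. $E$ denotes the set of idempotents of $S$, and for $e\in E$, $H_e$ denotes the maximal subgroup of $S$ corresponding to the idempotent $e$ (i.e. having $e$ as its identity). For a topological group $G$, the hypersemigroup $\exp(G)$ is the set of all non-empty compact subsets of $G$ with the operation $AB=\{ab:a\in A,\ b\in B\}$ and the Vietoris topology, generated by the sub-base of sets $U^+=\{K\in\exp(G):K\subset U\}$ and $U^-=\{K\in\exp(G):K\cap U\neq\emptyset\}$, $U$ open in $G$. $\mathcal H$ is the class of all topological semigroups that embed into $\exp(G)$ for some topological group $G$. For a topological semigroup $T$, $T^0=T\cup\{0\}$ is the extension of $T$ by an isolated point $0\notin T$ such that $t0=0t=0$ for all $t\in T^0$. $\mathcal H_0$ is the smallest class of topological semigroups closed under subdirect products, semidirect products with Abelian topological groups, and attaching zero to compact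 semigroups from $\mathcal H$. Here: a topological semigroup $T$ is a subdirect product of a family $\{S_\alpha:\alpha\in A\}$ of topological semigroups if $T$ embeds into $\prod_{\alpha\in A}S_\alpha$; if $\sigma$ is a homomorphism from a topological group $G$ to the group of topological automorphisms of a topological semigroup $T$ such that the map $G\times T\to T$, $(g,t)\mapsto\sigma(g)(t)$, is continuous, then the semidirect product of $T$ with $G$ is the space $T\times G$ with the operation $(t,g)*(t',g')=(t\cdot\sigma(g)(t'),gg')$; attaching zero is the operation $T\mapsto T^0$. A semigroup is Clifford if each of its elements lies in a subgroup. A semigroup $T$ is inverse if for each $x\in T$ there is a unique $x^{-1}\in T$ with $xx^{-1}x=x$ and $x^{-1}xx^{-1}=x^{-1}$; then the idempotents of $T$ form a commutative subsemigroup, called the idempotent semilattice of $T$. A topological inverse semigroup is a topological semigroup that is inverse and whose inversion $x\mapsto x^{-1}$ is continuous. A topological space is zero-dimensional if its closed-and-open sets form a base of the topology.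
   Formalization: The compact topological Clifford semigroup S is assumed Hausdorff; without this the equivalence fails (the two-element group with the indiscrete topology satisfies (3) and (4) but not (1) or (5)). *)

(* Defs.v *)
From HB Require Import structures.
From mathcomp Require Import all_boot all_order all_algebra.
From mathcomp Require Import all_classical all_reals topology urysohn.

Set Implicit Arguments.
Unset Strict Implicit.
Unset Printing Implicit Defensive.

Local Open Scope classical_set_scope.
Local Open Scope group_scope.

HB.mixin Record Semigroup_isTopological S of Semigroup S & Topological S := {
  mulg_continuous : continuous (fun xy : S * S => xy.1 * xy.2)
}.

#[short(type="topSemigroupType")]
HB.structure Definition TopSemigroup :=
  {S of Semigroup S & Topological S & Semigroup_isTopological S}.

HB.mixin Record Group_isTopological G of Group G & Topological G := {
  invg_continuous : continuous (fun x : G => x^-1)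
}.

(* No separation axiom is included: it is required separately, through
   [tychonoff_space], wherever a topological group is quantified over. *)
#[short(type="topGroupType")]
HB.structure Definition TopGroup :=
  {G of TopSemigroup G & Group G & Group_isTopological G}.

Definition tychonoff_space (T : topologicalType) :=
  hausdorff_space T /\ completely_regular_space T.

Definition topological_embedding (X Y : topologicalType) (f : X -> Y) :=
  injective f /\ open = [set f @^-1` V | V in open].

Definition embeds (S T : topSemigroupType) :=
  exists2 f : S -> T,
    {morph f : x y / x * y} & topological_embedding f.

Section continuity.

Lemma continuous_mulg (X : topologicalType) (S : topSemigroupType)
    (f g : X -> S) :
  continuous f -> continuous g -> continuous (fun x => f x * g x).
Proof.
move=> cf cg x.
apply: (@continuous_comp _ _ _ (fun x => (f x, g x))
  (fun xy : S * S => xy.1 * xy.2)); last exact: mulg_continuous.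
by apply: cvg_pair; [exact: cf | exact: cg].
Qed.

Lemma continuous_fst (X Y : topologicalType) : continuous (@fst X Y).
Proof. by move=> x; exact: cvg_fst. Qed.

Lemma continuous_snd (X Y : topologicalType) : continuous (@snd X Y).
Proof. by move=> x; exact: cvg_snd. Qed.

Lemma continuous_proj (I : Type) (T : I -> topologicalType) (i : I) :
  continuous ((fun f => f i) : prod_topology T -> T i).
Proof.
move=> f.
have /cvg_sup/(_ i) h : f --> f by apply: cvg_id.
apply: cvg_trans (@initial_continuous _ _ _ f).
apply: cvg_app; exact: h.
Qed.

Lemma continuous_prod (X : topologicalType) (I : Type)
    (T : I -> topologicalType) (f : X -> prod_topology T) :
  (forall i, continuous (fun x => f x i)) -> continuous f.
Proof.
move=> cf x; apply/cvg_sup => i.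
exact: (@continuous_comp_initial _ X _ (fun g : forall i, T i => g i) f (cf i) x).
Qed.

End continuity.

Section tube.

Lemma tube_half (X Y : topologicalType) (K : set X) (D : set (set Y))
    (O : set (X * Y)) :
  compact K -> D setT -> setI_closed D ->
  (forall x, K x -> exists N W, [/\ nbhs x N, D W & N `*` W `<=` O]) ->
  exists V W, [/\ open V, K `<=` V, D W & V `*` W `<=` O].
Proof.
move=> /compact_near_coveringP cK DT DI KO.
pose F : set_system (set Y) := filter_from D (fun W => [set W' | W' `<=` W]).
have FF : Filter F.
  apply: filter_from_filter; first by exists setT.
  move=> W W' DW DW'; exists (W `&` W'); [exact: DI |].
  by move=> Z /=; rewrite subsetI => -[].
pose P (W : set Y) := [set x | forall y, W y -> O (x, y)].
have [x Kx|W DW WK] := cK _ F (fun W x => nbhs x (P W)) FF.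
  have [N [W [Nx DW NW]]] := KO _ Kx.
  exists (N°, [set W' | W' `<=` W]).
    by split; [exact: nbhs_interior | exists W].
  move=> [x' W'] [/= Nx' W'W]; apply: filterS Nx' => z Nz y /W'W Wy.
  exact: (NW (z, y)).
exists (P W)°, W; split=> //; first exact: open_interior.
  by move=> x Kx; exact: (WK W (@subset_refl _ _) x Kx).
by move=> [x y] [/= /interior_subset Px Wy]; exact: Px.
Qed.

Lemma tube (X Y : topologicalType) (A : set X) (B : set Y) (O : set (X * Y)) :
  compact A -> compact B -> open O -> A `*` B `<=` O ->
  exists V W, [/\ open V, A `<=` V, open W, B `<=` W & V `*` W `<=` O].
Proof.
move=> cA cB oO ABO.
have [| | |V [W [oV AV [oW BW] VW]]] :=
    @tube_half X Y A [set W | open W /\ B `<=` W] O cA; last by exists V, W.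
- by split; [exact: openT|].
- move=> W W' [oW BW] [oW' BW']; split; first exact: openI.
  by move=> y By; split; [exact: BW | exact: BW'].
move=> a Aa.
have [| | |V [W [oV BV Wa VW]]] :=
    @tube_half Y X B (nbhs a) [set yx | O (yx.2, yx.1)] cB.
- exact: filterT.
- by move=> N N'; exact: filterI.
- move=> b Bb; have : nbhs (a, b) O by apply: open_nbhs_nbhs; split=> //; apply: ABO.
  by move=> [[N M] [/= Na Mb] NM]; exists M, N; split=> // -[y x] [/= My Nx];
    exact: (NM (x, y)).
- by exists W, V; split=> // -[x y] [/= Wx Vy]; exact: (VW (y, x)).
Qed.

End tube.

Section product.
Context {I : Type}.

Section semigroup.
Variable T : I -> topSemigroupType.

Definition prod_mul (f g : prod_topology T) : prod_topology T :=
  fun i => f i * g i.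

Lemma prod_mulA : associative prod_mul.
Proof. by move=> f g h; apply/functional_extensionality_dep => i; exact: mulgA. Qed.

HB.instance Definition _ := isSemigroup.Build (prod_topology T) prod_mulA.

Lemma prod_mul_continuous :
  continuous (fun xy : prod_topology T * prod_topology T => xy.1 * xy.2).
Proof.
apply: continuous_prod => i; apply: continuous_mulg => x.
- exact: (continuous_comp (@continuous_fst _ _ x) (@continuous_proj _ _ i _)).
- exact: (continuous_comp (@continuous_snd _ _ x) (@continuous_proj _ _ i _)).
Qed.

HB.instance Definition _ :=
  Semigroup_isTopological.Build (prod_topology T) prod_mul_continuous.

End semigroup.

Section group.
Variable T : I -> topGroupType.

Definition prod_one : prod_topology T := fun i => 1.
Definition prod_inv (f : prod_topology T) : prod_topology T :=
  fun i => (f i)^-1.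

Lemma prod_mul1 : left_id prod_one *%g.
Proof. by move=> f; apply/functional_extensionality_dep => i; exact: mul1g. Qed.

Lemma prod_1mul : right_id prod_one *%g.
Proof. by move=> f; apply/functional_extensionality_dep => i; exact: mulg1. Qed.

Lemma prod_mulV : left_inverse prod_one prod_inv *%g.
Proof. by move=> f; apply/functional_extensionality_dep => i; exact: mulVg. Qed.

Lemma prod_Vmul : right_inverse prod_one prod_inv *%g.
Proof. by move=> f; apply/functional_extensionality_dep => i; exact: mulgV. Qed.

HB.instance Definition _ :=
  Semigroup_isMonoid.Build (prod_topology T) prod_mul1 prod_1mul.
HB.instance Definition _ := hasInv.Build (prod_topology T) prod_inv.
HB.instance Definition _ :=
  Monoid_isGroup.Build (prod_topology T) prod_mulV prod_Vmul.

Lemma prod_inv_continuous : continuous (fun x : prod_topology T => x^-1).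
Proof.
apply: continuous_prod => i x.
exact: (continuous_comp (@continuous_proj _ _ i x) (@invg_continuous _ _)).
Qed.

HB.instance Definition _ :=
  Group_isTopological.Build (prod_topology T) prod_inv_continuous.

End group.

End product.

Section hypersemigroup.
Variable G : topGroupType.

Definition hypersemigroup : Type :=
  [set K : set G | compact K /\ K !=set0].

HB.instance Definition _ := Choice.copy hypersemigroup
  (set_type [set K : set G | compact K /\ K !=set0]).

Definition hyper_set (K : hypersemigroup) : set G := set_val K.

Definition vietoris_subbase : set (set hypersemigroup) :=
  [set [set K | hyper_set K `<=` U] | U in open] `|`
  [set [set K | hyper_set K `&` U !=set0] | U in open].

HB.instance Definition _ :=
  isSubBaseTopological.Build hypersemigroup vietoris_subbase id.

Lemma hyper_mul_subproof (A B : hypersemigroup) :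
  [set x * y | x in hyper_set A & y in hyper_set B]
    \in [set K : set G | compact K /\ K !=set0].
Proof.
have [cA [a Aa]] := set_mem (valP A).
have [cB [b Bb]] := set_mem (valP B).
apply/mem_set; split; last by exists (a * b), a => //; exists b.
have -> : [set x * y | x in hyper_set A & y in hyper_set B] =
    (fun xy : G * G => xy.1 * xy.2) @` (hyper_set A `*` hyper_set B).
  rewrite eqEsubset; split=> [_ [x Ax [y By <-]]|_ [[x y] [/= Ax By] <-]].
    by exists (x, y).
  by exists x => //; exists y.
apply: continuous_compact; last exact: compact_setX.
by apply: continuous_subspaceT; exact: mulg_continuous.
Qed.

Definition hyper_mul (A B : hypersemigroup) : hypersemigroup :=
  exist (fun K => K \in _) _ (hyper_mul_subproof A B).

Lemma hyper_mulA : associative hyper_mul.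
Proof.
move=> A B C; apply/val_inj; rewrite /= /hyper_set !set_valE /=.
rewrite eqEsubset; split.
- move=> _ [x Ax [_ [y By [z Cz <-]] <-]].
  by exists (x * y); [exists x => //; exists y | exists z => //; rewrite mulgA].
- move=> _ [_ [x Ax [y By <-]] [z Cz <-]].
  by exists x => //; exists (y * z); [exists y => //; exists z | rewrite mulgA].
Qed.

HB.instance Definition _ := isSemigroup.Build hypersemigroup hyper_mulA.

Lemma hyper_setM (A B : hypersemigroup) :
  hyper_set (A * B) = [set x * y | x in hyper_set A & y in hyper_set B].
Proof. by []. Qed.

Lemma vietoris_open (U : set hypersemigroup) : vietoris_subbase U -> open U.
Proof.
move=> sU; exists [set U]; last by rewrite bigcup_set1.
by move=> _ ->; exact: finI_from1.
Qed.

Lemma vietoris_open_sub (U : set G) :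
  open U -> open [set K : hypersemigroup | hyper_set K `<=` U].
Proof. by move=> oU; apply: vietoris_open; left; exists U. Qed.

Lemma vietoris_open_meets (U : set G) :
  open U -> open [set K : hypersemigroup | hyper_set K `&` U !=set0].
Proof. by move=> oU; apply: vietoris_open; right; exists U. Qed.

Lemma vietoris_cvg (F : set_system hypersemigroup) (K : hypersemigroup) :
  Filter F -> (forall U, vietoris_subbase U -> U K -> F U) -> F --> K.
Proof.
move=> FF FU A; rewrite nbhsE => -[_ [[D sD <-] [B DB BK]] DA].
apply: filterS DA _; apply: (@filterS _ _ _ B); first by move=> L BL; exists B.
have [E sE EB] := sD _ DB; rewrite -EB; apply: filter_bigI => V EV.
apply: FU; first by have := sE _ EV; rewrite inE.
by move: BK; rewrite -EB; apply.
Qed.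

Lemma hyper_mul_continuous :
  continuous (fun AB : hypersemigroup * hypersemigroup => AB.1 * AB.2).
Proof.
move=> [A B]; apply: vietoris_cvg => _ [|] [U oU <-] /=; rewrite hyper_setM.
- move=> ABU.
  have oO : open [set xy : G * G | U (xy.1 * xy.2)].
    by apply: (@open_comp _ _ (fun xy : G * G => xy.1 * xy.2)) => // x _;
      exact: mulg_continuous.
  have [V [W [oV AV oW BW VWU]]] : exists V W,
      [/\ open V, hyper_set A `<=` V, open W, hyper_set B `<=` W &
          V `*` W `<=` [set xy : G * G | U (xy.1 * xy.2)]].
    apply: tube => //; [by have [] := set_mem (valP A)
                       |by have [] := set_mem (valP B)|].
    by move=> [x y] [/= Ax By]; apply: ABU; exists x => //; exists y.
  exists ([set K | hyper_set K `<=` V], [set K | hyper_set K `<=` W]) => /=.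
    by split; apply: open_nbhs_nbhs; split=> //; exact: vietoris_open_sub.
  move=> [K L] [/= KV LW] _ [x /KV Vx [y /LW Wy <-]].
  exact: (VWU (x, y)).
- move=> [_ [[x Ax [y By <-]] Uxy]].
  have : nbhs (x * y) U by apply: open_nbhs_nbhs.
  move=> /(mulg_continuous (x, y)) [[V W] [/= Vx Wy] VW].
  exists ([set K | hyper_set K `&` V° !=set0],
          [set K | hyper_set K `&` W° !=set0]) => /=.
    split; apply: open_nbhs_nbhs; split.
    + by apply: vietoris_open_meets; exact: open_interior.
    + by exists x; split=> //; exact: nbhs_interior.
    + by apply: vietoris_open_meets; exact: open_interior.
    + by exists y; split=> //; exact: nbhs_interior.
  move=> [K L] [/= [k [Kk /interior_subset Vk]] [l [Ll /interior_subset Wl]]].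
  exists (k * l); split; last exact: (VW (k, l)).
  by exists k => //; exists l.
Qed.

HB.instance Definition _ :=
  Semigroup_isTopological.Build hypersemigroup hyper_mul_continuous.

End hypersemigroup.

Section zero_extension.

Definition zero_extension (T : Type) : Type := option T.

Section topology.
Variable T : topologicalType.

HB.instance Definition _ := Choice.copy (zero_extension T) (option T).

Definition zero_open : set (set (zero_extension T)) :=
  [set U | open (Some @^-1` U)].

Lemma zero_openT : zero_open setT.
Proof. exact: openT. Qed.

Lemma zero_openI : setI_closed zero_open.
Proof. by move=> U V; exact: openI. Qed.

Lemma zero_open_bigU (I : Type) (f : I -> set (zero_extension T)) :
  (forall i, zero_open (f i)) -> zero_open (\bigcup_i f i).
Proof.
move=> of_; rewrite /zero_open /= preimage_bigcup.
by apply: bigcup_open => i _; exact: of_.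
Qed.

HB.instance Definition _ := isOpenTopological.Build (zero_extension T)
  zero_openT zero_openI zero_open_bigU.

Lemma nbhs_zero_Some (t : T) (U : set (zero_extension T)) :
  nbhs (Some t : zero_extension T) U <-> nbhs t (Some @^-1` U).
Proof.
rewrite !nbhsE; split=> [[V [oV Vt] VU]|[V [oV Vt] VU]].
  by exists (Some @^-1` V) => // x /VU.
exists (Some @` V); last by move=> _ [x /VU ? <-].
split; last by exists t.
rewrite /open /= /zero_open /=; suff -> : Some @^-1` (Some @` V) = V by [].
by rewrite eqEsubset; split=> [x [y Vy [<-]]//|x Vx]; exists x.
Qed.

Lemma nbhs_zero_None (U : set (zero_extension T)) :
  nbhs (None : zero_extension T) U <-> U None.
Proof.
split=> [/nbhs_singleton//|UN]; rewrite nbhsE; exists [set None].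
  split=> //; rewrite /open /= /zero_open /=.
  have -> : Some @^-1` [set None] = set0 :> set T.
    by rewrite -subset0 => x.
  exact: open0.
by move=> _ ->.
Qed.

End topology.

Variable T : topSemigroupType.

Definition zero_mul (x y : zero_extension T) : zero_extension T :=
  match x, y with
  | Some a, Some b => Some (a * b)
  | _, _ => None
  end.

Lemma zero_mulA : associative zero_mul.
Proof. by move=> [x|] [y|] [z|] //=; rewrite mulgA. Qed.

HB.instance Definition _ := isSemigroup.Build (zero_extension T) zero_mulA.

Lemma zero_mul_continuous :
  continuous (fun xy : zero_extension T * zero_extension T => xy.1 * xy.2).
Proof.
move=> [[a|] [b|]] U /=.
- move=> /nbhs_zero_Some /(mulg_continuous (a, b))[[V W] [/= Va Wb] VW].
  exists (Some @` V, Some @` W) => /=.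
    split; apply/nbhs_zero_Some.
      by apply: filterS Va => x Vx; exists x.
    by apply: filterS Wb => x Wx; exists x.
  by move=> [_ _] [/= [x Vx <-] [y Wy <-]]; exact: (VW (x, y)).
- move=> /nbhs_zero_None UN; exists (setT, [set None]) => /=.
    by split; [exact: filterT | exact/nbhs_zero_None].
  by move=> [[x|] _] [_ /= ->].
- move=> /nbhs_zero_None UN; exists ([set None], setT) => /=.
    by split; [exact/nbhs_zero_None | exact: filterT].
  by move=> [_ y] [/= -> _].
- move=> /nbhs_zero_None UN; exists ([set None], setT) => /=.
    by split; [exact/nbhs_zero_None | exact: filterT].
  by move=> [_ y] [/= -> _].
Qed.

HB.instance Definition _ :=
  Semigroup_isTopological.Build (zero_extension T) zero_mul_continuous.

End zero_extension.

Definition top_automorphism (T : topSemigroupType) (f : T -> T) :=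
  {morph f : x y / x * y} /\
  exists2 g, cancel f g /\ cancel g f & continuous f /\ continuous g.

Record top_action (G : topGroupType) (T : topSemigroupType) := TopAction {
  top_act :> G -> T -> T;
  top_act_aut : forall g, top_automorphism (top_act g);
  top_actM : forall g h, top_act (g * h) = top_act g \o top_act h;
  top_act_continuous : continuous (fun gt : G * T => top_act gt.1 gt.2)
}.

Section semidirect.
Context {G : topGroupType} {T : topSemigroupType}.

Definition semidirect (s : top_action G T) : Type := (T * G)%type.

Variable s : top_action G T.

HB.instance Definition _ := Topological.copy (semidirect s) (T * G)%type.

Definition semidirect_mul (x y : semidirect s) : semidirect s :=
  (x.1 * s x.2 y.1, x.2 * y.2).

Lemma semidirect_mulA : associative semidirect_mul.
Proof.
move=> [x g] [y h] [z k]; rewrite /semidirect_mul /=.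
by have [-> _] := top_act_aut s g; rewrite top_actM /= !mulgA.
Qed.

HB.instance Definition _ := isSemigroup.Build (semidirect s) semidirect_mulA.

Lemma semidirect_mul_continuous :
  continuous (fun xy : semidirect s * semidirect s => xy.1 * xy.2).
Proof.
have c1 : continuous (fun xy : semidirect s * semidirect s =>
    (xy.1 : T * G).1).
  by move=> x; exact: (continuous_comp (@continuous_fst _ _ x)
    (@continuous_fst T G _)).
have c2 : continuous (fun xy : semidirect s * semidirect s =>
    (xy.1 : T * G).2).
  by move=> x; exact: (continuous_comp (@continuous_fst _ _ x)
    (@continuous_snd T G _)).
have c3 : continuous (fun xy : semidirect s * semidirect s =>
    (xy.2 : T * G).1).
  by move=> x; exact: (continuous_comp (@continuous_snd _ _ x)
    (@continuous_fst T G _)).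
have c4 : continuous (fun xy : semidirect s * semidirect s =>
    (xy.2 : T * G).2).
  by move=> x; exact: (continuous_comp (@continuous_snd _ _ x)
    (@continuous_snd T G _)).
move=> x; apply: (@cvg_pair _ _ _ _ (nbhs _) (nbhs _)); last first.
  exact: (continuous_mulg c2 c4).
apply: (continuous_mulg c1) => y.
apply: (@continuous_comp _ _ _
  (fun xy : semidirect s * semidirect s => ((xy.1 : T * G).2, (xy.2 : T * G).1))
  (fun gt : G * T => s gt.1 gt.2)); last exact: top_act_continuous.
by apply: cvg_pair; [exact: c2 | exact: c3].
Qed.

HB.instance Definition _ :=
  Semigroup_isTopological.Build (semidirect s) semidirect_mul_continuous.

End semidirect.

Section semigroup.
Context {S : semigroupType}.

Definition idempotents : set S := [set e | e * e = e].

Definition subgroup_at (e : S) (A : set S) :=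
  [/\ A e,
      forall x y, A x -> A y -> A (x * y),
      forall x, A x -> e * x = x /\ x * e = x &
      forall x, A x -> exists y, [/\ A y, x * y = e & y * x = e]].

(* The largest subgroup with identity [e], see [maximal_subgroupP]; it is empty
   when [e] is not idempotent. *)
Definition maximal_subgroup (e : S) : set S :=
  \bigcup_(A in subgroup_at e) A.

Lemma maximal_subgroupP (e : S) : idempotents e ->
  subgroup_at e (maximal_subgroup e).
Proof.
move=> ee; pose H : set S := [set x | [/\ e * x = x, x * e = x &
  exists y, [/\ e * y = y, y * e = y, x * y = e & y * x = e]]].
have sH : subgroup_at e H.
  split.
  - by split=> //; exists e.
  - move=> x y [ex xe [x' [ex' x'e xx' x'x]]] [ey ye [y' [ey' y'e yy' y'y]]].
    split; [by rewrite mulgA ex|by rewrite -mulgA ye|].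
    exists (y' * x'); split.
    + by rewrite mulgA ey'.
    + by rewrite -mulgA x'e.
    + by rewrite -mulgA [y * _]mulgA yy' ex' xx'.
    + by rewrite -mulgA [x' * _]mulgA x'x ey y'y.
  - by move=> x [].
  - move=> x [ex xe [y [ey ye xy yx]]]; exists y; split=> //.
    by split=> //; exists x.
suff -> : maximal_subgroup e = H by [].
rewrite eqEsubset; split=> [x [A [_ _ Ae AV] Ax]|x Hx]; last by exists H.
have [ex xe] := Ae _ Ax; have [y [/Ae[ey ye] xy yx]] := AV _ Ax.
by split=> //; exists y.
Qed.

Lemma maximal_subgroupM (e x y : S) : maximal_subgroup e x ->
  maximal_subgroup e y -> maximal_subgroup e (x * y).
Proof.
move=> ex ey; have [|_ + _ _] := @maximal_subgroupP e; last exact.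
by case: ex => A [Ae _ /(_ _ Ae)[]].
Qed.

End semigroup.
Arguments idempotents : clear implicits.

Section maximal_subgroup_semigroup.
Context {S : topSemigroupType}.

Definition maxsubgroup (e : S) : Type := maximal_subgroup e.

Variable e : S.

HB.instance Definition _ :=
  Topological.copy (maxsubgroup e) (set_type (maximal_subgroup e)).

Lemma maxsubgroup_mul_subproof (x y : maxsubgroup e) :
  set_val x * set_val y \in maximal_subgroup e.
Proof.
by apply/mem_set/maximal_subgroupM; apply/set_mem; [exact: (valP x)|exact: (valP y)].
Qed.

Definition maxsubgroup_mul (x y : maxsubgroup e) : maxsubgroup e :=
  exist (fun x => x \in _) _ (maxsubgroup_mul_subproof x y).

Lemma maxsubgroup_mulA : associative maxsubgroup_mul.
Proof. by move=> x y z; apply/val_inj; exact: mulgA. Qed.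

HB.instance Definition _ := isSemigroup.Build (maxsubgroup e) maxsubgroup_mulA.

Lemma maxsubgroup_mul_continuous :
  continuous (fun xy : maxsubgroup e * maxsubgroup e => xy.1 * xy.2).
Proof.
apply: continuous_comp_initial.
apply: (@continuous_mulg _ _ (fun xy : maxsubgroup e * maxsubgroup e =>
  set_val xy.1) (fun xy => set_val xy.2)) => x.
- exact: (continuous_comp (@continuous_fst _ _ x)
    (@initial_continuous _ _ set_val _)).
- exact: (continuous_comp (@continuous_snd _ _ x)
    (@initial_continuous _ _ set_val _)).
Qed.

HB.instance Definition _ :=
  Semigroup_isTopological.Build (maxsubgroup e) maxsubgroup_mul_continuous.

End maximal_subgroup_semigroup.

Definition class_H (S : topSemigroupType) :=
  exists2 G : topGroupType, tychonoff_space G & embeds S (hypersemigroup G).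

(* In [class_H0_zero], [T] ranges over all compact members of [class_H], not only
   those already in [class_H0]: this constructor is where non-Abelian groups enter. *)
Inductive class_H0 : topSemigroupType -> Prop :=
| class_H0_subdirect (I : Type) (F : I -> topSemigroupType)
    (S : topSemigroupType) :
    (forall i, class_H0 (F i)) -> embeds S (prod_topology F) -> class_H0 S
| class_H0_semidirect (T : topSemigroupType) (G : topGroupType)
    (s : top_action G T) :
    class_H0 T -> tychonoff_space G -> (forall x y : G, x * y = y * x) ->
    class_H0 (semidirect s)
| class_H0_zero (T : topSemigroupType) :
    class_H T -> compact [set: T] -> class_H0 (zero_extension T).

Definition clifford (S : semigroupType) :=
  forall x : S, exists e A, subgroup_at e A /\ A x.

Definition is_inverse (S : semigroupType) (x y : S) :=
  x * y * x = x /\ y * x * y = y.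

Definition inverse_semigroup (S : semigroupType) :=
  forall x : S, exists! y, is_inverse x y.

Definition topological_inverse_semigroup (S : topSemigroupType) :=
  inverse_semigroup S /\
  exists2 inv : S -> S, (forall x, is_inverse x (inv x)) & continuous inv.

(* Unlike the library's [zero_dimensional], which only asks that clopen sets
   separate points. *)
Definition has_clopen_base (T : topologicalType) := basis (@clopen T).

(* Main.v *)
From HB Require Import structures.
Require Import Defs.
From mathcomp Require Import all_boot all_order all_algebra.
From mathcomp Require Import all_classical all_reals topology normedtype.
From mathcomp Require Import sequences derive urysohn Rstruct.
From mathcomp Require Import ring lra.

(**
Every semigroup in [class_H] or [class_H0] is [tame]: two idempotents whose
product lies in a subgroup commute, and a compact connected band is trivial.  Tameness passes to subsemigroups,
products, semidirect products and zero extensions, so only [exp(G)] matters.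
There, idempotents are compact subgroups; if [K L] lies in a subgroup of
[exp(G)] then it is itself a subgroup, whence [K L = L K].  The union [K] of a
compact connected band [Q] in [exp(G)] is a compact group.  If some [L] in [Q] is
proper, the spectral theorem for a convolution operator on [K] (with respect to
an invariant mean, built by averaging finitely many translates) yields an
eigenspace [V] containing an [L]-invariant nonconstant function [f].  By
compactness [V] is moved little by small translations, which forces the
[X]-invariants of [V] to be locally constant in [X]; hence the subgroups in [Q]
fixing [f] form a clopen set, contradicting connectedness.

A compact tame Clifford semigroup is inverse with continuous inversion (closed
graph), and components of its semilattice [E] are bands, hence trivial.
Conversely if [E] is zero-dimensional then every idempotent is a limit of smaller
idempotents [e] with [{x | e <= x x^-1}] open: [e] is the least element of a
class of the syntactic congruence of a clopen set.  For those [e] the maps sending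
[x] to [e x] if [e <= x x^-1] and to [0] otherwise are continuous and separate
points.  Finally a point of the product of the [H_e^0] is sent to the closed
cylinder of the product group that it defines, and compactness of [S] turns
continuity and injectivity into an embedding.
*)

Set Implicit Arguments.
Unset Strict Implicit.
Unset Printing Implicit Defensive.

Import Order.TTheory GRing.Theory Num.Theory.
Import numFieldNormedType.Exports.

Local Open Scope classical_set_scope.

(** * Topological preliminaries *)

(** Class membership is used only through [tame], whose two clauses can be tested by continuous
    homomorphisms that separate points; this carries the induction over [class_H0]. The obstacle is
    the second clause in [exp(G)]: a compact group may have arbitrarily small subgroups, so a
    subgroup close to a given one is not controlled by it. One eigenspace restores control, because
    there a small translation moves a function by at most half of its sup norm; this bound comes
    straight from the kernel, not from a dimension count. The eigenfunction maximises a Rayleigh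
    quotient, and Arzela-Ascoli supplies the limit. In the passage from [H_e^0] to [exp(G)] zero
    becomes a whole factor, since the whole group times any nonempty set is the whole group again;
    the factor has to differ from a singleton, hence the additional group of order two. The
    implication from [class_H] to [class_H0] itself goes through the zero-dimensional semilattice
    and the product of the [H_e^0], whose factors are compact groups with a zero attached. *)

Lemma hausdorff_openP (T : topologicalType) : hausdorff_space T <->
  forall x y : T, x <> y ->
    exists A B, [/\ open A, open B, A x, B y & forall z, A z -> B z -> False].
Proof.
rewrite open_hausdorff; split=> hT x y xy.
  have [[A B] [/= /set_mem Ax /set_mem By] [oA oB /eqP AB]] := hT x y (introN eqP xy).
  by exists A, B; split=> // z Az Bz; suff : (A `&` B) z by rewrite AB.
have [A [B [oA oB Ax By AB]]] := hT x y (elimN eqP xy).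
exists (A, B); first by split; exact/mem_set.
by split=> //; apply/eqP; rewrite -subset0 => z [/AB]; exact.
Qed.

Lemma closed_equalizer (X Y : topologicalType) (f g : X -> Y) : hausdorff_space Y ->
  continuous f -> continuous g -> closed [set x | f x = g x].
Proof.
move=> /hausdorff_openP hY cf cg; rewrite -[X in closed X]setCK; apply: open_closedC.
rewrite openE => x /= /hY[A [B [oA oB Afx Bgx AB]]].
have nA : nbhs x (f @^-1` A) by apply: cf; exact: open_nbhs_nbhs.
have nB : nbhs x (g @^-1` B) by apply: cg; exact: open_nbhs_nbhs.
by apply: filterS (filterI nA nB) => y [/= Ay By] fgy; apply: (AB (f y)); rewrite // fgy.
Qed.

Lemma continuous_pair (X Y Z : topologicalType) (f : X -> Y) (g : X -> Z) :
  continuous f -> continuous g -> continuous (fun x => (f x, g x)).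
Proof.
by move=> cf cg x; apply: (@cvg_pair _ _ _ _ (nbhs _) (nbhs _)); [exact: cf|exact: cg].
Qed.

Lemma continuous_mulgl (S : topSemigroupType) (a : S) : continuous (fun x => a * x)%g.
Proof. by apply: (@continuous_mulg _ _ (cst a) id) => x; [exact: cvg_cst|exact: cvg_id]. Qed.

Lemma continuous_mulgr (S : topSemigroupType) (a : S) : continuous (fun x => x * a)%g.
Proof. by apply: (@continuous_mulg _ _ id (cst a)) => x; [exact: cvg_id|exact: cvg_cst]. Qed.

Lemma near_compact (X Y : topologicalType) (K : set Y) (P : X -> Y -> Prop)
    (x : X) :
  compact K -> (forall y, K y -> nbhs (x, y) [set p : X * Y | P p.1 p.2]) ->
  nbhs x [set x' | forall y, K y -> P x' y].
Proof.
move=> /compact_near_coveringP cK KP.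
apply: (cK X (nbhs x) (fun x y => P x y)) => y Ky.
have [[A B] /= [Ax By] AB] := KP y Ky.
by exists (B, A) => //= -[y' x'] [/= By' Ax']; exact: (AB (x', y')).
Qed.

(** The compact complement of an open neighbourhood of [f x] misses the graph over [x], hence, by
    [near_compact], over all nearby points. *)
Lemma closed_graph_continuous (X Y : topologicalType) (f : X -> Y) :
  compact [set: Y] -> closed [set p : X * Y | f p.1 = p.2] -> continuous f.
Proof.
move=> cY cf x U; rewrite nbhsE => -[V [oV Vfx] VU].
have : nbhs x [set x' | forall y, (~` V) y -> f x' <> y].
  apply: near_compact.
    by apply: subclosed_compact cY _ => //; exact: open_closedC.
  move=> y Vy; have : open (~` [set p : X * Y | f p.1 = p.2]) by exact: closed_openC.
  rewrite openE; apply; rewrite /= => fxy; apply: Vy; rewrite -fxy; exact: Vfx.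
by apply: filterS => x' fx'; apply: VU; apply: contrapT => /fx'; exact.
Qed.

Lemma compact_embedding (X Y : topologicalType) (f : X -> Y) :
  compact [set: X] -> hausdorff_space Y -> continuous f -> injective f ->
  topological_embedding f.
Proof.
move=> cX hY cf fI; split=> //; rewrite eqEsubset; split=> [U oU|_ [V oV <-]]; last first.
  by apply: open_comp => // x _; exact: cf.
exists (~` (f @` (~` U))).
  apply: closed_openC; apply: compact_closed => //.
  apply: continuous_compact; first exact: continuous_subspaceT.
  by apply: subclosed_compact cX _ => //; exact: open_closedC.
rewrite eqEsubset; split=> x /=.
  by move=> nUx; apply: contrapT => Ux; apply: nUx; exists x.
by move=> Ux [y Uy /fI yx]; apply: Uy; rewrite yx.
Qed.

Lemma embedding_continuous (X Y : topologicalType) (f : X -> Y) :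
  topological_embedding f -> continuous f.
Proof.
move=> [_ fE]; apply/continuousP => A oA; rewrite fE; by exists A.
Qed.

Lemma hausdorff_injective (X Y : topologicalType) (f : X -> Y) :
  hausdorff_space Y -> continuous f -> injective f -> hausdorff_space X.
Proof.
move=> /hausdorff_openP hY cf fI; apply/hausdorff_openP => x y xy.
have [A [B [oA oB Ax By AB]]] := hY (f x) (f y) (contra_not (@fI x y) xy).
exists (f @^-1` A), (f @^-1` B); split=> //; last by move=> z; exact: AB.
  by apply: open_comp => // z _; exact: cf.
by apply: open_comp => // z _; exact: cf.
Qed.

Lemma compact_set_type (X : topologicalType) (A : set X) : compact A ->
  compact [set: set_type A].
Proof.
move=> /compact_near_coveringP cA; apply/compact_near_coveringP => I F P FF AP.
have h : \forall i \near F, A `<=` (fun x => forall a : A, set_val a = x -> P i a).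
  apply: cA => x Ax; have [[N W] [/= Nx FW] NW] := AP (exist _ x (mem_set Ax)) Logic.I.
  have [_ [[V oV <-]] /= Vx VN] := Nx.
  exists (V, W); first by split=> //; exact: open_nbhs_nbhs.
  by move=> [y i] [/= Vy Wi] a ay; apply: (NW (a, i)); split=> //=; apply: VN; rewrite /= ay.
by apply: filterS h => i Wi a _; apply: (Wi (set_val a)) => //; exact: set_valP.
Qed.

Lemma continuous_set_val (X : topologicalType) (A : set X) :
  continuous (set_val : A -> X).
Proof. exact: initial_continuous. Qed.

Lemma set_val_inj (T : Type) (A : set T) : injective (set_val : A -> T).
Proof. by move=> x y; rewrite set_valE => /val_inj. Qed.

(** Clopen neighbourhoods of [x] shrink to [Q] ([refine]). If a relatively clopen piece [B] of [Q]
    contains [x], disjoint open sets around [B] and the rest of [Q] cut a clopen neighbourhood of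
    [x] into two clopen parts; the part around [B] contains [x], hence all of [Q]. *)
Lemma quasi_component_connected (X : topologicalType) (x : X) :
  compact [set: X] -> hausdorff_space X ->
  connected (\bigcap_(C in [set C | clopen C /\ C x]) C).
Proof.
move=> cX hX; set Q := \bigcap_(_ in _) _.
have Qx : Q x by move=> C [].
have cQ : closed Q.
  move=> y clQ C [cC Cx]; apply: cC.2; apply: closureS clQ => z Qz.
  by apply: Qz; split.
have refine (B : set X) : open B -> Q `<=` B -> exists C, [/\ clopen C, C x & C `<=` B].
  move=> oB QB.
  pose F : set_system X := filter_from [set C | clopen C /\ C x] id.
  have FF : Filter F.
    apply: filter_from_filter; first by exists setT; split=> //; exact: clopenT.
    move=> C D [cC Cx] [cD Dx]; exists (C `&` D) => //; split; last by split.
    exact: clopenI.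
  apply: contrapT => nC.
  (* If no clopen [C] fits into [B], these sets generate a proper filter. Its cluster point lies in
     every [C], hence in [Q] and in the open set [B], which the filter avoids. *)
  pose F' : set_system X := filter_from [set C | clopen C /\ C x] (fun C => C `\` B).
  have FF' : ProperFilter F'.
    apply: filter_from_proper.
      apply: filter_from_filter; first by exists setT; split=> //; exact: clopenT.
      move=> C D [cC Cx] [cD Dx]; exists (C `&` D).
        by split; [exact: clopenI|split].
      by move=> y [[Cy Dy] By].
    move=> C [cC Cx]; apply: contrapT => CB; apply: nC; exists C; split=> // y Cy.
    by apply: contrapT => By; apply: CB; exists y.
  have [y [_ clF']] := cX F' FF' (@filterT _ F' _).
  have Qy : Q y.
    move=> C [cC Cx]; have [_ clC] := cC; apply: clC => N Ny.
    have [|z [[Cz _] Nz]] := clF' (C `\` B) N _ Ny; last by exists z.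
    by exists C.
  have yB : nbhs y B by apply: open_nbhs_nbhs; split=> //; exact: QB.
  have [|z [[_ Bz] Bz']] := clF' (setT `\` B) B _ yB; last exact: Bz.
  by exists setT => //; split=> //; exact: clopenT.
have half (B C D : set X) : open C -> closed D -> B = Q `&` C -> B = Q `&` D -> B x -> B = Q.
  move=> oC cD BC BD Bx.
  have cB : closed B by rewrite BD; exact: closedI.
  have cB' : closed (Q `\` B).
    have -> : Q `\` B = Q `&` ~` C.
      by rewrite BC eqEsubset; split=> y [Qy nC]; split=> // Cy; apply: nC => //; case: Cy.
    by apply: closedI => //; exact: open_closedC.
  have oN : open [set p : X * X | p.1 <> p.2].
    apply: closed_openC; apply: closed_equalizer => //.
      exact: continuous_fst.
    exact: continuous_snd.
  have [|||U [V [oU BU oV QV UV]]] := tube (A := B) (B := Q `\` B) _ _ oN.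
  - exact: subclosed_compact cX _.
  - exact: subclosed_compact cX _.
  - by move=> [a b] [/= Ba [_ Bb]] ab; apply: Bb; rewrite -ab.
  have [||E [[oE cE] Ex EUV]] := refine (U `|` V); first exact: openU.
    by move=> y Qy; have [By|By] := pselect (B y); [left; exact: BU|right; exact: QV].
  have UVd y : U y -> V y -> False by move=> Uy Vy; exact: (UV (y, y)).
  have EUE : E `&` U = E `&` ~` V.
    rewrite eqEsubset; split=> y [Ey h]; split=> //; first by move=> /(UVd y h).
    by have [|/h] := EUV y Ey.
  have QE : Q `<=` E `&` U.
    move=> y; apply; split; last by split=> //; exact: BU.
    split; first exact: openI.
    by rewrite EUE; apply: closedI => //; exact: open_closedC.
  rewrite eqEsubset; split=> y; first by rewrite BC => -[].
  move=> Qy; apply: contrapT => By; apply: (UVd y); first exact: (QE y Qy).2.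
  exact: QV.
move=> B [b Bb] [C oC BC] [D cD BD].
have [Bx|Bx] := pselect (B x); first exact: half BC BD Bx.
(* A piece that misses [x] is handled through its complement in [Q]. *)
have QB : Q `\` B = Q.
  apply: (half _ (~` D) (~` C)) => //; first exact: closed_openC.
  - exact: open_closedC.
  - rewrite BD eqEsubset; split=> y [Qy h]; split=> //; first by move=> Dy; apply: h.
    by move=> [].
  - rewrite BC eqEsubset; split=> y [Qy h]; split=> //; first by move=> Cy; apply: h.
    by move=> [].
have : (Q `\` B) b by rewrite QB; move: Bb; rewrite BC => -[].
by case.
Qed.

(** Quasi-components are connected, hence points here, so clopen sets separate points; compactness
    upgrades this to a base. *)
Lemma totally_disconnected_clopen_base (X : topologicalType) :
  compact [set: X] -> hausdorff_space X ->
  (forall (Q : set X), connected Q -> is_subset1 Q) -> has_clopen_base X.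
Proof.
move=> cX hX dX; have zX : zero_dimensional X.
  move=> x y /eqP xy; apply: contrapT => nC; apply: xy.
  apply: (dX _ (quasi_component_connected (x := x) cX hX)); first by move=> C [].
  by move=> C [cC Cx]; apply: contrapT => Cy; apply: nC; exists C.
split; first by move=> C [].
move=> x U Ux; have [C [Cx cC] CU] := zero_dimensional_cvg (x := x) hX zX cX Ux.
by exists C.
Qed.

Section analysis.
Local Open Scope ring_scope.

(** * Invariant means on compact subgroups *)

(** Subgroups remain subsets of one fixed group and functions stay defined on all of [G], so that
    means over different subgroups act on the same functions. *)
Definition compact_subgroup (G : topGroupType) (Z : set G) :=
  [/\ compact Z, Z 1%g, forall x y, Z x -> Z y -> Z (x * y)%g &
      forall x, Z x -> Z x^-1%g].

Lemma compact_seq_cover (X : topologicalType) (I : choiceType) (K : set X)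
    (D : set I) (O : I -> set X) :
  compact K -> (forall i, D i -> open (O i)) ->
  (forall x, K x -> exists2 i, D i & O i x) ->
  exists s : seq I, (forall i, i \in s -> D i) /\
    forall x, K x -> exists2 i, i \in s & O i x.
Proof.
move=> /compact_near_coveringP cK oO KO.
pose F : set_system (seq I) :=
  filter_from [set s : seq I | forall i, i \in s -> D i]
    (fun s => [set t : seq I | {subset s <= t}]).
have FF : Filter F.
  apply: filter_from_filter; first by exists [::].
  move=> s t sD tD; exists (s ++ t).
    by move=> i; rewrite mem_cat => /orP[/sD|/tD].
  by move=> u /= stu; split=> i iu; apply: stu; rewrite mem_cat iu ?orbT.
have [x Kx|s sD sK] := cK _ F (fun t x => exists2 i, i \in t & O i x) FF.
  have [i Di Oix] := KO x Kx; exists (O i, [set t : seq I | i \in t]).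
    split; first by apply: open_nbhs_nbhs; split=> //; exact: oO.
    exists [:: i]; first by move=> j; rewrite inE => /eqP ->.
    by move=> t; apply; rewrite inE.
  by move=> [y t] /= [Oiy it]; exists i.
by exists s; split=> // x Kx; exact: (sK s).
Qed.

Section averages.
Context {R : realType} {G : topGroupType}.
Implicit Types (f g : G -> R) (A B : seq G) (Z : set G).

(** Averages over lists with repetitions: composing two of them gives another one, over the list of
    products ([ravg_allpairs]). *)
Definition ravg A f (x : G) : R := (size A)%:R^-1 * \sum_(a <- A) f (x * a)%g.
Definition lavg B f (x : G) : R := (size B)%:R^-1 * \sum_(b <- B) f (b * x)%g.

Definition seq_in Z A := (0 < size A)%N /\ forall a, a \in A -> Z a.

(** Left and right translations commute. This is the source of the agreement of left and right
    means, and so of uniqueness. *)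
Lemma lravgC A B f : lavg B (ravg A f) = ravg A (lavg B f).
Proof.
apply/funext => x; rewrite /lavg /ravg -!mulr_sumr exchange_big /=.
rewrite mulrCA; congr (_ * (_ * _)).
by apply: eq_bigr => a _; apply: eq_bigr => b _; rewrite mulgA.
Qed.

Lemma ravg_allpairs A B f :
  ravg A (ravg B f) = ravg [seq (a * b)%g | a <- A, b <- B] f.
Proof.
apply/funext => x; rewrite /ravg size_allpairs natrM invfM -mulr_sumr mulrA.
congr (_ * _); rewrite big_allpairs_dep /=.
by apply: eq_bigr => a _; apply: eq_bigr => b _; rewrite mulgA.
Qed.

Lemma sum_le_size (T : eqType) (A : seq T) (F : T -> R) (c : R) :
  (forall a, a \in A -> F a <= c) -> \sum_(a <- A) F a <= (size A)%:R * c.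
Proof.
move=> Fc; rewrite big_seq.
apply: (@le_trans _ _ (\sum_(a <- A | a \in A) c)); first exact: ler_sum.
by rewrite -big_seq big_const_seq count_predT iter_addr addr0 mulr_natl.
Qed.

Lemma seq_in_allpairs Z A B : compact_subgroup Z -> seq_in Z A -> seq_in Z B ->
  seq_in Z [seq (a * b)%g | a <- A, b <- B].
Proof.
move=> [_ _ ZM _] [A0 AZ] [B0 BZ]; split; first by rewrite size_allpairs muln_gt0 A0.
by move=> _ /allpairsP[[a b] /= [/AZ aA /BZ bB ->]]; exact: ZM.
Qed.

Section bounds.
Variables (Z : set G) (A : seq G) (f : G -> R).
Hypotheses (cZ : compact_subgroup Z) (ZA : seq_in Z A).

Let sz : 0 < (size A)%:R :> R.
Proof. by rewrite ltr0n; case: ZA. Qed.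

Lemma ravg_le c : (forall x, Z x -> f x <= c) ->
  forall x, Z x -> ravg A f x <= c.
Proof.
move=> fc x Zx; rewrite /ravg ler_pdivrMl//; apply: sum_le_size => a aA.
by apply: fc; case: cZ => _ _ + _; apply => //; case: ZA => _; exact.
Qed.

Lemma lavg_le c : (forall x, Z x -> f x <= c) ->
  forall x, Z x -> lavg A f x <= c.
Proof.
move=> fc x Zx; rewrite /lavg ler_pdivrMl//; apply: sum_le_size => a aA.
by apply: fc; case: cZ => _ _ + _; apply => //; case: ZA => _; exact.
Qed.

End bounds.

Lemma ravgN A f : ravg A (\- f) = \- ravg A f.
Proof. by apply/funext => x; rewrite /ravg /= sumrN mulrN. Qed.

Lemma lavgN A f : lavg A (\- f) = \- lavg A f.
Proof. by apply/funext => x; rewrite /lavg /= sumrN mulrN. Qed.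

Lemma ravg_ge Z A f c : compact_subgroup Z -> seq_in Z A ->
  (forall x, Z x -> c <= f x) -> forall x, Z x -> c <= ravg A f x.
Proof.
move=> cZ ZA fc x Zx; rewrite -lerN2 -[X in X <= _]/((\- ravg A f) x) -ravgN.
by apply: ravg_le Zx => // y /fc; rewrite /= lerN2.
Qed.

Lemma lavg_ge Z A f c : compact_subgroup Z -> seq_in Z A ->
  (forall x, Z x -> c <= f x) -> forall x, Z x -> c <= lavg A f x.
Proof.
move=> cZ ZA fc x Zx; rewrite -lerN2 -[X in X <= _]/((\- lavg A f) x) -lavgN.
by apply: lavg_le Zx => // y /fc; rewrite /= lerN2.
Qed.

Lemma ravg_near Z A f c e : compact_subgroup Z -> seq_in Z A ->
  (forall x, Z x -> `|f x - c| <= e) -> forall x, Z x -> `|ravg A f x - c| <= e.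
Proof.
move=> cZ ZA fc x Zx; rewrite ler_distl; apply/andP; split.
  by apply: ravg_ge Zx => // y /fc; rewrite ler_distl => /andP[].
by apply: ravg_le Zx => // y /fc; rewrite ler_distl => /andP[].
Qed.

Lemma lavg_near Z A f c e : compact_subgroup Z -> seq_in Z A ->
  (forall x, Z x -> `|f x - c| <= e) -> forall x, Z x -> `|lavg A f x - c| <= e.
Proof.
move=> cZ ZA fc x Zx; rewrite ler_distl; apply/andP; split.
  by apply: lavg_ge Zx => // y /fc; rewrite ler_distl => /andP[].
by apply: lavg_le Zx => // y /fc; rewrite ler_distl => /andP[].
Qed.

Definition left_small Z (U : set G) (e : R) f :=
  forall u x, U u -> Z x -> Z (u * x)%g -> `|f (u * x)%g - f x| <= e.

(** The modulus concerns left translations, which right averages do not disturb; so it survives any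
    number of averaging steps. *)
Lemma left_small_ravg Z A U e f : compact_subgroup Z -> seq_in Z A ->
  left_small Z U e f -> left_small Z U e (ravg A f).
Proof.
move=> cZ ZA fU u x Uu Zx Zux; rewrite /ravg -mulrBr -sumrB.
have sz : 0 < (size A)%:R :> R by rewrite ltr0n; case: ZA.
rewrite normrM ger0_norm ?invr_ge0 ?(ltW sz)// ler_pdivrMl//.
apply: le_trans (ler_norm_sum _ _ _) _; apply: sum_le_size => a aA.
have [_ _ ZM _] := cZ; have Za := ZA.2 _ aA.
by rewrite -mulgA; apply: fU => //; [exact: ZM|rewrite mulgA; exact: ZM].
Qed.

Definition osc_le Z (D : R) f :=
  exists m, forall x, Z x -> m <= f x <= m + D.

(* One averaging step: [A] runs over the quotients of a finite net, so every [x]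
   is moved by some [a] in [A] close to an almost minimum of [f]. *)
Lemma ravg_contract Z U e : compact_subgroup Z -> nbhs 1%g U -> 0 < e ->
  exists2 A, seq_in Z A & forall D f, left_small Z U e f -> osc_le Z D f ->
    osc_le Z ((1 - (size A)%:R^-1) * D + (size A)%:R^-1 * (3 * e)) (ravg A f).
Proof.
move=> cZ U1 e0; have [Zc Z1 ZM ZV] := cZ.
pose O (c : G) : set G := [set x | U° (x * c^-1)%g].
have oO c : Z c -> open (O c).
  move=> _; apply: (@open_comp _ _ (fun x => (x * c^-1)%g) (U°)); last first.
    exact: open_interior.
  by move=> x _; exact: continuous_mulgr.
have ZO x : Z x -> exists2 c, Z c & O c x.
  by move=> Zx; exists x => //; rewrite /O /= mulgV; exact: nbhs_singleton (nbhs_interior U1).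
have [s [sZ Zs]] := compact_seq_cover Zc oO ZO.
pose A := [seq (c^-1 * d)%g | c <- s, d <- s].
have ZA : seq_in Z A.
  split.
    have [c cs _] := Zs _ Z1.
    by rewrite size_allpairs muln_gt0 andbb; case: (s) cs.
  by move=> _ /allpairsP[[c d] /= [/sZ Zc' /sZ Zd ->]]; apply: ZM => //; exact: ZV.
exists A => // D f fU [m fm].
have sz : 0 < (size A)%:R :> R by rewrite ltr0n; case: ZA.
pose S := f @` Z.
have hS : has_inf S.
  split; first by exists (f 1%g), 1%g.
  by exists m => _ [x Zx <-]; case/andP: (fm x Zx).
have [_ [x0 Zx0 <-] fx0] := inf_adherent e0 hS.
set m1 := inf S in fx0; exists m1 => x Zx; apply/andP; split.
  by apply: ravg_ge Zx => // y Zy; apply: ge_inf; [exact: hS.2|exists y].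
have [c cs Ocx] := Zs _ Zx; have [d ds Odx] := Zs _ Zx0.
have Zc' := sZ _ cs; have Zd := sZ _ ds.
have aA : (c^-1 * d)%g \in A by apply/allpairsP; exists (c, d).
(* One [e] for [x0] almost attaining the infimum, one for replacing [x0] by its net point [d], one
   for moving [x] from its net point [c]. *)
have small : f (x * (c^-1 * d))%g <= m1 + 3 * e.
  have h1 : `|f (x * (c^-1 * d))%g - f d| <= e.
    rewrite mulgA; apply: fU => //; first exact: interior_subset Ocx.
    exact: ZM _ _ (ZM _ _ Zx (ZV _ Zc')) Zd.
  have h2 : `|f x0 - f d| <= e.
    have := @fU (x0 * d^-1)%g d (interior_subset Odx) Zd.
    by rewrite -mulgA mulVg mulg1; apply.
  move: h1 h2; rewrite !ler_distl => /andP[_ h1] /andP[h2 h3].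
  by move: fx0 h1 h2; lra.
have big y : Z y -> f y <= m1 + D.
  move=> Zy; have /andP[_ fy] := fm y Zy; apply: le_trans fy _; rewrite lerD2r.
  by apply: lb_le_inf; [exact: hS.1|move=> _ [z Zz <-]; case/andP: (fm z Zz)].
(* The translate found above contributes at most [m1 + 3 * e], each remaining term at most
   [m1 + D]. *)
rewrite /ravg ler_pdivrMl// (big_rem _ aA) /=.
have sr : size A = (size (rem (c^-1 * d)%g A)).+1.
  by rewrite size_rem// prednK//; case: ZA.
have : \sum_(a <- rem (c^-1 * d)%g A) f (x * a)%g <=
    (size (rem (c^-1 * d)%g A))%:R * (m1 + D).
  apply: sum_le_size => a /mem_rem /ZA.2 Za; exact/big/ZM.
move: sz; rewrite sr; set k := (size (rem _ _))%:R => sz hk.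
have kE : (size (rem (c^-1 * d)%g A)).+1%:R = k + 1 :> R by rewrite -addn1 natrD.
rewrite kE in sz *.
have -> : (k + 1) * (m1 + ((1 - (k + 1)^-1) * D + (k + 1)^-1 * (3 * e))) =
  k * (m1 + D) + (m1 + 3 * e) by field; rewrite gt_eqF.
by move: small hk; lra.
Qed.

Lemma ravg_iter Z A k : compact_subgroup Z -> seq_in Z A ->
  exists2 B, seq_in Z B & forall f, iter k (ravg A) f = ravg B f.
Proof.
move=> cZ ZA; elim: k => [|k [B ZB IH]].
  exists [:: 1%g]; first by split => // a; rewrite inE => /eqP ->; case: cZ.
  by move=> f; apply/funext => x; rewrite /ravg /= big_seq1 invr1 mul1r mulg1.
exists [seq (a * b)%g | a <- A, b <- B]; first exact: seq_in_allpairs.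
by move=> f; rewrite iterS IH ravg_allpairs.
Qed.

(** Iterating [ravg_contract] drives the oscillation geometrically to its fixed point [3 * e];
    stopping once [q ^+ k * D <= e] gives [4 * e]. The list depends only on [Z], [U], [e] and [D],
    so it serves a whole family of functions at once, as [mean_exchange] requires. *)
Lemma ravg_uniform Z U e D : compact_subgroup Z -> nbhs 1%g U -> 0 < e ->
  exists2 A, seq_in Z A & forall f, left_small Z U e f -> osc_le Z D f ->
    exists c, forall x, Z x -> `|ravg A f x - c| <= 4 * e.
Proof.
move=> cZ U1 e0; have [A ZA AP] := ravg_contract cZ U1 e0.
have sz : 1 <= (size A)%:R :> R by rewrite ler1n; case: ZA.
set q : R := 1 - (size A)%:R^-1.
have q0 : 0 <= q by rewrite subr_ge0 invf_le1// (lt_le_trans ltr01).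
have q1 : q < 1 by rewrite ltrBlDr ltrDl invr_gt0 (lt_le_trans ltr01).
have step k f : left_small Z U e f -> osc_le Z D f ->
    left_small Z U e (iter k (ravg A) f) /\
    osc_le Z (q ^+ k * D + (1 - q ^+ k) * (3 * e)) (iter k (ravg A) f).
  move=> fU fD; elim: k => [|k [IH1 IH2]].
    by split=> //; rewrite expr0 mul1r subrr mul0r addr0.
  split; first exact: left_small_ravg.
  have := AP _ _ IH1 IH2; rewrite iterS -/q.
  have -> : (size A)%:R^-1 = 1 - q by rewrite /q opprB addrC subrK.
  suff -> : q * (q ^+ k * D + (1 - q ^+ k) * (3 * e)) + (1 - q) * (3 * e) =
    q ^+ k.+1 * D + (1 - q ^+ k.+1) * (3 * e) by [].
  by rewrite exprS; ring.
have [k qk] : exists k, q ^+ k * D <= e.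
  (* Nothing bounds [D] away from zero, so [D] itself cannot be the denominator. *)
  have D0 : 0 < `|D| + 1 by rewrite ltr_wpDl.
  have /cvgrPdist_lt/(_ (e / (`|D| + 1))) : (fun k => q ^+ k) @ \oo --> (0 : R).
    by apply: cvg_expr; rewrite ger0_norm.
  rewrite divr_gt0// => /(_ isT) [k _ /(_ k (leqnn k)) /=].
  rewrite sub0r normrN ger0_norm ?exprn_ge0// ltr_pdivlMr// => qk.
  exists k; apply: le_trans (ltW qk); apply: ler_wpM2l; first exact: exprn_ge0.
  by rewrite (le_trans (ler_norm _))// lerDl.
have [B ZB BE] := ravg_iter k cZ ZA.
exists B => // f fU fD; have [_ [m mP]] := step k f fU fD.
have qk0 : 0 <= q ^+ k by exact: exprn_ge0.
exists m => x Zx; rewrite -BE; have /andP[h1 h2] := mP x Zx.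
rewrite ler_distl; apply/andP; split; first by move: h1 e0; lra.
have : (1 - q ^+ k) * (3 * e) <= 3 * e.
  rewrite -[leRHS]mul1r ler_wpM2r ?mulr_ge0 ?(ltW e0)//.
  by rewrite lerBlDr lerDl.
by move: h2 qk; lra.
Qed.

End averages.

Lemma compact_close (R : realType) (X Y : topologicalType) (K : set Y)
    (F : X -> Y -> R) (x0 : X) (e : R) :
  continuous (fun p : X * Y => F p.1 p.2) -> compact K -> 0 < e ->
  nbhs x0 [set x | forall y, K y -> `|F x y - F x0 y| <= e].
Proof.
move=> cF cK e0; apply: (@near_compact X Y K (fun x y => `|F x y - F x0 y| <= e)) => //.
move=> y Ky; have e20 : 0 < e / 2 by rewrite divr_gt0.
have /cvgrPdist_lt/(_ _ e20) := cF (x0, y).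
move=> [[A B] /= [Ax By] AB]; exists (A, B) => // -[x y'] [/= Ax' By'].
have := AB (x, y') (conj Ax' By').
have := AB (x0, y') (conj (nbhs_singleton Ax) By').
rewrite /= !ltr_distl ler_distl => /andP[h1 h2] /andP[h3 h4].
by apply/andP; split; lra.
Qed.

Lemma left_small_nbhs (R : realType) (G : topGroupType) (Z : set G) (f : G -> R) e :
  continuous f -> compact Z -> 0 < e ->
  exists2 U, nbhs 1%g U & left_small Z U e f.
Proof.
move=> cf cZ e0.
exists [set u | forall x, Z x -> `|f (u * x)%g - f x| <= e].
  have h : continuous (fun p : G * G => f (p.1 * p.2)%g).
    move=> p; apply: (@continuous_comp _ _ _ (fun p : G * G => (p.1 * p.2)%g) f).
      exact: mulg_continuous.
    exact: cf.
  apply: filterS (compact_close (F := fun u x => f (u * x)%g) 1%g h cZ e0).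
  by move=> u /= hu x Zx; have := hu x Zx; rewrite mul1g.
by move=> u x Uu Zx _; exact: Uu.
Qed.

Lemma compact_norm_max (R : realType) (X : topologicalType) (K : set X) (f : X -> R) :
  compact K -> K !=set0 -> continuous f ->
  exists2 x0, K x0 & forall x, K x -> `|f x| <= `|f x0|.
Proof.
move=> cK K0 cf; have [|x0 /set_mem Kx0 fx0] := @compact_EVT_max X R (fun x => `|f x|) K K0 cK.
  apply: continuous_subspaceT => x.
  apply: (@continuous_comp _ _ _ f Num.norm); [exact: cf|exact: norm_continuous].
by exists x0 => // x Kx; apply: fx0; exact/mem_set.
Qed.

Section mean.
Context {R : realType} {G : topGroupType} (Z : set G).
Hypothesis cZ : compact_subgroup Z.
Implicit Types (f g : G -> R) (A B : seq G).

Let Zc : compact Z. Proof. by case: cZ. Qed.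
Let Z1 : Z 1%g. Proof. by case: cZ. Qed.
Let ZM x y : Z x -> Z y -> Z (x * y)%g. Proof. by case: cZ => _ _ + _; exact. Qed.
Let ZV x : Z x -> Z x^-1%g. Proof. by case: cZ => _ _ _; exact. Qed.

Definition is_rmean f c :=
  forall e, 0 < e -> exists2 A, seq_in Z A & forall x, Z x -> `|ravg A f x - c| <= e.

Definition is_lmean f c :=
  forall e, 0 < e -> exists2 A, seq_in Z A & forall x, Z x -> `|lavg A f x - c| <= e.

(** The normalised Haar integral over [Z], obtained by averaging translates in the manner of von
    Neumann. Taking a supremum of lower bounds makes it a total function; for continuous [f] its
    meaning is given by [mean_spec]. *)
Definition mean f : R :=
  sup [set c | exists2 A, seq_in Z A & forall x, Z x -> c <= ravg A f x].

(** At [1], [lavg B (ravg A f)] is at least [l] and [ravg A (lavg B g)] is at most [u]; [lravgC]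
    makes the two comparable. *)
Lemma ravg_le_lavg A B f g l u : seq_in Z A -> seq_in Z B ->
  (forall x, Z x -> f x <= g x) ->
  (forall x, Z x -> l <= ravg A f x) -> (forall x, Z x -> lavg B g x <= u) ->
  l <= u.
Proof.
move=> ZA ZB fg fl gu.
have h1 := lavg_ge cZ ZB fl Z1; have h2 := ravg_le cZ ZA gu Z1.
apply: le_trans h1 (le_trans _ h2); rewrite lravgC.
rewrite /ravg ler_wpM2l ?invr_ge0//; rewrite big_seq [leRHS]big_seq; apply: ler_sum.
move=> a aA; rewrite /lavg ler_wpM2l ?invr_ge0// big_seq [leRHS]big_seq.
apply: ler_sum => b bB; apply: fg; apply: ZM; first exact: ZB.2.
by apply: ZM => //; exact: ZA.2.
Qed.

Lemma le_rmean_lmean f g c d : (forall x, Z x -> f x <= g x) ->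
  is_rmean f c -> is_lmean g d -> c <= d.
Proof.
move=> fg fc gd; apply/ler_addgt0Pr => e e0; have e20 : 0 < e / 2 by rewrite divr_gt0.
have [A ZA fA] := fc _ e20; have [B ZB gB] := gd _ e20.
have : c - e / 2 <= d + e / 2.
  apply: (ravg_le_lavg ZA ZB fg) => x Zx.
    by have := fA x Zx; rewrite ler_distl => /andP[].
  by have := gB x Zx; rewrite ler_distl => /andP[].
by lra.
Qed.

Lemma is_rmeanN f c : is_rmean f c -> is_rmean (\- f) (- c).
Proof.
move=> fc e /fc[A ZA fA]; exists A => // x Zx.
by rewrite ravgN /= -opprD normrN; exact: fA.
Qed.

Lemma is_lmeanN f c : is_lmean f c -> is_lmean (\- f) (- c).
Proof.
move=> fc e /fc[A ZA fA]; exists A => // x Zx.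
by rewrite lavgN /= -opprD normrN; exact: fA.
Qed.

Lemma rmean_lmean f c d : is_rmean f c -> is_lmean f d -> c = d.
Proof.
move=> fc fd; apply/eqP; rewrite eq_le (le_rmean_lmean _ fc fd)//=.
by rewrite -lerN2; apply: (le_rmean_lmean _ (is_rmeanN fc) (is_lmeanN fd)).
Qed.

Lemma ravg_near_constant f e : continuous f -> 0 < e ->
  exists2 A, seq_in Z A & exists c, forall x, Z x -> `|ravg A f x - c| <= e.
Proof.
move=> cf e0; have e40 : 0 < e / 4 by rewrite divr_gt0.
have [U U1 fU] := left_small_nbhs cf Zc e40.
have [|x0 Zx0 fx0] := compact_norm_max Zc _ cf; first by exists 1%g.
have [A ZA AP] := ravg_uniform (2 * `|f x0|) cZ U1 e40.
exists A => //; have [|c cP] := AP f fU.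
  exists (- `|f x0|) => x /fx0; rewrite ler_norml => /andP[h1 h2].
  by apply/andP; split; lra.
by exists c => x /cP; have -> : 4 * (e / 4) = e by field.
Qed.

Lemma lavg_near_constant f e : continuous f -> 0 < e ->
  exists2 A, seq_in Z A & exists c, forall x, Z x -> `|lavg A f x - c| <= e.
Proof.
move=> cf e0.
have cf' : continuous (fun x => f x^-1%g).
  by move=> x; apply: (@continuous_comp _ _ _ _ f); [exact: invg_continuous|exact: cf].
have [A [A0 AZ] [c Ac]] := ravg_near_constant cf' e0.
exists (map (fun x => x^-1%g) A).
  by split; rewrite ?size_map// => _ /mapP[a /AZ Za ->]; exact: ZV.
exists c => x Zx; have := Ac _ (ZV Zx); rewrite /ravg /lavg size_map big_map.
by rewrite /= (eq_bigr (fun a => f (a^-1 * x)%g)) // => a _; rewrite invgM invgK.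
Qed.

(** Take constants [c] and [d] within [e] of a right and a left average. By [ravg_le_lavg], for [f]
    and for [\- f], they differ by at most [2 * e], and the supremum lies between [c - e] and
    [d + e]; hence the error [4 * e]. *)
Lemma mean_spec f : continuous f -> is_rmean f (mean f) /\ is_lmean f (mean f).
Proof.
move=> cf; set S := [set c | exists2 A, seq_in Z A & forall x, Z x -> c <= ravg A f x].
have key e : 0 < e ->
    (exists2 A, seq_in Z A & forall x, Z x -> `|ravg A f x - sup S| <= 4 * e) /\
    (exists2 A, seq_in Z A & forall x, Z x -> `|lavg A f x - sup S| <= 4 * e).
  move=> e0.
  have [A ZA [c Ac]] := ravg_near_constant cf e0.
  have [B ZB [d Bd]] := lavg_near_constant cf e0.
  have Sd l : S l -> l <= d + e.
    move=> [A' ZA' fA']; apply: (ravg_le_lavg ZA' ZB _ fA') => // x Zx.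
    by have := Bd x Zx; rewrite ler_distl => /andP[].
  have Sc : S (c - e).
    by exists A => // x /Ac; rewrite ler_distl => /andP[].
  have h1 : sup S <= d + e by apply: ge_sup; [exists (c - e)|].
  have h2 : c - e <= sup S.
    by apply: ub_le_sup => //; exists (d + e).
  have h3 : - (c + e) <= - (d - e).
    apply: (@ravg_le_lavg A B (\- f) (\- f)) => // x Zx.
      by rewrite ravgN /= lerN2; have := Ac x Zx; rewrite ler_distl => /andP[].
    by rewrite lavgN /= lerN2; have := Bd x Zx; rewrite ler_distl => /andP[].
  split; [exists A => // x /Ac|exists B => // x /Bd];
    rewrite !ler_distl => /andP[h4 h5]; apply/andP; move: h1 h2 h3 h4 h5; clear; split; lra.
by split=> e e0; have [] := key (e / 4); rewrite ?divr_gt0//;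
  have -> : 4 * (e / 4) = e by field.
Qed.

Lemma rmeanE f c : continuous f -> is_rmean f c -> mean f = c.
Proof. by move=> cf fc; apply/esym/(rmean_lmean fc); case: (mean_spec cf). Qed.

Lemma lmeanE f c : continuous f -> is_lmean f c -> mean f = c.
Proof. by move=> cf; apply: rmean_lmean; case: (mean_spec cf). Qed.

Lemma mean_le f g : continuous f -> continuous g ->
  (forall x, Z x -> f x <= g x) -> mean f <= mean g.
Proof.
move=> /mean_spec[fc _] /mean_spec[_ gc] fg; exact: (le_rmean_lmean fg fc gc).
Qed.

Lemma eq_mean f g : continuous f -> continuous g ->
  (forall x, Z x -> f x = g x) -> mean f = mean g.
Proof.
by move=> cf cg fg; apply/eqP; rewrite eq_le !mean_le// => x /fg ->.
Qed.

Let cont_right f a : continuous f -> continuous (fun x => f (x * a)%g).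
Proof.
move=> cf x; apply: (@continuous_comp _ _ _ (fun x => x * a)%g f); last exact: cf.
exact: continuous_mulgr.
Qed.

Let cont_left f a : continuous f -> continuous (fun x => f (a * x)%g).
Proof.
move=> cf x; apply: (@continuous_comp _ _ _ (fun x => a * x)%g f); last exact: cf.
exact: continuous_mulgl.
Qed.

Lemma continuous_bigsum (X : topologicalType) (I : Type) (s : seq I) (F : I -> X -> R) :
  (forall i, continuous (F i)) -> continuous (fun x => \sum_(i <- s) F i x).
Proof.
move=> cF x; elim: s => [|i s IH].
  have -> : (fun x => \sum_(i <- [::]) F i x) = cst 0.
    by apply/funext => y; rewrite big_nil.
  exact: cvg_cst.
have -> : (fun x => \sum_(j <- i :: s) F j x) = (fun x => F i x + \sum_(j <- s) F j x).
  by apply/funext => y; rewrite big_cons.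
by apply: cvgD; [exact: cF|].
Qed.

Let cont_sum (I : Type) (s : seq I) (F : I -> G -> R) (k : R) :
  (forall i, continuous (F i)) -> continuous (fun x => k * \sum_(i <- s) F i x).
Proof.
move=> cF x; apply: cvgM; first exact: cvg_cst.
exact: continuous_bigsum.
Qed.

Lemma continuous_ravg A f : continuous f -> continuous (ravg A f).
Proof. by move=> cf; apply: cont_sum => a; exact: cont_right. Qed.

Lemma continuous_lavg A f : continuous f -> continuous (lavg A f).
Proof. by move=> cf; apply: cont_sum => a; exact: cont_left. Qed.

(** A right translation merely evaluates the left averages at another point of [Z], so the left mean
    does not see it. [mean_left] is the mirror image, with right averages. *)
Lemma mean_right f a : continuous f -> Z a -> mean (fun x => f (x * a)%g) = mean f.
Proof.
move=> cf Za; apply: lmeanE; first exact: cont_right.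
move=> e e0; have [A ZA fA] := (mean_spec cf).2 e e0.
exists A => // x Zx; have := fA _ (ZM Zx Za); rewrite /lavg.
by under eq_bigr do rewrite mulgA.
Qed.

Lemma mean_left f a : continuous f -> Z a -> mean (fun x => f (a * x)%g) = mean f.
Proof.
move=> cf Za; apply: rmeanE; first exact: cont_left.
move=> e e0; have [A ZA fA] := (mean_spec cf).1 e e0.
exists A => // x Zx; have := fA _ (ZM Za Zx); rewrite /ravg.
by under eq_bigr do rewrite -mulgA.
Qed.

Lemma mean_ravg A f : continuous f -> seq_in Z A -> mean (ravg A f) = mean f.
Proof.
move=> cf ZA; apply: lmeanE; first exact: continuous_ravg.
move=> e e0; have [B ZB fB] := (mean_spec cf).2 e e0.
by exists B => // x Zx; rewrite lravgC; apply: (ravg_near cZ ZA fB).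
Qed.

Lemma mean_lavg A f : continuous f -> seq_in Z A -> mean (lavg A f) = mean f.
Proof.
move=> cf ZA; apply: rmeanE; first exact: continuous_lavg.
move=> e e0; have [B ZB fB] := (mean_spec cf).1 e e0.
by exists B => // x Zx; rewrite -lravgC; apply: (lavg_near cZ ZA fB).
Qed.

Lemma mean_cst c : mean (cst c) = c.
Proof.
apply: rmeanE; first by move=> x; exact: cvg_cst.
move=> e e0; exists [:: 1%g]; first by split=> // a; rewrite inE => /eqP ->.
by move=> x Zx; rewrite /ravg big_seq1 invr1 mul1r subrr normr0 ltW.
Qed.

Lemma meanD f g : continuous f -> continuous g ->
  mean (fun x => f x + g x) = mean f + mean g.
Proof.
move=> cf cg; apply: lmeanE; first by move=> x; apply: cvgD; [exact: cf|exact: cg].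
move=> e e0; have e20 : 0 < e / 2 by rewrite divr_gt0.
have [A ZA fA] := (mean_spec cf).2 _ e20.
(* [B] is chosen after [A], for the averaged [g], whose mean is unchanged; averaging [f] further
   over [B] keeps it as close to its mean as [A] made it. *)
have [B ZB gB] := (mean_spec (continuous_lavg (A := A) cg)).2 _ e20.
rewrite mean_lavg// in gB.
have lcomp h x : lavg B (lavg A h) x = lavg [seq (a * b)%g | b <- B, a <- A] h x.
  rewrite /lavg size_allpairs natrM invfM -mulr_sumr mulrA; congr (_ * _).
  rewrite big_allpairs_dep /=.
  by apply: eq_bigr => a _; apply: eq_bigr => b _; rewrite mulgA.
exists [seq (a * b)%g | b <- B, a <- A].
  have [A0 AZ] := ZA; have [B0 BZ] := ZB.
  split; first by rewrite size_allpairs muln_gt0 A0 B0.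
  by move=> _ /allpairsP[[a b] /= [/BZ aA /AZ bB ->]]; exact: ZM.
move=> x Zx; rewrite -lcomp.
have -> : lavg B (lavg A (fun x => f x + g x)) x =
    lavg B (lavg A f) x + lavg B (lavg A g) x.
  rewrite /lavg -mulrDr -big_split /=; congr (_ * _); apply: eq_bigr => b _.
  by rewrite -mulrDr -big_split.
have := lavg_near cZ ZB fA Zx; have := gB x Zx.
rewrite !ler_distl => /andP[h1 h2] /andP[h3 h4].
by apply/andP; move: h1 h2 h3 h4; clear; split; lra.
Qed.

Lemma meanZ k f : continuous f -> mean (fun x => k * f x) = k * mean f.
Proof.
move=> cf; apply: rmeanE.
  by move=> x; apply: cvgM; [exact: cvg_cst|exact: cf].
move=> e e0; have k0 : 0 < `|k| + 1 by rewrite ltr_wpDl.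
have [A ZA fA] := (mean_spec cf).1 _ (divr_gt0 e0 k0).
exists A => // x /fA; rewrite /ravg -mulr_sumr mulrCA -mulrBr normrM.
set y := `|_ - _|; rewrite ler_pdivlMr// => ye; apply: le_trans ye.
by rewrite mulrDr mulr1 mulrC lerDl normr_ge0.
Qed.

Lemma meanB f g : continuous f -> continuous g ->
  mean (fun x => f x - g x) = mean f - mean g.
Proof.
move=> cf cg; have cg' : continuous (fun x => (-1) * g x).
  by move=> x; apply: cvgM; [exact: cvg_cst|exact: cg].
under eq_fun do rewrite -[X in _ + X]mulN1r.
by rewrite meanD// meanZ// mulN1r.
Qed.

Lemma mean_sum (I : Type) (s : seq I) (F : I -> G -> R) :
  (forall i, continuous (F i)) ->
  mean (fun x => \sum_(i <- s) F i x) = \sum_(i <- s) mean (F i).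
Proof.
move=> cF; elim: s => [|i s IH].
  by under eq_fun do rewrite big_nil; rewrite big_nil; exact: mean_cst.
under eq_fun do rewrite big_cons; rewrite big_cons meanD ?IH//.
exact: continuous_bigsum.
Qed.

Lemma mean_ge0 f : continuous f -> (forall x, Z x -> 0 <= f x) -> 0 <= mean f.
Proof.
move=> cf f0; rewrite -(mean_cst 0); apply: mean_le => //.
by move=> x; exact: cvg_cst.
Qed.

Lemma mean_close f g e : continuous f -> continuous g ->
  (forall x, Z x -> `|f x - g x| <= e) -> `|mean f - mean g| <= e.
Proof.
move=> cf cg fg; have ce : continuous (fun x => g x + cst e x).
  by move=> x; apply: cvgD; [exact: cg|exact: cvg_cst].
have ce' : continuous (fun x => f x + cst e x).
  by move=> x; apply: cvgD; [exact: cf|exact: cvg_cst].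
have cc : continuous (cst e : G -> R) by move=> x; exact: cvg_cst.
have h1 : mean f <= mean g + e.
  rewrite -[in leRHS](mean_cst e) -meanD//; apply: mean_le => // x /fg.
  by rewrite ler_distl => /andP[].
have h2 : mean g <= mean f + e.
  rewrite -[in leRHS](mean_cst e) -meanD//; apply: mean_le => // x /fg.
  by rewrite ler_distl lerBlDr => /andP[].
by rewrite ler_distl h1 lerBlDr h2.
Qed.

Lemma mean_norm_le f c : continuous f -> (forall x, Z x -> `|f x| <= c) ->
  `|mean f| <= c.
Proof.
move=> cf fc; rewrite -[mean f]subr0 -(mean_cst 0); apply: mean_close => //.
  by move=> x; exact: cvg_cst.
by move=> x /fc; rewrite /cst subr0.
Qed.

(** Finitely many translates of the open set where [f] exceeds [f z / 2] cover [Z], so some average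
    of [f], which has the same mean, is bounded below by a positive constant. *)
Lemma mean_gt0 f z : continuous f -> (forall x, Z x -> 0 <= f x) -> Z z -> 0 < f z ->
  0 < mean f.
Proof.
move=> cf f0 Zz fz; have fz2 : 0 < f z / 2 by rewrite divr_gt0.
have [A [AZ ZA]] : exists A, (forall a, a \in A -> Z a) /\
    forall x, Z x -> exists2 a, a \in A & f z / 2 < f (x * a)%g.
  apply: (@compact_seq_cover _ _ Z Z (fun a x => f z / 2 < f (x * a)%g) Zc).
    move=> a Za; have := @open_comp _ _ (fun x => f (x * a)%g) [set r | f z / 2 < r].
    by apply; [move=> x _; exact: cont_right|exact: open_gt].
  move=> x Zx; exists (x^-1 * z)%g; first exact: ZM (ZV Zx) Zz.
  by rewrite mulgA mulgV mul1g ltr_pdivrMr// ltr_pMr// ltr1n.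
have A0 : seq_in Z A.
  by split=> //; have [a] := ZA _ Z1; case: (A).
rewrite -(mean_ravg cf A0).
have sz : 0 < (size A)%:R :> R by rewrite ltr0n; case: A0.
apply: (@lt_le_trans _ _ ((size A)%:R^-1 * (f z / 2))).
  by rewrite mulr_gt0// invr_gt0.
rewrite -[leLHS](mean_cst); apply: mean_le.
- by move=> x; exact: cvg_cst.
- exact: continuous_ravg.
move=> x Zx; rewrite /ravg ler_wpM2l ?invr_ge0 ?(ltW sz)//.
have [a aA fxa] := ZA x Zx; rewrite (big_rem _ aA) /=.
apply: le_trans (ltW fxa) _; rewrite lerDl big_seq; apply: sumr_ge0 => b /mem_rem bA.
by apply: f0; apply: ZM => //; exact: AZ.
Qed.

Lemma continuous_mean (X : topologicalType) (F : X -> G -> R) :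
  continuous (fun p : X * G => F p.1 p.2) -> continuous (fun x => mean (F x)).
Proof.
move=> cF x0; have cFx x : continuous (F x).
  move=> y; apply: (@continuous_comp _ _ _ (fun y => (x, y)) (fun p : X * G => F p.1 p.2)).
    by apply: cvg_pair; [exact: cvg_cst|exact: cvg_id].
  exact: cF.
apply/cvgrPdist_le => e e0; apply: filterS (compact_close x0 cF Zc e0) => x hx.
by rewrite distrC; exact: mean_close.
Qed.

End mean.

(** Fubini: by [ravg_uniform] one list [A] makes the right averages of all [F x], [x] in [Z1], close
    to their means, and a finite average commutes with the mean over [Z1]. *)
Lemma mean_exchange (R : realType) (G : topGroupType) (Z1 Z2 : set G)
    (F : G -> G -> R) :
  compact_subgroup Z1 -> compact_subgroup Z2 ->
  continuous (fun p : G * G => F p.1 p.2) ->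
  mean Z1 (fun x => mean Z2 (F x)) = mean Z2 (fun y => mean Z1 (F^~ y)).
Proof.
move=> cZ1 cZ2 cF.
have cFx x : continuous (F x).
  move=> y; apply: (@continuous_comp _ _ _ (fun y => (x, y)) (fun p : G * G => F p.1 p.2)).
    by apply: cvg_pair; [exact: cvg_cst|exact: cvg_id].
  exact: cF.
have cF' : continuous (fun p : G * G => F p.2 p.1).
  move=> p; apply: (@continuous_comp _ _ _ (fun p : G * G => (p.2, p.1))
    (fun p : G * G => F p.1 p.2)); last exact: cF.
  by apply: cvg_pair; [exact: continuous_snd|exact: continuous_fst].
have cFy y : continuous (F^~ y).
  move=> x; apply: (@continuous_comp _ _ _ (fun x => (x, y)) (fun p : G * G => F p.1 p.2)).
    by apply: cvg_pair; [exact: cvg_id|exact: cvg_cst].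
  exact: cF.
have cm1 : continuous (fun x => mean Z2 (F x)) by exact: continuous_mean.
have cm2 : continuous (fun y => mean Z1 (F^~ y)).
  exact: (continuous_mean cZ1 (F := fun y x => F x y)).
apply/eqP; rewrite -subr_eq0 -normr_le0; apply/ler_addgt0Pr => e e0; rewrite add0r.
(* The average and the mean are each within [4 * (e / 8)] of the same constant. *)
have e80 : 0 < e / 8 by rewrite divr_gt0.
have [Z1c Z11 _ _] := cZ1; have [Z2c Z21 _ _] := cZ2.
pose U : set G := [set u | forall p : G * G, (Z1 `*` Z2) p ->
  `|F p.1 (u * p.2)%g - F p.1 p.2| <= e / 8].
have U1 : nbhs 1%g U.
  pose H (u : G) (p : G * G) := F p.1 (u * p.2)%g.
  have cH : continuous (fun q : G * (G * G) => H q.1 q.2).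
    move=> q; apply: (@continuous_comp _ _ _
      (fun q : G * (G * G) => (q.2.1, q.1 * q.2.2)%g) (fun p : G * G => F p.1 p.2)).
      apply: cvg_pair.
        exact: (continuous_comp (@continuous_snd _ _ q) (@continuous_fst _ _ _)).
      apply: continuous_mulg => {}q; first exact: continuous_fst.
      exact: (continuous_comp (@continuous_snd _ _ q) (@continuous_snd _ _ _)).
    exact: cF.
  apply: filterS (compact_close 1%g cH (compact_setX Z1c Z2c) e80) => u hu p /hu.
  by rewrite /H mul1g.
have [|[x0 y0] _ Fmax] := @compact_norm_max R (G * G)%type (Z1 `*` Z2)
    (fun p => F p.1 p.2) (compact_setX Z1c Z2c) _ cF; first by exists (1%g, 1%g).
set D := `|_| in Fmax.
have [A ZA AP] := ravg_uniform (2 * D) cZ2 U1 e80.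
have near x y : Z1 x -> Z2 y -> `|ravg A (F x) y - mean Z2 (F x)| <= e.
  move=> Zx Zy; have [||c cP] := AP (F x).
  - by move=> u z Uu Zz _; exact: (Uu (x, z)).
  - exists (- D) => z Zz; have := Fmax (x, z) (conj Zx Zz).
    by rewrite ler_norml => /andP[h1 h2]; apply/andP; split; move: h1 h2; rewrite /=; lra.
  have h : `|mean Z2 (F x) - c| <= 4 * (e / 8).
    rewrite -(mean_ravg cZ2 (cFx x) ZA) -(mean_cst (Z := Z2) cZ2 c); apply: mean_close => //.
    - exact: continuous_ravg.
    - by move=> z; exact: cvg_cst.
  have := cP y Zy; move: h; rewrite !ler_distl => /andP[h1 h2] /andP[h3 h4].
  by apply/andP; move: h1 h2 h3 h4; clear; split; lra.
rewrite -[X in _ - X](mean_ravg cZ2 cm2 ZA) -[X in X - _](mean_cst (Z := Z2) cZ2).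
apply: mean_close => //; [by move=> z; exact: cvg_cst|exact: continuous_ravg|].
move=> y Zy; have -> : ravg A (fun y => mean Z1 (F^~ y)) y = mean Z1 (fun x => ravg A (F x) y).
  by rewrite /ravg meanZ// ?mean_sum//; exact: continuous_bigsum.
rewrite distrC; apply: mean_close => //.
  by move=> x; apply: cvgM; [exact: cvg_cst|exact: continuous_bigsum].
by move=> x Zx; exact: near.
Qed.

(** * Eigenfunctions of convolution operators *)

(** Arzela-Ascoli along a filter, as [K] may fail to be metrizable. Tychonoff yields a pointwise
    cluster point [g]; it inherits the equicontinuity of [E], and a finite net turns closeness at
    the net points into uniform closeness on [K]. *)
Lemma equicontinuous_cluster (R : realType) (X : topologicalType) (K : set X)
    (F : set_system (X -> R)) (E : set (X -> R)) :
  compact K -> ProperFilter F -> F E ->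
  (forall x, exists c, forall h, E h -> `|h x| <= c) ->
  (forall x e, 0 < e -> exists2 N, nbhs x N &
     forall h, E h -> forall y, N y -> `|h y - h x| <= e) ->
  exists2 g, continuous g &
    forall A e, F A -> 0 < e -> exists2 h, A h & forall x, K x -> `|h x - g x| <= e.
Proof.
move=> cK FF FE /choice[c Ec] Eeq.
have cC := @tychonoff X (fun=> R) (fun x => `[- c x, c x]%classic)
  (fun x => @segment_compact R _ _).
have [|g [_ gF]] := cC F FF.
  by apply: filterS FE => h Eh x; rewrite /= in_itv /= -ler_norml; exact: Ec.
have near (s : seq X) e A : F A -> 0 < e ->
    exists2 h, A h & forall x, x \in s -> `|h x - g x| < e.
  move=> FA e0.
  pose P := prod_topology (fun _ : X => R : topologicalType).
  have [|h [Ah hg]] := gF A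
    [set h : X -> R | forall x, x \in s -> `|h x - g x| < e] FA.
    change (nbhs (g : P) [set h : P | forall x, x \in s -> `|h x - g x| < e]).
    elim: s => [|x s IH]; first by apply: filterS filterT => h _ x.
    have hx : nbhs (g : P) [set h : P | `|h x - g x| < e].
      have := @continuous_proj X (fun _ => R : topologicalType) x g.
      move=> /cvgrPdist_lt/(_ _ e0); apply: filterS => h.
      by rewrite distrC.
    apply: filterS (filterI hx IH) => h [h1 h2] y; rewrite inE => /orP[/eqP ->//|].
    exact: h2.
  by exists h.
have gE x e : 0 < e -> exists2 N, nbhs x N & (forall h, E h -> forall y, N y ->
    `|h y - h x| <= e) /\ (forall y, N y -> `|g y - g x| <= e).
  move=> e0; have [N Nx NE] := Eeq x e e0; exists N => //; split=> // y Ny.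
  apply/ler_addgt0Pr => d d0; have d20 : 0 < d / 2 by rewrite divr_gt0.
  have [h Eh hg] := near [:: x; y] _ _ FE d20.
  have := hg x (mem_head _ _); have := hg y; rewrite !inE eqxx orbT => /(_ isT).
  have := NE h Eh y Ny; rewrite !ltr_distl !ler_distl => /andP[h1 h2] /andP[h3 h4] /andP[h5 h6].
  by apply/andP; move: h1 h2 h3 h4 h5 h6; clear; split; lra.
exists g.
  move=> x; apply/cvgrPdist_le => e e0; have [N Nx [_ Ng]] := gE x e e0.
  by apply: filterS Nx => y /Ng; rewrite distrC.
move=> A e FA e0; have e30 : 0 < e / 3 by rewrite divr_gt0.
have /choice[N NP] : forall x, exists N, nbhs x N /\ ((forall h, E h -> forall y, N y ->
    `|h y - h x| <= e / 3) /\ (forall y, N y -> `|g y - g x| <= e / 3)).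
  by move=> x; have [N] := gE x _ e30; exists N.
have [s [_ Ks]] : exists s : seq X, (forall x, x \in s -> setT x) /\
    forall x, K x -> exists2 y, y \in s & (N y)° x.
  apply: compact_seq_cover => // [y _|x _]; first exact: open_interior.
  by exists x => //; exact: nbhs_singleton (nbhs_interior (NP x).1).
have [h [Ah Eh] hg] := near s _ _ (filterI FA FE) e30.
exists h => // y /Ks[x xs /interior_subset Nxy].
have := (NP x).2.1 h Eh y Nxy; have := (NP x).2.2 y Nxy; have := hg x xs.
rewrite ltr_distl !ler_distl => /andP[h1 h2] /andP[h3 h4] /andP[h5 h6].
by apply/andP; move: h1 h2 h3 h4 h5 h6; clear; split; lra.
Qed.

Section continuity.
Context {R : realType} {X : topologicalType}.
Implicit Types f g : X -> R.

Lemma continuous_addf f g : continuous f -> continuous g -> continuous (fun x => f x + g x).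
Proof. by move=> cf cg x; apply: cvgD; [exact: cf|exact: cg]. Qed.

Lemma continuous_subf f g : continuous f -> continuous g -> continuous (fun x => f x - g x).
Proof. by move=> cf cg x; apply: cvgB; [exact: cf|exact: cg]. Qed.

Lemma continuous_mulf f g : continuous f -> continuous g -> continuous (fun x => f x * g x).
Proof. by move=> cf cg x; apply: cvgM; [exact: cf|exact: cg]. Qed.

Lemma continuous_scalef c f : continuous f -> continuous (fun x => c * f x).
Proof. by move=> cf; apply: continuous_mulf => // x; exact: cvg_cst. Qed.

Lemma continuous_compf (Y : topologicalType) (h : Y -> X) f :
  continuous h -> continuous f -> continuous (fun y => f (h y)).
Proof. by move=> ch cf y; apply: (@continuous_comp _ _ _ h f); [exact: ch|exact: cf]. Qed.

End continuity.

Section convolution.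
Context {R : realType} {G : topGroupType} (K : set G).
Hypothesis cK : compact_subgroup K.
Implicit Types (f g h p : G -> R).

Let Kc : compact K. Proof. by case: cK. Qed.
Let K1 : K 1%g. Proof. by case: cK. Qed.
Let KM x y : K x -> K y -> K (x * y)%g. Proof. by case: cK => _ _ + _; exact. Qed.
Let KV x : K x -> K x^-1%g. Proof. by case: cK => _ _ _; exact. Qed.

Definition dot f g := mean K (fun x => f x * g x).

Lemma dotC f g : dot f g = dot g f.
Proof. by rewrite /dot; congr mean; apply/funext => x; rewrite mulrC. Qed.

Lemma dot_linear a b f g h : continuous f -> continuous g -> continuous h ->
  dot (fun x => a * f x + b * g x) h = a * dot f h + b * dot g h.
Proof.
move=> cf cg ch; rewrite /dot.
have -> : (fun x => (a * f x + b * g x) * h x) =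
    (fun x => a * (f x * h x) + b * (g x * h x)).
  by apply/funext => x; rewrite mulrDl !mulrA.
by rewrite meanD ?meanZ//; do ?apply: continuous_scalef; exact: continuous_mulf.
Qed.

Lemma dot_ge0 f : continuous f -> 0 <= dot f f.
Proof.
move=> cf; apply: mean_ge0 => //; first exact: continuous_mulf.
by move=> x _; rewrite -expr2 sqr_ge0.
Qed.

Lemma dot_eq0 f x : continuous f -> dot f f = 0 -> K x -> f x = 0.
Proof.
move=> cf ff0 Kx; apply/eqP; apply: contraT => fx0.
suff : 0 < dot f f by rewrite ff0 ltxx.
apply: (mean_gt0 cK (z := x)) => //; first exact: continuous_mulf.
  by move=> y _; rewrite -expr2 sqr_ge0.
by rewrite -expr2 exprn_even_gt0.
Qed.

Lemma dot_vanish f g : continuous f -> continuous g -> (forall x, K x -> f x = 0) ->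
  dot f g = 0.
Proof.
move=> cf cg f0; rewrite -(mean_cst cK 0); apply: eq_mean => //.
- exact: continuous_mulf.
- by move=> x; exact: cvg_cst.
- by move=> x /f0 ->; rewrite mul0r.
Qed.

Lemma dot_sqr_linear a b f g : continuous f -> continuous g ->
  dot (fun x => a * f x + b * g x) (fun x => a * f x + b * g x) =
  a ^+ 2 * dot f f + 2 * a * b * dot f g + b ^+ 2 * dot g g.
Proof.
move=> cf cg; have cfg : continuous (fun x => a * f x + b * g x).
  by apply: continuous_addf; exact: continuous_scalef.
rewrite dot_linear// ![dot _ (fun x => a * f x + b * g x)]dotC !dot_linear//.
by rewrite [dot g f]dotC; ring.
Qed.

Lemma dot_cauchy_schwarz f g : continuous f -> continuous g ->
  dot f g ^+ 2 <= dot f f * dot g g.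
Proof.
move=> cf cg; have [g0|g0] := eqVneq (dot g g) 0.
  rewrite dotC dot_vanish ?expr0n/= ?mulr_ge0 ?dot_ge0//.
  by move=> x; exact: dot_eq0.
have gp : 0 < dot g g by rewrite lt_neqAle eq_sym g0 dot_ge0.
(* The test vector is the component of [f] orthogonal to [g], multiplied by [dot g g] to avoid a
   division. *)
have := dot_ge0 (f := fun x => dot g g * f x + (- dot f g) * g x).
rewrite dot_sqr_linear// => /(_ _)/wrap[].
  by apply: continuous_addf; exact: continuous_scalef.
set F := dot f f; set H := dot g g; set M := dot f g.
have -> : H ^+ 2 * F + 2 * H * - M * M + (- M) ^+ 2 * H = H * (F * H - M ^+ 2) by ring.
by rewrite pmulr_rge0// subr_ge0.
Qed.

(** Convolution on the compact group [K]. The kernel depends on [x * y^-1] only, so the operator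
    commutes with right translations by [K] ([conv_right]); its adjoint has kernel [checked p]. *)
Definition conv p f x := mean K (fun y => p (x * y^-1)%g * f y).

Definition checked p : G -> R := fun z => p z^-1%g.

Lemma continuous_checked p : continuous p -> continuous (checked p).
Proof. by move=> cp; apply: continuous_compf => //; exact: invg_continuous. Qed.

Lemma checkedK p : checked (checked p) = p.
Proof. by apply/funext => z; rewrite /checked invgK. Qed.

Lemma continuous_mulV : continuous (fun q : G * G => q.1 * q.2^-1)%g.
Proof.
apply: continuous_mulg; first exact: continuous_fst.
by move=> q; apply: (@continuous_comp _ _ _ snd (fun x => x^-1)%g);
  [exact: continuous_snd|exact: invg_continuous].
Qed.

Lemma continuous_kernel p f : continuous p -> continuous f ->
  continuous (fun q : G * G => p (q.1 * q.2^-1)%g * f q.2).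
Proof.
move=> cp cf; apply: continuous_mulf; apply: continuous_compf => //.
  exact: continuous_mulV.
exact: continuous_snd.
Qed.

Lemma continuous_kernelr p f x : continuous p -> continuous f ->
  continuous (fun y => p (x * y^-1)%g * f y).
Proof.
move=> cp cf; have := continuous_kernel cp cf.
apply: (@continuous_compf _ _ _ (fun y => (x, y))) => y.
by apply: cvg_pair; [exact: cvg_cst|exact: cvg_id].
Qed.

Lemma continuous_conv p f : continuous p -> continuous f -> continuous (conv p f).
Proof.
move=> cp cf; apply: (continuous_mean cK (F := fun x y => p (x * y^-1)%g * f y)).
exact: continuous_kernel.
Qed.

Lemma conv_adjoint p f g : continuous p -> continuous f -> continuous g ->
  dot (conv p f) g = dot f (conv (checked p) g).
Proof.
move=> cp cf cg; rewrite /dot /conv.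
pose F x y := p (x * y^-1)%g * f y * g x.
have cF : continuous (fun q : G * G => F q.1 q.2).
  apply: continuous_mulf; first exact: continuous_kernel.
  by apply: continuous_compf => //; exact: continuous_fst.
have -> : (fun x => mean K (fun y => p (x * y^-1)%g * f y) * g x) =
    (fun x => mean K (F x)).
  apply/funext => x; rewrite mulrC -meanZ//; last exact: continuous_kernelr.
  by congr mean; apply/funext => y; rewrite /F mulrC.
rewrite mean_exchange//; congr mean; apply/funext => y.
rewrite -meanZ//; last by apply: continuous_kernelr => //; exact: continuous_checked.
by congr mean; apply/funext => x; rewrite /F /checked invgM invgK; ring.
Qed.

Lemma conv_linear p a b f g x : continuous p -> continuous f -> continuous g ->
  conv p (fun x => a * f x + b * g x) x = a * conv p f x + b * conv p g x.
Proof.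
move=> cp cf cg; rewrite /conv -!meanZ//; try exact: continuous_kernelr.
rewrite -meanD//; try by apply: continuous_scalef; exact: continuous_kernelr.
by congr mean; apply/funext => y; ring.
Qed.

Lemma conv_right p f a x : continuous p -> continuous f -> K a ->
  conv p (fun y => f (y * a)%g) x = conv p f (x * a)%g.
Proof.
move=> cp cf Ka; rewrite /conv.
rewrite -(mean_right cK (f := fun y => p (x * a * y^-1)%g * f y) _ Ka).
  by congr mean; apply/funext => y; rewrite invgM !mulgA mulgK.
exact: continuous_kernelr.
Qed.

(** For continuous [f], the projection onto functions invariant under right translations by [Z]. *)
Definition right_mean (Z : set G) f x := mean Z (fun z => f (x * z)%g).

Lemma continuous_right_mean Z f : compact_subgroup Z -> continuous f ->
  continuous (right_mean Z f).
Proof.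
move=> cZ cf; apply: (continuous_mean cZ (F := fun x z => f (x * z)%g)).
by apply: continuous_compf => //; exact: mulg_continuous.
Qed.

Lemma conv_right_mean Z p f x : compact_subgroup Z -> Z `<=` K ->
  continuous p -> continuous f ->
  conv p (right_mean Z f) x = right_mean Z (conv p f) x.
Proof.
move=> cZ ZK cp cf; rewrite /conv /right_mean.
pose F y z := p (x * y^-1)%g * f (y * z)%g.
have cfz z : continuous (fun y => f (y * z)%g).
  apply: (continuous_compf (h := fun y => y * z)%g) => //.
  exact: continuous_mulgr.
have cfy y : continuous (fun z => f (y * z)%g).
  apply: (continuous_compf (h := fun z => y * z)%g) => //.
  exact: continuous_mulgl.
have cF : continuous (fun q : G * G => F q.1 q.2).
  apply: continuous_mulf; last by apply: continuous_compf => //; exact: mulg_continuous.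
  apply: (continuous_compf (f := fun y => p (x * y^-1)%g)); first exact: continuous_fst.
  have -> : (fun y => p (x * y^-1)%g) = (fun y => p (x * y^-1)%g * cst 1 y).
    by apply/funext => y; rewrite mulr1.
  by apply: continuous_kernelr => // y; exact: cvg_cst.
have -> : (fun y => p (x * y^-1)%g * mean Z (fun z => f (y * z)%g)) =
    (fun y => mean Z (F y)).
  by apply/funext => y; rewrite -meanZ.
rewrite (mean_exchange cK cZ cF); apply: (eq_mean cZ).
- apply: (continuous_mean cK (F := fun z y => F y z)).
  apply: (continuous_compf (h := fun q : G * G => (q.2, q.1)) (f := fun q => F q.1 q.2)) => //.
  by move=> q; apply: cvg_pair; [exact: continuous_snd|exact: continuous_fst].
- apply: (continuous_compf (h := fun z => (x * z)%g) (f := conv p f)).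
    exact: continuous_mulgl.
  exact: continuous_conv.
- by move=> z /ZK Kz; rewrite -/(conv p f (x * z)%g) -conv_right.
Qed.

Lemma eq_conv p f g x : continuous p -> continuous f -> continuous g ->
  (forall y, K y -> f y = g y) -> conv p f x = conv p g x.
Proof.
move=> cp cf cg fg; apply: (eq_mean cK); try exact: continuous_kernelr.
by move=> y /fg ->.
Qed.

Lemma conv_sqr_le p f x B : continuous p -> continuous f -> K x ->
  (forall z, K z -> `|p z| <= B) -> conv p f x ^+ 2 <= B ^+ 2 * dot f f.
Proof.
move=> cp cf Kx pB; have cpx : continuous (fun y => p (x * y^-1)%g).
  have -> : (fun y => p (x * y^-1)%g) = (fun y => p (x * y^-1)%g * cst 1 y).
    by apply/funext => y; rewrite mulr1.
  by apply: continuous_kernelr => // y; exact: cvg_cst.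
apply: le_trans (dot_cauchy_schwarz cpx cf) _; apply: ler_wpM2r; first exact: dot_ge0.
rewrite -(mean_cst cK (B ^+ 2)); apply: (mean_le cK).
- exact: continuous_mulf.
- by move=> y; exact: cvg_cst.
- move=> y Ky; rewrite -expr2 -real_normK ?num_real//.
  have := pB _ (KM Kx (KV Ky)); set v := `|p _| => vB.
  by rewrite /cst ler_pXn2r ?nnegrE ?normr_ge0//; apply: le_trans vB; exact: normr_ge0.
Qed.

Lemma conv_norm_le p f x B C : continuous p -> continuous f ->
  (forall w, K w -> `|p (x * w^-1)%g| <= B) -> (forall w, K w -> `|f w| <= C) ->
  `|conv p f x| <= B * C.
Proof.
move=> cp cf pB fC; apply: (mean_norm_le cK); first exact: continuous_kernelr.
by move=> w Kw; rewrite normrM ler_pM//; [exact: pB|exact: fC].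
Qed.

Lemma conv_near p f x y e C : continuous p -> continuous f ->
  (forall w, K w -> `|p (y * w^-1)%g - p (x * w^-1)%g| <= e) ->
  (forall w, K w -> `|f w| <= C) -> `|conv p f y - conv p f x| <= e * C.
Proof.
move=> cp cf pe fC; rewrite /conv -meanB//; try exact: continuous_kernelr.
apply: (mean_norm_le cK).
  by apply: continuous_subf; exact: continuous_kernelr.
by move=> w Kw; rewrite -mulrBl normrM ler_pM//; [exact: pe|exact: fC].
Qed.

Lemma kernel_close p x e : continuous p -> 0 < e ->
  exists2 N, nbhs x N &
    forall y, N y -> forall w, K w -> `|p (y * w^-1)%g - p (x * w^-1)%g| <= e.
Proof.
move=> cp e0; exists [set y | forall w, K w -> `|p (y * w^-1)%g - p (x * w^-1)%g| <= e].
  apply: (compact_close x (F := fun y w => p (y * w^-1)%g) _ Kc e0).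
  by apply: continuous_compf => //; exact: continuous_mulV.
by [].
Qed.

End convolution.

Section eigenfunction.
Context {R : realType} {G : topGroupType} (K : set G) (p : G -> R).
Hypotheses (cK : compact_subgroup K) (cp : continuous p).
Implicit Types (f g h : G -> R).

Let Kc : compact K. Proof. by case: cK. Qed.
Let K1 : K 1%g. Proof. by case: cK. Qed.
Let KM x y : K x -> K y -> K (x * y)%g. Proof. by case: cK => _ _ + _; exact. Qed.
Let KV x : K x -> K x^-1%g. Proof. by case: cK => _ _ _; exact. Qed.
Let cp' : continuous (checked p). Proof. exact: continuous_checked. Qed.

(** With [T = conv K p] this is the adjoint of [T] composed with [T]: self-adjoint and positive for
    every kernel, so its top eigenvalue can be reached by maximisation. *)
Definition conv_sq f := conv K (checked p) (conv K p f).

Lemma continuous_conv_sq f : continuous f -> continuous (conv_sq f).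
Proof. by move=> cf; do 2!apply: continuous_conv => //. Qed.

Lemma conv_sq_linear a b f g x : continuous f -> continuous g ->
  conv_sq (fun x => a * f x + b * g x) x = a * conv_sq f x + b * conv_sq g x.
Proof.
move=> cf cg; rewrite /conv_sq -conv_linear//; try exact: continuous_conv.
by congr conv; apply/funext => y; rewrite conv_linear.
Qed.

Lemma dot_conv_sq f g : continuous f -> continuous g ->
  dot K (conv_sq f) g = dot K (conv K p f) (conv K p g).
Proof.
by move=> cf cg; rewrite [LHS]conv_adjoint ?checkedK//; exact: continuous_conv.
Qed.

Lemma kernel_bound : exists2 B, 0 <= B &
  forall z, K z -> `|p z| <= B /\ `|checked p z| <= B.
Proof.
have [|x _ px] := compact_norm_max Kc _ cp; first by exists 1%g.
by exists `|p x| => // z Kz; split; apply: px => //; exact: KV.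
Qed.

Variable W : set (G -> R).
Hypotheses (Wc : forall f, W f -> continuous f)
  (WZ : forall c f, W f -> W (fun x => c * f x))
  (WS : forall f, W f -> W (conv_sq f))
  (Wlim : forall g, continuous g ->
     (forall e, 0 < e -> exists2 f, W f & forall x, K x -> `|f x - g x| <= e) -> W g).

Let T f := conv K p f.
Let cT f : continuous f -> continuous (T f). Proof. exact: continuous_conv. Qed.
Let cS f : continuous f -> continuous (conv_sq f). Proof. exact: continuous_conv_sq. Qed.

(** Rayleigh quotients of [conv_sq] on [W]; their supremum [lam] is the square of the norm of [T] on
    [W]. *)
Let ratios := [set c | exists f, [/\ W f, 0 < dot K f f & c = dot K (T f) (T f) / dot K f f]].
Let lam := sup ratios.

Variables (f0 : G -> R) (x0 : G).
Hypotheses (Wf0 : W f0) (Kx0 : K x0) (Tf0 : T f0 x0 <> 0).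

Lemma T_dot_le B f : continuous f -> (forall z, K z -> `|p z| <= B) ->
  dot K (T f) (T f) <= B ^+ 2 * dot K f f.
Proof.
move=> cf pB; rewrite -(mean_cst cK (B ^+ 2 * dot K f f)); apply: (mean_le cK).
- by apply: continuous_mulf; exact: cT.
- by move=> x; exact: cvg_cst.
- by move=> x Kx; rewrite -expr2; exact: conv_sqr_le.
Qed.

Lemma has_sup_ratios : has_sup ratios.
Proof.
have [B B0 pB] := kernel_bound.
have cf0 := Wc Wf0.
have d0 : 0 < dot K f0 f0.
  rewrite lt_neqAle dot_ge0// andbT; apply/negP => /eqP /esym d0; apply: Tf0.
  have Tz := T_dot_le cf0 (fun z Kz => (pB z Kz).1).
  apply: (dot_eq0 cK (cT cf0)) Kx0; apply/eqP; rewrite eq_le dot_ge0//; last exact: cT.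
  by rewrite (le_trans Tz)// d0 mulr0.
split; first by exists (dot K (T f0) (T f0) / dot K f0 f0), f0.
exists (B ^+ 2) => _ [f [Wf ff ->]]; rewrite ler_pdivrMr//.
by apply: T_dot_le => [|z /pB[]//]; exact: Wc.
Qed.

Lemma T_dot_le_lam f : W f -> dot K (T f) (T f) <= lam * dot K f f.
Proof.
move=> Wf; have cf := Wc Wf; have [ff|ff] := eqVneq (dot K f f) 0.
  rewrite ff mulr0; rewrite [leLHS]dot_vanish//; try exact: cT.
  have [B B0 pB] := kernel_bound.
  move=> x; apply: (dot_eq0 cK (cT cf)); apply/eqP; rewrite eq_le dot_ge0//; last exact: cT.
  by rewrite andbT (le_trans (T_dot_le cf (fun z Kz => (pB z Kz).1)))// ff mulr0.
have fpos : 0 < dot K f f by rewrite lt_neqAle eq_sym ff dot_ge0.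
rewrite -ler_pdivrMr//; apply: (sup_upper_bound has_sup_ratios).
by exists f.
Qed.

Lemma lam_gt0 : 0 < lam.
Proof.
have cf0 := Wc Wf0; have := T_dot_le_lam Wf0.
have Tp : 0 < dot K (T f0) (T f0).
  rewrite lt_neqAle dot_ge0//; last exact: cT.
  by rewrite andbT; apply/negP => /eqP/esym/(dot_eq0 cK (cT cf0))/(_ Kx0).
move=> h; have := lt_le_trans Tp h; have := dot_ge0 cK cf0.
by move=> d0; rewrite pmulr_lgt0// lt_neqAle d0 andbT; apply/negP => /eqP d; move: h Tp; rewrite -d mulr0 => /le_lt_trans /[apply]; rewrite ltxx.
Qed.

(** With [a] the left side, [a ^+ 2] is the square of [dot K (T f) (T (conv_sq f))]. Cauchy-Schwarz
    and [T_dot_le_lam], applied to [f] and to [conv_sq f], bound it by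
    [lam * dot K f f * (lam * a)]; then [a] cancels. *)
Lemma S_dot_le_lam f : W f -> dot K (conv_sq f) (conv_sq f) <= lam ^+ 2 * dot K f f.
Proof.
move=> Wf; have cf := Wc Wf; have WSf := WS Wf; have cSf := Wc WSf.
set a := dot K (conv_sq f) (conv_sq f).
have a0 : 0 <= a by exact: dot_ge0.
have [->|an0] := eqVneq a 0; first by rewrite mulr_ge0 ?sqr_ge0// dot_ge0.
have ap : 0 < a by rewrite lt_neqAle eq_sym an0.
rewrite -(ler_pM2r ap) -[X in X <= _]/(a * a) -expr2.
rewrite {1}/a dot_conv_sq//.
apply: le_trans (dot_cauchy_schwarz cK (cT cf) (cT cSf)) _.
have -> : lam ^+ 2 * dot K f f * a = (lam * dot K f f) * (lam * a) by ring.
apply: ler_pM; rewrite ?dot_ge0//; try exact: cT.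
  exact: T_dot_le_lam.
exact: T_dot_le_lam.
Qed.

Let near_max e := [set h | exists f, [/\ W f, dot K f f <= 1,
  lam - e <= dot K (T f) (T f) & h = conv_sq f]].

Lemma near_max_nonempty e : 0 < e -> near_max e !=set0.
Proof.
move=> e0; have [_ [f [Wf ff ->]] fe] := sup_adherent e0 has_sup_ratios.
have cf := Wc Wf.
pose c := (Num.sqrt (dot K f f))^-1.
have c2 : c ^+ 2 = (dot K f f)^-1 by rewrite exprVn sqr_sqrtr// ltW.
have scal g : continuous g -> dot K (fun x => c * g x) (fun x => c * g x) = c ^+ 2 * dot K g g.
  move=> cg; have -> : (fun x => c * g x) = (fun x => c * g x + 0 * g x).
    by apply/funext => x; rewrite mul0r addr0.
  by rewrite dot_sqr_linear//; ring.
exists (conv_sq (fun x => c * f x)), (fun x => c * f x); split=> //.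
- exact: WZ.
- by rewrite scal// c2 mulVf// gt_eqF.
- have -> : T (fun x => c * f x) = (fun x => c * T f x).
    apply/funext => x; have := conv_linear cK c 0 x cp cf cf.
    rewrite mul0r addr0 => <-; congr conv; apply/funext => y.
    by rewrite mul0r addr0.
  rewrite scal; last exact: cT.
  by rewrite c2 mulrC; exact: ltW.
Qed.

(** Near-maximisers [f] satisfy [conv_sq f = lam f] up to a small [dot] norm. Their images under
    [conv_sq] are bounded and equicontinuous, so they cluster uniformly on [K] at some [g]; applying
    [conv_sq] once more turns norm smallness into pointwise smallness. *)
Theorem eigenfunction : exists l g, [/\ 0 < l, W g, exists2 x, K x & g x <> 0 &
  forall x, K x -> conv_sq g x = l * g x].
Proof.
have lam0 := lam_gt0; have [B B0 pB] := kernel_bound.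
pose F : set_system (G -> R) := filter_from [set e : R | 0 < e] near_max.
have FF : ProperFilter F.
  apply: filter_from_proper; last exact: near_max_nonempty.
  apply: filter_from_filter; first by exists 1; rewrite /= ltr01.
  move=> d e d0 e0; exists (Num.min d e); first by rewrite /= lt_min d0.
  move=> _ [f [Wf ff fe ->]]; split; exists f; split=> //; apply: le_trans fe.
    by rewrite lerD2l lerN2 ge_min lexx.
  by rewrite lerD2l lerN2 ge_min lexx orbT.
pose E := [set h | exists f, [/\ W f, dot K f f <= 1 & h = conv_sq f]].
have FE : F E by exists 1; [rewrite /= ltr01|move=> _ [f [Wf ff _ ->]]; exists f].
have TB f w : W f -> dot K f f <= 1 -> K w -> `|T f w| <= B.
  move=> Wf ff Kw; rewrite -ler_sqr ?nnegrE// real_normK ?num_real//.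
  apply: le_trans (conv_sqr_le cK cp (Wc Wf) Kw (fun z Kz => (pB z Kz).1)) _.
  by rewrite -[leRHS]mulr1 ler_wpM2l// sqr_ge0.
have [||g cg gP] := equicontinuous_cluster Kc FF FE.
- move=> x; have cpx : continuous (fun w => checked p (x * w^-1)%g).
    apply: (continuous_compf (f := fun q : G * G => checked p (q.1 * q.2^-1)%g)
      (h := fun w => (x, w))).
      by move=> w; apply: cvg_pair; [exact: cvg_cst|exact: cvg_id].
    by apply: continuous_compf => //; exact: continuous_mulV.
  have [|w _ wP] := compact_norm_max Kc _ cpx; first by exists 1%g.
  exists (`|checked p (x * w^-1)%g| * B) => _ [f [Wf ff ->]].
  apply: conv_norm_le => //; first exact/cT/Wc.
  by move=> v Kv; exact: TB.
- move=> x e e0; have eB : 0 < e / (B + 1) by rewrite divr_gt0// ltr_wpDl.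
  have [N Nx NP] := kernel_close cK x cp' eB; exists N => // _ [f [Wf ff ->]] y Ny.
  apply: (@le_trans _ _ (e / (B + 1) * (B + 1))); last by rewrite divfK// gt_eqF// ltr_wpDl.
  apply: conv_near => //; [exact/cT/Wc|exact: NP|].
  by move=> w Kw; apply: le_trans (TB f w Wf ff Kw) _; rewrite lerDl.
have gnear e : 0 < e -> exists f, [/\ W f, dot K f f <= 1, lam - e <= dot K (T f) (T f) &
    forall x, K x -> `|conv_sq f x - g x| <= e].
  move=> e0; have [|h [f [Wf ff fe ->]] hg] := gP (near_max e) e _ e0.
    by exists e.
  by exists f.
exists lam, g; split=> //.
- apply: Wlim => // e e0; have [f [Wf _ _ fg]] := gnear e e0.
  by exists (conv_sq f) => //; exact: WS.
(* If [g] vanished on [K], then [conv_sq f] would be at most [lam / 4] there and Cauchy-Schwarz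
   would give [dot K (T f) (T f) <= lam / 4], against the lower bound [lam - lam / 4]. *)
- apply: contrapT => g0; have {}g0 x : K x -> g x = 0.
    by move=> Kx; apply: contrapT => gx; apply: g0; exists x.
  have e0 : 0 < lam / 4 by rewrite divr_gt0.
  have [f [Wf ff fe fg]] := gnear _ e0; have cf := Wc Wf; have WSf := Wc (WS Wf).
  have h1 := dot_cauchy_schwarz cK WSf cf; rewrite dot_conv_sq// in h1.
  have h2 : dot K (conv_sq f) (conv_sq f) <= (lam / 4) ^+ 2.
    rewrite -(mean_cst cK ((lam / 4) ^+ 2)); apply: (mean_le cK).
    + exact: continuous_mulf.
    + by move=> x; exact: cvg_cst.
    + move=> x Kx; have := fg x Kx; rewrite g0// subr0 => fx.
      rewrite -expr2 -real_normK ?num_real// /cst ler_sqr ?nnegrE//.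
      exact: ltW.
  have h3 : dot K (T f) (T f) ^+ 2 <= (lam / 4) ^+ 2.
    apply: le_trans h1 (le_trans _ h2); rewrite -[leRHS]mulr1.
    by apply: ler_wpM2l => //; exact: dot_ge0.
  move: h3; rewrite ler_sqr ?nnegrE ?dot_ge0 ?(ltW e0)//; last exact: cT.
  by move: fe lam0; lra.
- move=> x Kx; apply/eqP; rewrite -subr_eq0 -sqrf_eq0 eq_le sqr_ge0 andbT.
  (* [M * e] will bound twice the sum of the squares of the two error terms below; [e <= 1] lets [e]
     absorb [e ^+ 2]. *)
  pose M := 4 * B ^+ 4 * lam + 2 * (B ^+ 2 + lam) ^+ 2.
  have M0 : 0 <= M.
    by rewrite addr_ge0// !mulr_ge0 ?exprn_ge0// ?addr_ge0 ?exprn_ge0// ltW.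
  apply/ler_addgt0Pr => d d0; rewrite add0r.
  pose e := Num.min 1 (d / (M + 1)).
  have e0 : 0 < e by rewrite lt_min ltr01 divr_gt0// ltr_wpDl.
  have e1 : e <= 1 by rewrite ge_min lexx.
  have eM : M * e <= d.
    apply: (@le_trans _ _ (M * (d / (M + 1)))).
      by rewrite ler_wpM2l// ge_min lexx orbT.
    rewrite mulrCA ler_piMr ?(ltW d0)// ler_pdivrMr ?ltr_wpDl// mul1r.
    by rewrite lerDl.
  apply: le_trans eM; have [f [Wf ff fe fg]] := gnear e e0.
  have cf := Wc Wf; have cSf := Wc (WS Wf).
  (* The defect of [g] splits into [conv_sq u], where the defect [u] of [f] is small in the [dot]
     norm, and a term in [q = g - conv_sq f], which is uniformly small on [K]. *)
  pose u y := 1 * conv_sq f y + (- lam) * f y.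
  have cu : continuous u by apply: continuous_addf; exact: continuous_scalef.
  have uu : dot K u u <= 2 * lam * e.
    rewrite dot_sqr_linear// (dot_conv_sq cf cf) -/(T f).
    have := S_dot_le_lam Wf; set s := dot K (conv_sq f) _; set t := dot K (T f) _ in fe *.
    set n := dot K f f in ff *.
    have n0 : 0 <= n by exact: dot_ge0.
    move=> hs; have : lam ^+ 2 * n <= lam ^+ 2 by rewrite -[leRHS]mulr1 ler_wpM2l ?sqr_ge0.
    have : lam * (lam - e) <= lam * t by rewrite ler_wpM2l// ltW.
    have -> : lam * (lam - e) = lam ^+ 2 - lam * e by ring.
    have -> : 1 ^+ 2 * s + 2 * 1 * - lam * t + (- lam) ^+ 2 * n =
      s - 2 * (lam * t) + lam ^+ 2 * n by ring.
    have -> : 2 * lam * e = 2 * (lam * e) by ring.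
    by move: hs; lra.
  have Su : conv_sq u x ^+ 2 <= B ^+ 4 * (2 * lam * e).
    apply: le_trans (conv_sqr_le cK cp' (cT cu) Kx (fun z Kz => (pB z Kz).2)) _.
    have -> : B ^+ 4 * (2 * lam * e) = B ^+ 2 * (B ^+ 2 * (2 * lam * e)) by ring.
    rewrite ler_wpM2l ?sqr_ge0//.
    apply: le_trans (T_dot_le cu (fun z Kz => (pB z Kz).1)) _.
    by rewrite ler_wpM2l ?sqr_ge0.
  pose q y := 1 * g y + (-1) * conv_sq f y.
  have cq : continuous q by apply: continuous_addf; exact: continuous_scalef.
  have qe y : K y -> `|q y| <= e by move=> /fg; rewrite distrC /q mul1r mulN1r.
  have Sq : `|conv_sq q x| <= B ^+ 2 * e.
    rewrite expr2 -mulrA; apply: conv_norm_le => //; first exact: cT.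
      by move=> w Kw; apply: (pB _ _).2; exact/KM/KV.
    move=> w Kw; apply: conv_norm_le => // v Kv.
    by apply: (pB _ _).1; exact/KM/KV.
  have -> : conv_sq g x - lam * g x = conv_sq u x + (conv_sq q x - lam * q x).
    rewrite /u /q !conv_sq_linear//; ring.
  have Sq' : `|conv_sq q x - lam * q x| <= (B ^+ 2 + lam) * e.
    rewrite mulrDl; apply: le_trans (ler_normB _ _) _; apply: lerD => //.
    by rewrite normrM gtr0_norm// ler_wpM2l ?(ltW lam0)//; exact: qe.
  have Sq2 : (conv_sq q x - lam * q x) ^+ 2 <= (B ^+ 2 + lam) ^+ 2 * e.
    rewrite -real_normK ?num_real//.
    apply: (@le_trans _ _ (((B ^+ 2 + lam) * e) ^+ 2)).
      rewrite ler_sqr ?nnegrE// mulr_ge0 ?(ltW e0)//.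
      by rewrite addr_ge0 ?sqr_ge0// ltW.
    by rewrite exprMn ler_wpM2l ?sqr_ge0// expr2 ler_piMr// ltW.
  set a := conv_sq u x in Su *; set b := _ - _ in Sq2 *.
  have : (a + b) ^+ 2 <= 2 * a ^+ 2 + 2 * b ^+ 2.
    rewrite -subr_ge0; have -> : 2 * a ^+ 2 + 2 * b ^+ 2 - (a + b) ^+ 2 = (a - b) ^+ 2 by ring.
    exact: sqr_ge0.
  move=> /le_trans; apply.
  have -> : M * e = 2 * (B ^+ 4 * (2 * lam * e)) + 2 * ((B ^+ 2 + lam) ^+ 2 * e) by rewrite /M; ring.
  by apply: lerD; rewrite ler_wpM2l.
Qed.

End eigenfunction.

(** * Rigid spaces: invariance under a subgroup forces invariance under nearby larger subgroups *)

Section invariance.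
Context {R : realType} {G : topGroupType}.
Implicit Types (K X Z L : set G) (f g h : G -> R).

Definition right_invariant K X f := forall y x, K y -> X x -> f (y * x)%g = f y.

(* A space of functions on which small translations are uniformly close to the
   identity: the substitute for "no small subgroups". *)
Record rigid_space K (U : set G) (V : set (G -> R)) : Prop := RigidSpace {
  rigid_continuous : forall f, V f -> continuous f;
  rigid_sub : forall f g, V f -> V g -> V (fun x => f x - g x);
  rigid_mean : forall Z f, compact_subgroup Z -> Z `<=` K -> V f -> V (right_mean Z f);
  rigid_small : forall f c, V f -> (forall x, K x -> `|f x| <= c) ->
    forall x u, K x -> U u -> K (x * u)%g -> `|f (x * u)%g - f x| <= c / 2
}.

Lemma right_mean_invariant Z f x y : compact_subgroup Z -> continuous f -> Z x ->
  right_mean Z f (y * x)%g = right_mean Z f y.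
Proof.
move=> cZ cf Zx; rewrite /right_mean.
rewrite -[RHS](mean_left cZ (f := fun z => f (y * z)%g) _ Zx).
  by congr mean; apply/funext => z; rewrite mulgA.
apply: (continuous_compf (h := fun z => (y * z)%g) (f := f)) => //.
exact: continuous_mulgl.
Qed.

(** The difference [d] of [f] and its [Z]-mean is [X]-invariant and has zero [Z]-means. At a maximum
    [y0] of its absolute value, [d (y0 * z)] with [z = u * x] equals [d (y0 * u)], which differs
    from [d y0] by at most half of that maximum; averaging over [z] forces the maximum to be
    zero. *)
Lemma rigid_invariant K U V X Z f : compact_subgroup K -> rigid_space K U V ->
  compact_subgroup X -> compact_subgroup Z -> X `<=` Z -> Z `<=` K ->
  (forall z, Z z -> exists u x, [/\ U u, X x & z = (u * x)%g]) ->
  V f -> right_invariant K X f -> right_invariant K Z f.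
Proof.
move=> cK rV cX cZ XZ ZK ZUX Vf fX; have cf := rigid_continuous rV Vf.
have [Kc K1 KM KV] := cK; have [_ Z1 ZM ZV] := cZ; have [_ X1 _ _] := cX.
have cmove h y : continuous h -> continuous (fun z => h (y * z)%g).
  move=> ch; apply: (continuous_compf (h := fun z => (y * z)%g) (f := h)) => //.
  exact: continuous_mulgl.
pose d x := f x - right_mean Z f x.
have Vd : V d by apply: (rigid_sub rV) => //; exact: (rigid_mean rV).
have cd := rigid_continuous rV Vd.
have cr : continuous (right_mean Z f) by exact: continuous_right_mean.
have dX : right_invariant K X d.
  by move=> y x Ky Xx; rewrite /d right_mean_invariant ?fX//; exact: XZ.
have d0 y : right_mean Z d y = 0.
  rewrite {1}/right_mean /d meanB//; try exact: cmove.
  rewrite -[X in _ - X]/(mean Z (fun z => right_mean Z f (y * z)%g)).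
  apply/eqP; rewrite subr_eq0; apply/eqP; rewrite -[LHS](mean_cst cZ).
  apply: (eq_mean cZ); last by move=> z Zz; rewrite right_mean_invariant.
    by move=> z; exact: cvg_cst.
  exact: cmove cr.
have [|y0 Ky0 dmax] := compact_norm_max Kc _ cd; first by exists 1%g.
have dy0 : `|d y0| <= `|d y0| / 2.
  rewrite -[X in X <= _]normrN -[X in `|X|]add0r -(d0 y0).
  rewrite -[X in _ - X](mean_cst cZ) -meanB//; last 2 first.
    exact: cmove.
    by move=> z; exact: cvg_cst.
  apply: (mean_norm_le cZ).
    by apply: continuous_subf; [exact: cmove|move=> z; exact: cvg_cst].
  move=> z Zz; have [u [x [Uu Xx zux]]] := ZUX z Zz.
  have uE : u = (z * x^-1)%g by rewrite zux mulgK.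
  have Ku : K (y0 * u)%g.
    by apply: KM => //; rewrite uE; apply: ZK; apply: ZM => //; exact/ZV/XZ.
  rewrite zux mulgA dX//; exact: (rigid_small rV Vd dmax).
have d00 y : K y -> f y = right_mean Z f y.
  move=> Ky; apply/eqP; rewrite -subr_eq0 -normr_le0.
  by apply: le_trans (dmax y Ky) _; move: dy0; set t := `|_|; lra.
move=> y z Ky Zz; rewrite d00; last by apply: KM => //; exact: ZK.
by rewrite right_mean_invariant// -d00.
Qed.

(** Fubini together with invariance of the mean; it is used to see that convolution preserves mean
    zero. *)
Lemma mean_conv K p f : compact_subgroup K -> continuous p -> continuous f ->
  mean K (conv K p f) = mean K p * mean K f.
Proof.
move=> cK cp cf; rewrite /conv.
rewrite (mean_exchange cK cK (F := fun x y => p (x * y^-1)%g * f y)); last first.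
  exact: continuous_kernel.
rewrite -meanZ//; apply: (eq_mean cK).
- apply: (continuous_mean cK (F := fun y x => p (x * y^-1)%g * f y)).
  apply: (continuous_compf (h := fun q : G * G => (q.2, q.1))
    (f := fun q : G * G => p (q.1 * q.2^-1)%g * f q.2)).
    by move=> q; apply: cvg_pair; [exact: continuous_snd|exact: continuous_fst].
  exact: continuous_kernel.
- exact: continuous_scalef.
move=> y Ky; rewrite mulrC.
have Ky' : K y^-1%g by case: cK => _ _ _; exact.
have cpy : continuous (fun x => p (x * y^-1)%g).
  apply: (continuous_compf (h := fun x => (x * y^-1)%g) (f := p)) => //.
  exact: continuous_mulgr.
rewrite -[in RHS](mean_right cK cp Ky') -meanZ//.
by congr mean; apply/funext => x; rewrite mulrC.
Qed.

Lemma conv_right_invariant K L p f : compact_subgroup K -> L `<=` K ->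
  continuous p -> continuous f -> right_invariant K L f -> right_invariant K L (conv K p f).
Proof.
move=> cK LK cp cf fL y l Ky Ll; rewrite -conv_right//; last exact: LK.
apply: (eq_conv cK) => //; last by move=> z Kz; exact: fL.
apply: (continuous_compf (h := fun z => (z * l)%g) (f := f)) => //.
exact: continuous_mulgr.
Qed.

(** A Urysohn function equal to [1] on [L] and [0] at [x0] is averaged over [L] on the right; the
    result takes different values at [1] and at [x0], so removing its mean leaves a nonzero
    function. *)
Lemma right_invariant_separating K L x0 : completely_regular_space G ->
  hausdorff_space G -> compact_subgroup K -> compact_subgroup L -> L `<=` K ->
  K x0 -> ~ L x0 ->
  exists f, [/\ continuous f, right_invariant K L f, mean K f = 0 & 0 < dot K f f].
Proof.
move=> crG hG cK cL LK Kx0 Lx0; have [Lc L1 _ _] := cL; have [Kc K1 KM KV] := cK.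
have /(@uniform_separatorP _ R)[f0 [cf0 f01 f0x f0L]] :=
  crG x0 L (compact_closed hG Lc) Lx0.
have f0x0 : f0 x0 = 0 by apply: f0x; exists x0.
have f0L1 l : L l -> f0 l = 1 by move=> Ll; apply: f0L; exists l.
have f0le1 x : f0 x <= 1.
  have : range f0 (f0 x) by exists x.
  by move=> /f01; rewrite /= in_itv /= => /andP[].
pose f1 := right_mean L f0.
have cf1 : continuous f1 by exact: continuous_right_mean.
pose f x := f1 x - cst (mean K f1) x.
have cc c : continuous (cst c : G -> R) by move=> x; exact: cvg_cst.
have cf : continuous f by apply: continuous_subf.
exists f; split=> //.
- by move=> y l Ky Ll; rewrite /f /f1 right_mean_invariant.
- by rewrite meanB// mean_cst// subrr.
rewrite lt_neqAle dot_ge0// andbT; apply/negP => /eqP/esym ff0.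
have f1c y : K y -> f1 y = mean K f1.
  by move=> Ky; apply/eqP; rewrite -subr_eq0; apply/eqP/(dot_eq0 cK cf ff0).
have f11 : f1 1%g = 1.
  rewrite -(mean_cst cL 1); apply: (eq_mean cL) => //.
    by apply: (continuous_compf (h := fun z => (1 * z)%g) (f := f0)) => // z;
      under eq_fun do rewrite mul1g; exact: cvg_id.
  by move=> l Ll; rewrite mul1g f0L1.
have cx0 : continuous (fun z => f0 (x0 * z)%g).
  apply: (continuous_compf (h := fun z => (x0 * z)%g) (f := f0)) => //.
  exact: continuous_mulgl.
(* The integrand is nonnegative and equals [1] at [z = 1], so the average of [f0] at [x0] is
   strictly below [1]. *)
have : 0 < mean L (fun z => cst 1 z - f0 (x0 * z)%g).
  apply: (mean_gt0 cL (z := 1%g)) => //; first exact: continuous_subf.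
    by move=> z _; rewrite subr_ge0.
  by rewrite mulg1 f0x0 subr0 ltr01.
rewrite meanB// mean_cst// -[X in _ - X]/(f1 x0).
by rewrite f1c// -(f1c _ K1) f11 subrr ltxx.
Qed.

Theorem rigid_space_separating K L x0 : completely_regular_space G ->
  hausdorff_space G -> compact_subgroup K -> compact_subgroup L -> L `<=` K ->
  K x0 -> ~ L x0 ->
  exists U V g, [/\ nbhs 1%g U, rigid_space K U V, V g, right_invariant K L g &
    ~ right_invariant K K g].
Proof.
move=> crG hG cK cL LK Kx0 Lx0; have [Kc K1 KM KV] := cK.
have [f [cf fL mf ff]] := right_invariant_separating crG hG cK cL LK Kx0 Lx0.
(* With this kernel [conv K p f] takes the value [dot K f f] at [1], so the operator does not
   annihilate [f]. *)
pose p := checked f; have cp : continuous p by exact: continuous_checked.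
have cp' : continuous (checked p) by exact: continuous_checked.
(* [L]-invariance and mean zero are preserved by the operator; mean zero rules out a constant
   nonzero eigenfunction. *)
pose W := [set h : G -> R | [/\ continuous h, right_invariant K L h & mean K h = 0]].
have [|||||||l [g [l0 Wg [x1 Kx1 gx1] Sg]]] :=
    @eigenfunction R G K p cK cp W _ _ _ _ f 1%g.
- by move=> h [].
- move=> c h [ch hL mh]; split.
  + exact: continuous_scalef.
  + by move=> y z Ky Lz; rewrite hL.
  + by rewrite meanZ// mh mulr0.
- move=> h [ch hL mh]; have cTh : continuous (conv K p h) by exact: continuous_conv.
  split; first exact: continuous_conv_sq.
  + by apply: conv_right_invariant => //; exact: conv_right_invariant.
  + by rewrite mean_conv// mean_conv// mh !mulr0.
- move=> h ch hW; split=> //.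
  + move=> y z Ky Lz; apply/eqP; rewrite -subr_eq0 -normr_le0.
    apply/ler_addgt0Pr => e e0; rewrite add0r; have e20 : 0 < e / 2 by rewrite divr_gt0.
    have [k [ck kL mk] kh] := hW _ e20.
    have := kh y Ky; have := kh (y * z)%g (KM _ _ Ky (LK _ Lz)); rewrite kL//.
    rewrite !ler_distl => /andP[h1 h2] /andP[h3 h4].
    by apply/andP; move: h1 h2 h3 h4; clear; split; lra.
  + apply/eqP; rewrite -normr_le0; apply/ler_addgt0Pr => e e0; rewrite add0r.
    have [k [ck kL mk] kh] := hW _ e0.
    by rewrite -[mean K h]subr0 -mk distrC; exact: mean_close.
- by split.
- exact: K1.
- move=> T0; move: ff; rewrite -[X in _ < X]/(mean K (fun y => f y * f y)).
  suff -> : mean K (fun y => f y * f y) = 0 by rewrite ltxx.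
  rewrite -T0 /conv; congr mean; apply/funext => y.
  by rewrite /p /checked mul1g invgK.
have [cg gL mg] := Wg.
have [B B0 pB] := kernel_bound cK cp.
(* Chosen so that [d * (B * c) <= l * (c / 2)]; [B + 1] replaces [B], which may vanish. *)
pose d := l / (2 * (B + 1)); have d0 : 0 < d by rewrite divr_gt0// mulr_gt0// ltr_wpDl.
pose H (u : G) (q : G * G) := checked p (q.1 * u * q.2^-1)%g.
have cH : continuous (fun q : G * (G * G) => H q.1 q.2).
  apply: (continuous_compf (h := fun q : G * (G * G) => (q.2.1 * q.1 * q.2.2^-1)%g)) => //.
  apply: continuous_mulg.
    apply: continuous_mulg; last exact: continuous_fst.
    by move=> q; exact: (continuous_comp (@continuous_snd _ _ q) (@continuous_fst _ _ _)).
  move=> q; apply: (@continuous_comp _ _ _ (fun q : G * (G * G) => q.2.2) (fun x => x^-1)%g).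
    exact: (continuous_comp (@continuous_snd _ _ q) (@continuous_snd _ _ _)).
  exact: invg_continuous.
exists [set u | forall q, (K `*` K) q -> `|H u q - H 1%g q| <= d].
(* The whole eigenspace, not its intersection with [W]: means over an arbitrary subgroup [Z] need
   not preserve [L]-invariance. *)
exists [set h : G -> R | continuous h /\ forall x, K x -> conv_sq K p h x = l * h x].
exists g; split=> //.
- exact: compact_close cH (compact_setX Kc Kc) d0.
- split.
  + by move=> h [].
  + move=> h k [ch Sh] [ck Sk]; split; first exact: continuous_subf.
    move=> x Kx; have -> : (fun x => h x - k x) = (fun x => 1 * h x + (-1) * k x).
      by apply/funext => y; rewrite mul1r mulN1r.
    by rewrite conv_sq_linear// Sh// Sk//; ring.
  + move=> Z h cZ ZK [ch Sh]; split; first exact: continuous_right_mean.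
    move=> x Kx; have cTh : continuous (conv K p h) by exact: continuous_conv.
    have -> : conv_sq K p (right_mean Z h) = right_mean Z (conv_sq K p h).
      apply/funext => y; rewrite -[RHS]conv_right_mean// /conv_sq; congr conv.
      by apply/funext => z; rewrite conv_right_mean.
    have cmove (k : G -> R) : continuous k -> continuous (fun z => k (x * z)%g).
      move=> ck; apply: (continuous_compf (h := fun z => (x * z)%g) (f := k)) => //.
      exact: continuous_mulgl.
    rewrite /right_mean -meanZ//; last exact: cmove.
    apply: (eq_mean cZ).
    * by apply: cmove; exact: continuous_conv_sq.
    * by apply: continuous_scalef; exact: cmove.
    * by move=> z Zz; apply: Sh; apply: KM => //; exact: ZK.
  + move=> h c [ch Sh] hc x u Kx Uu Kxu.
    have c0 : 0 <= c by apply: le_trans (hc 1%g K1).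
    have : `|l * h (x * u)%g - l * h x| <= d * (B * c).
      rewrite -!Sh//; apply: conv_near => //; first exact: continuous_conv.
        by move=> w Kw; have := Uu (x, w) (conj Kx Kw); rewrite /H /= mulg1.
      move=> w Kw; apply: conv_norm_le => // v Kv.
      by apply: (pB _ _).1; exact/KM/KV.
    rewrite -mulrBr normrM gtr0_norm// => hl.
    rewrite -(ler_pM2l l0); apply: le_trans hl _.
    have -> : d * (B * c) = (B / (B + 1)) * (l * (c / 2)).
      by rewrite /d; field; rewrite gt_eqF// ltr_wpDl.
    rewrite ler_piMl//; first by rewrite mulr_ge0 ?divr_ge0// ltW.
    by rewrite ler_pdivrMr ?ltr_wpDl// mul1r lerDl.
- move=> gK; apply: gx1.
  have g1 y : K y -> g y = g 1%g by move=> Ky; rewrite -[y in LHS]mul1g gK.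
  rewrite g1// -mg; apply/esym; rewrite -[RHS](mean_cst cK); apply: (eq_mean cK) => //.
  by move=> x; exact: cvg_cst.
Qed.

End invariance.

End analysis.

Local Open Scope group_scope.

(** * Tame semigroups *)

Record tame (T : topSemigroupType) : Prop := Tame {
  tame_commute : forall e f u : T, idempotents T e -> idempotents T f ->
    maximal_subgroup u (e * f) -> e * f = f * e;
  tame_connected : forall Q : set T, compact Q -> connected Q ->
    (forall x y, Q x -> Q y -> Q (x * y)) -> Q `<=` idempotents T ->
    is_subset1 Q
}.

(** * Compact subsemigroups of topological groups *)

Section topological_groups.
Variable G : topGroupType.
Hypothesis hG : hausdorff_space G.

(** The powers of [a] cluster somewhere, and two of them close to the cluster point differ by a
    power close to [1]. With an exponent of at least 2, division by [a] still leaves a positive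
    power. *)
Lemma recurrent_powers (A : set G) (a : G) (U : set G) : compact A ->
  (forall x y, A x -> A y -> A (x * y)) -> A a -> nbhs 1 U ->
  exists k, U (a ^+ k.+2).
Proof.
move=> cA AM Aa U1.
have Aan n : A (a ^+ n.+1).
  by elim: n => [//|n IH]; rewrite expgS; exact: AM.
have [|p [Ap clp]] := cA ((fun n => a ^+ n.+1) @ \oo) (fmap_proper_filter _ _).
  by exists 0%N => // n _; exact: Aan.
have c : continuous (fun q : G * G => q.1^-1 * q.2).
  apply: continuous_mulg; last exact: continuous_snd.
  by move=> q; apply: (@continuous_comp _ _ _ fst (fun x => x^-1));
    [exact: continuous_fst|exact: invg_continuous].
have /(c (p, p)) [[V1 V2] /= [V1p V2p] VU] : nbhs ((p, p).1^-1 * (p, p).2) U.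
  by rewrite /= mulVg.
have freq N : exists2 n, (N <= n)%N & (V1 `&` V2) (a ^+ n.+1).
  have [||_ [[n /= Nn <-] Vn]] := clp [set a ^+ n.+1 | n in [set n | (N <= n)%N]] (V1 `&` V2).
  - by exists N => // n Nn; exists n.
  - exact: filterI.
  - by exists n.
(* Asking for [m >= n + 2] makes the exponent [m - n] of the quotient at least 2. *)
have [n _ [V1n _]] := freq 0%N; have [m nm [_ V2m]] := freq n.+2.
exists (m - n.+2)%N.
have -> : a ^+ (m - n.+2).+2 = (a ^+ n.+1)^-1 * a ^+ m.+1.
  have -> : m.+1 = (n.+1 + (m - n.+2).+2)%N.
    by rewrite -[in LHS](subnK nm) !addnS !addSn addnC.
  by rewrite expgnDr mulKg.
exact: (VU (a ^+ n.+1, a ^+ m.+1)).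
Qed.

(** Positive powers of [a] accumulate at [1], hence also at [a^-1] after lowering the exponent by
    one; and [A] is closed. *)
Lemma compact_subsemigroup (A : set G) : compact A -> A !=set0 ->
  (forall x y, A x -> A y -> A (x * y)) -> compact_subgroup A.
Proof.
move=> cA [a0 Aa0] AM; have clA := compact_closed hG cA.
have Aan a n : A a -> A (a ^+ n.+1).
  by move=> Aa; elim: n => [//|n IH]; rewrite expgS; exact: AM.
have A1 : A 1.
  apply: clA => U /(recurrent_powers cA AM Aa0)[k Uk].
  by exists (a0 ^+ k.+2); split=> //; exact: Aan.
split=> // a Aa; apply: clA => N Na.
have [k Nk] : exists k, N (a^-1 * a ^+ k.+2).
  have := @recurrent_powers A a (fun x => N (a^-1 * x)) cA AM Aa; apply.
  have := @continuous_mulg _ _ (cst a^-1) id (fun=> cvg_cst _) (fun=> cvg_id) 1.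
  by apply; rewrite mulg1.
by exists (a ^+ k.+1); split; [exact: Aan|move: Nk; rewrite expgS mulKg].
Qed.

End topological_groups.

(** * Tameness of hypersemigroups *)

Section hypersemigroup.
Variable G : topGroupType.
Hypothesis hG : hausdorff_space G.
Implicit Types X Y : hypersemigroup G.

Lemma hyper_compact X : compact (hyper_set X).
Proof. by have [] := set_mem (valP X). Qed.

Lemma hyper_nonempty X : hyper_set X !=set0.
Proof. by have [] := set_mem (valP X). Qed.

Lemma hyper_inj X Y : hyper_set X = hyper_set Y -> X = Y.
Proof. by move=> XY; apply: val_inj. Qed.

Lemma hyper_idempotent X : idempotents _ X -> compact_subgroup (hyper_set X).
Proof.
move=> XX; apply: compact_subsemigroup => //; first exact: hyper_compact.
  exact: hyper_nonempty.
by move=> x y Xx Xy; rewrite -XX; exists x => //; exists y.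
Qed.

(** A point of one set outside the other compact set is separated from it by open [V] and [W]; no
    set inside [W] meets [V]. *)
Lemma hyper_hausdorff : hausdorff_space (hypersemigroup G).
Proof.
suff sep X Y x : hyper_set X x -> ~ hyper_set Y x -> exists U V,
    [/\ open U, open V, U X, V Y & forall Z, U Z -> V Z -> False].
  apply/hausdorff_openP => X Y XY.
  have [x XYx] : exists x, ~ (hyper_set X x <-> hyper_set Y x).
    by apply/existsNP => XYE; apply: XY; apply/hyper_inj/seteqP; split=> x /XYE.
  have [Xx|Xx] := pselect (hyper_set X x).
    by apply: (sep X Y x) => // Yx; apply: XYx.
  have Yx : hyper_set Y x by apply: contrapT => Yx; apply: XYx; split=> // /Xx.
  have [U [V [oU oV YU XV UV]]] := sep Y X x Yx Xx.
  by exists V, U; split=> // Z VZ UZ; exact: (UV Z).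
move=> Xx Yx.
have [||||V] := @tube G G [set x] (hyper_set Y) [set p | p.1 <> p.2].
- exact: compact_set1.
- exact: hyper_compact.
- apply: closed_openC; apply: closed_equalizer => //.
    exact: continuous_fst.
  exact: continuous_snd.
- by move=> [a b] [/= -> Yb] xb; apply: Yx; rewrite xb.
move=> [W [oV xV oW YW VW]].
exists [set Z | hyper_set Z `&` V !=set0], [set Z | hyper_set Z `<=` W]; split => //=.
- exact: vietoris_open_meets.
- exact: vietoris_open_sub.
- by exists x; split=> //; exact: xV.
- by move=> Z [z [Zz Vz]] ZW; apply: (VW (z, z)); split=> //=; exact: ZW.
Qed.

Lemma compact_hyper_union (Q : set (hypersemigroup G)) : compact Q ->
  compact (\bigcup_(X in Q) hyper_set X).
Proof.
move=> /compact_near_coveringP cQ; apply/compact_near_coveringP => I F P FF KP.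
have h : \forall i \near F, Q `<=` (fun X => hyper_set X `<=` P i).
  apply: cQ => X QX.
  (* The filter of small index sets lets compactness of [X] produce a single [W] valid at all its
     points, and then on a Vietoris neighbourhood of [X]. *)
  pose F' : set_system (set I) := filter_from F (fun W => [set W' | W' `<=` W]).
  have FF' : Filter F'.
    apply: filter_from_filter; first by exists setT; exact: filterT.
    move=> W W' FW FW'; exists (W `&` W'); first exact: filterI.
    by move=> Z /=; rewrite subsetI => -[].
  pose P' (W : set I) : set G := [set y | forall i, W i -> P i y].
  have [W FW WX] : \forall W \near F', hyper_set X `<=` (fun x => nbhs x (P' W)).
    have /compact_near_coveringP cX := @hyper_compact X.
    apply: cX => x Xx; have [[N W] [/= Nx FW] NW] := KP x (ex_intro2 _ _ X QX Xx).
    exists (N°, [set W' | W' `<=` W]).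
      by split; [exact: nbhs_interior|exists W].
    move=> [x' W'] [/= Nx' W'W]; apply: filterS Nx' => y Ny i /W'W Wi.
    exact: (NW (y, i)).
  exists ([set Y | hyper_set Y `<=` (P' W)°], W).
    split=> //; apply: open_nbhs_nbhs; split; last by move=> x Xx; exact: (WX W).
    by apply: vietoris_open_sub; exact: open_interior.
  by move=> [Y i] [/= YV Wi] y /YV /interior_subset; exact.
by apply: filterS h => i Wi x [X QX Xx]; exact: (Wi X QX).
Qed.

(** Since [1] is in [X * Y], the identity [Z] lies in [Z * (X * Y)], which is [X * Y]. Conversely,
    an element of the group inverse [T] of [X * Y] lies in [Z] and can be cancelled from products
    lying in [Z]. So [X * Y] is a subgroup of [G], and inverting its elements gives [Y * X]. *)
Lemma hyper_commute X Y Z : idempotents _ X -> idempotents _ Y ->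
  maximal_subgroup Z (X * Y) -> X * Y = Y * X.
Proof.
move=> iX iY [A [AZ AM A1 AV] AXY].
have iZ : idempotents _ Z by case: (A1 _ AZ).
have [Xc X1 XM XV] := hyper_idempotent iX.
have [Yc Y1 YM YV] := hyper_idempotent iY.
have [Zc Z1 ZM ZV] := hyper_idempotent iZ.
have [ZXY _] := A1 _ AXY; have [T [AT XYT TXY]] := AV _ AXY.
have [t Tt] := hyper_nonempty T.
have XY1 : hyper_set (X * Y) 1 by exists 1 => //; exists 1 => //; rewrite mulg1.
have XYZ : hyper_set (X * Y) = hyper_set Z.
  rewrite eqEsubset; split=> [x XYx|z Zz]; last first.
    by rewrite -ZXY; exists z => //; exists 1 => //; rewrite mulg1.
  have Zt : hyper_set Z t by rewrite -XYT; exists 1 => //; exists t => //; rewrite mul1g.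
  have Zxt : hyper_set Z (x * t) by rewrite -XYT; exists x => //; exists t.
  by rewrite -[x](mulgK t); apply: ZM => //; exact: ZV.
apply: hyper_inj; rewrite XYZ eqEsubset; split=> z.
  move=> /ZV; rewrite -XYZ => -[x Xx [y Yy xy]].
  exists y^-1; first exact: YV; exists x^-1; first exact: XV.
  by rewrite -invgM xy invgK.
move=> [y Yy [x Xx <-]]; rewrite -[y * x]invgK; apply: ZV; rewrite -XYZ.
by exists x^-1; [exact: XV|exists y^-1; [exact: YV|rewrite -invgM]].
Qed.

Variable R : realType.
Hypothesis crG : completely_regular_space G.

Lemma hyper_connected (Q : set (hypersemigroup G)) : compact Q -> connected Q ->
  (forall X Y, Q X -> Q Y -> Q (X * Y)) -> Q `<=` idempotents _ -> is_subset1 Q.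
Proof.
move=> cQ coQ QM Qi; pose K := \bigcup_(X in Q) hyper_set X.
suff QK X : Q X -> hyper_set X = K.
  by move=> X Y QX QY; apply: hyper_inj; rewrite (QK X) ?(QK Y).
move=> QX; have XK Y : Q Y -> hyper_set Y `<=` K by move=> QY x Yx; exists Y.
have Qg Y : Q Y -> compact_subgroup (hyper_set Y) by move=> /Qi; exact: hyper_idempotent.
have cK : compact_subgroup K.
  apply: compact_subsemigroup => //; first exact: compact_hyper_union.
    by have [x Xx] := hyper_nonempty X; exists x, X.
  move=> x y [Y QY Yx] [Z QZ Zy]; exists (Y * Z); first exact: QM.
  by exists x => //; exists y.
rewrite eqEsubset; split; first exact: XK.
move=> x0 Kx0; apply: contrapT => Xx0.
have [U [V [g [U1 rV Vg gX gK]]]] :=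
  rigid_space_separating (R := R) crG hG cK (Qg X QX) (XK X QX) Kx0 Xx0.
have [Kc K1 KM KV] := cK; have cg := rigid_continuous rV Vg.
pose C := [set Y | Q Y /\ right_invariant K (hyper_set Y) g].
have CQ : C = Q.
  apply: coQ; first by exists X.
  (* Openness in [Q]. A nearby [Y'] need not contain [Y], so [rigid_invariant] is applied to the
     group [Y' * Y], which contains both and lies in the product of [U] and [Y] when [Y'] is close
     to [Y]. *)
  - pose UY (Y : hypersemigroup G) := \bigcup_(y in hyper_set Y) [set z | U° (z * y^-1)].
    pose O (Y : hypersemigroup G) := [set Y' : hypersemigroup G | hyper_set (Y' * Y) `<=` UY Y].
    exists (\bigcup_(Y in C) O Y).
      apply: bigcup_open => Y CY.
      apply: (@open_comp _ _ (fun Y' => Y' * Y) [set Z | hyper_set Z `<=` UY Y]).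
        move=> Y' _; exact: continuous_mulgr.
      apply: vietoris_open_sub; apply: bigcup_open => y Yy.
      apply: (@open_comp _ _ (fun z => z * y^-1) U°); last exact: open_interior.
      move=> z _; exact: continuous_mulgr.
    rewrite eqEsubset; split=> [Y CY|Y' [QY' [Y [QY gY] OY]]].
      split; first by case: CY.
      exists Y => //; rewrite /O /=; have -> : Y * Y = Y by case: CY => /Qi.
      by move=> y Yy; exists y => //=; rewrite mulgV; exact: nbhs_singleton (nbhs_interior U1).
    split=> //; have [_ Y1 _ _] := Qg Y QY; have [_ Y'1 _ _] := Qg Y' QY'.
    have gYY : right_invariant K (hyper_set (Y' * Y)) g.
      apply: (rigid_invariant cK rV (Qg Y QY)) => //.
      + exact/Qg/QM.
      + by move=> y Yy; exists 1 => //; exists y => //; rewrite mul1g.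
      + exact/XK/QM.
      + move=> z /OY[y Yy Uzy]; exists (z * y^-1), y; split=> //.
          exact: interior_subset Uzy.
        by rewrite mulgVK.
    move=> y x Ky Y'x; apply: gYY => //.
    by exists x => //; exists 1 => //; rewrite mulg1.
  (* Closedness in [Q]: failing to fix [g] means meeting the open set [D], a Vietoris open
     condition. *)
  - pose D := \bigcup_(y in K) [set h | g (y * h) != g y].
    exists (~` [set Y | hyper_set Y `&` D !=set0]).
      apply: open_closedC; apply: vietoris_open_meets; apply: bigcup_open => y Ky.
      apply: (@open_comp _ _ (fun h => g (y * h)) [set r | r != g y]).
        move=> h _; apply: (@continuous_comp _ _ _ (fun h => y * h) g); last exact: cg.
        exact: continuous_mulgl.
      have -> : [set r | r != g y] = ~` [set g y].
        by apply/seteqP; split=> r /= /eqP.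
      apply: closed_openC; apply: accessible_closed_set1.
      exact/hausdorff_accessible/Rhausdorff.
    rewrite eqEsubset; split=> [Y [QY gY]|Y [QY nY]].
      by split=> // -[h [Yh [y Ky /= /eqP]]]; apply; exact: gY.
    split=> // y h Ky Yh; apply: contrapT => gyh; apply: nY.
    by exists h; split=> //; exists y => //=; apply/eqP.
apply: gK => y x Ky [Y QY Yx]; have : C Y by rewrite CQ.
by move=> [_]; apply.
Qed.

Lemma tame_hypersemigroup : tame (hypersemigroup G).
Proof. by split; [exact: hyper_commute|exact: hyper_connected]. Qed.

End hypersemigroup.

(** * Permanence of tameness *)

Lemma maximal_subgroupE (S : semigroupType) (e x : S) :
  maximal_subgroup e x <-> [/\ e * e = e, e * x = x, x * e = x &
    exists y, [/\ e * y = y, y * e = y, x * y = e & y * x = e]].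
Proof.
split=> [Hx|[ee ex xe [y [ey ye xy yx]]]].
  have ee : e * e = e by case: Hx => A [Ae _ /(_ _ Ae)[]].
  have [_ _ He HV] := maximal_subgroupP ee.
  have [ex xe] := He _ Hx; have [y [/He[ey ye] xy yx]] := HV _ Hx.
  by split=> //; exists y.
exists [set z | [/\ e * z = z, z * e = z & exists y, [/\ e * y = y, y * e = y, z * y = e & y * z = e]]].
  split.
  - by split=> //; exists e.
  - move=> a b [ea ae [a' [ea' a'e aa' a'a]]] [eb be [b' [eb' b'e bb' b'b]]].
    split; [by rewrite mulgA ea|by rewrite -mulgA be|exists (b' * a')].
    split; [by rewrite mulgA eb'|by rewrite -mulgA a'e| |].
      by rewrite -mulgA [b * _]mulgA bb' ea'.
    by rewrite -mulgA [a' * _]mulgA a'a eb.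
  - by move=> a [].
  - move=> a [ea ae [b [eb be ab ba]]]; exists b; split=> //.
    by split=> //; exists a.
by split=> //; exists y.
Qed.

Lemma maximal_subgroup_morph (S T : semigroupType) (f : S -> T) e x :
  {morph f : x y / x * y} -> maximal_subgroup e x -> maximal_subgroup (f e) (f x).
Proof.
move=> fM /maximal_subgroupE[ee ex xe [y [ey ye xy yx]]]; apply/maximal_subgroupE.
split; rewrite -?fM ?ee ?ex ?xe//; exists (f y).
by rewrite -!fM ey ye xy yx.
Qed.

Lemma connected_image (X Y : topologicalType) (f : X -> Y) (Q : set X) :
  continuous f -> connected Q -> connected (f @` Q).
Proof.
by move=> cf coQ; apply: connected_continuous_connected => //; exact: continuous_subspaceT.
Qed.

Lemma compact_image (X Y : topologicalType) (f : X -> Y) (Q : set X) :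
  continuous f -> compact Q -> compact (f @` Q).
Proof.
by move=> cf coQ; apply: continuous_compact => //; exact: continuous_subspaceT.
Qed.

(** A failure of either clause exhibits two distinct points. A homomorphism separating them
    transports idempotents, subgroups, compactness and connectedness, and contradicts tameness of
    its target. *)
Lemma tame_separated (S : topSemigroupType) :
  (forall x y : S, x <> y -> exists (T : topSemigroupType) (f : S -> T),
    [/\ tame T, {morph f : x y / x * y}, continuous f & f x <> f y]) ->
  tame S.
Proof.
move=> sepS; split.
  move=> e f u ee ff uef; apply: contrapT => /sepS[T [h [tT hM _]]]; apply.
  have idh x : idempotents S x -> idempotents T (h x) by rewrite /idempotents /= -hM => ->.
  rewrite !hM; apply: (tame_commute tT (u := h u)); try exact: idh.
  by rewrite -hM; exact: maximal_subgroup_morph.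
move=> Q cQ coQ QM Qi x y Qx Qy; apply: contrapT => /sepS[T [h [tT hM ch]]]; apply.
apply: (tame_connected tT (Q := h @` Q)).
- exact: compact_image.
- exact: connected_image.
- by move=> _ _ [a Qa <-] [b Qb <-]; exists (a * b); [exact: QM|rewrite hM].
- by move=> _ [a Qa <-]; rewrite /idempotents /= -hM Qi.
- by exists x.
- by exists y.
Qed.

Lemma tame_embeds (S T : topSemigroupType) : embeds S T -> tame T -> tame S.
Proof.
move=> [f fM fE] tT; apply: tame_separated => x y xy; exists T, f; split=> //.
  exact: embedding_continuous.
by move=> fxy; apply: xy; apply: fE.1.
Qed.

Lemma tame_prod (I : Type) (F : I -> topSemigroupType) :
  (forall i, tame (F i)) -> tame (prod_topology F).
Proof.
move=> tF; apply: tame_separated => x y xy.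
have [i xyi] : exists i, x i <> y i.
  by apply/existsNP => xyE; apply: xy; exact: functional_extensionality_dep.
by exists (F i), (fun f => f i); split=> //; exact: continuous_proj.
Qed.

Section semidirect.
Variables (T : topSemigroupType) (G : topGroupType) (s : top_action G T).
Implicit Types x y : semidirect s.

Lemma top_act1 (t : T) : s 1 t = t.
Proof.
have [_ [h [sK _] _]] := top_act_aut s 1.
by apply: (can_inj sK); rewrite -[in RHS](mulg1 1) top_actM.
Qed.

Lemma semidirect_idempotent x : idempotents _ x -> x.2 = 1 /\ x.1 * x.1 = x.1.
Proof.
case: x => t g; rewrite /idempotents /= => -[]; rewrite /= => tE gE.
have g1 : g = 1 by apply: (mulgI g); rewrite mulg1.
by split=> //; move: tE; rewrite g1 top_act1.
Qed.

(** Idempotents have trivial group component and [1] acts trivially, so all the products involved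
    are computed in [T]. *)
Lemma tame_semidirect : tame T -> tame (semidirect s).
Proof.
move=> tT; split.
  move=> [a g] [b h] [c k] /semidirect_idempotent[/= -> aa] /semidirect_idempotent[/= -> bb].
  move=> /maximal_subgroupE[/semidirect_idempotent[/= -> cc]].
  move=> [+ _] [+ _] [[d l] [[+ _] [+ _] [+ lE] [+ _]]]; rewrite /=.
  have l1 : l = 1 by move: lE; rewrite /= mulg1 mul1g.
  rewrite l1 !mulg1 !top_act1 => h1 h2 h3 h4 h5 h6.
  congr (_, _); rewrite /= !top_act1; apply: (tame_commute tT (u := c)) => //.
  by apply/maximal_subgroupE; split=> //; exists d.
move=> Q cQ coQ QM Qi [a g] [b h] Qa Qb.
have [/= g1 _] := semidirect_idempotent (Qi _ Qa).
have [/= h1 _] := semidirect_idempotent (Qi _ Qb).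
rewrite g1 h1; congr (_, _).
have c1 : continuous (fst : semidirect s -> T) by exact: (@continuous_fst T G).
apply: (tame_connected tT (Q := (fst : semidirect s -> T) @` Q)).
- exact: compact_image.
- exact: connected_image.
- move=> _ _ [x Qx <-] [y Qy <-]; exists (x * y); first exact: QM.
  have [x1 _] := semidirect_idempotent (Qi _ Qx).
  by rewrite /= x1 top_act1.
- by move=> _ [x Qx <-]; have [] := semidirect_idempotent (Qi _ Qx).
- by exists (a, g).
- by exists (b, h).
Qed.

End semidirect.

Section zero_extension.
Variable T : topSemigroupType.

Lemma continuous_zero_out (Y : topologicalType) (h : T -> Y) (y0 : Y) :
  continuous h -> continuous (fun x : zero_extension T => if x is Some t then h t else y0).
Proof.
move=> ch [t|] U Uy; last by apply/nbhs_zero_None; exact: nbhs_singleton Uy.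
by apply/nbhs_zero_Some; exact: ch.
Qed.

Lemma open_zero : open [set None : zero_extension T].
Proof.
rewrite /open /= /zero_open /=.
have -> : Some @^-1` [set None] = set0 :> set T by rewrite -subset0 => x.
exact: open0.
Qed.

Lemma closed_zero : closed [set None : zero_extension T].
Proof.
rewrite -[X in closed X]setCK; apply: open_closedC.
rewrite /open /= /zero_open /=.
have -> : Some @^-1` (~` [set None]) = setT :> set T by rewrite -subTset => x.
exact: openT.
Qed.

Lemma tame_zero_extension : tame T -> tame (zero_extension T).
Proof.
move=> tT; split.
  move=> [a|] [b|] u //= [aa] [bb] /maximal_subgroupE.
  case: u => [c|] [cc h1 h2 [[d|] [h3 h4 h5 h6]]] //.
  congr Some; apply: (tame_commute tT (u := c)) => //.
  case: cc h1 h2 h3 h4 h5 h6 => cc [h1] [h2] [h3] [h4] [h5] [h6].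
  by apply/maximal_subgroupE; split=> //; exists d.
move=> Q cQ coQ QM Qi.
have [QN|QN] := pselect (Q None).
  (* Zero is isolated, so a connected set through it is a singleton. *)
  suff QE : Q = [set None] by rewrite QE => x y -> ->.
  rewrite -[LHS](coQ (Q `&` [set None])).
  - by rewrite eqEsubset; split=> [x []//|_ ->].
  - by exists None.
  - by exists [set None] => //; exact: open_zero.
  - by exists [set None] => //; exact: closed_zero.
move=> [a|] [b|] // Qa Qb; congr Some.
(* The value [a] at zero is a dummy: [Q] avoids zero. *)
pose r (x : zero_extension T) := if x is Some t then t else a.
have cr : continuous r by apply: (continuous_zero_out (h := id)) => x; exact: cvg_id.
apply: (tame_connected tT (Q := r @` Q)).
- exact: compact_image.
- exact: connected_image.
- move=> _ _ [[x|] Qx <-] [[y|] Qy <-] //; exists (Some (x * y)) => //.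
  exact: (QM (Some x) (Some y)).
- by move=> _ [[x|] Qx <-] //; have [] := Qi _ Qx.
- by exists (Some a).
- by exists (Some b).
Qed.

End zero_extension.

Lemma tame_class_H (R : realType) (S : topSemigroupType) : class_H S -> tame S.
Proof.
move=> [G [hG crG] SG]; apply: tame_embeds SG _.
exact: (tame_hypersemigroup hG R crG).
Qed.

Lemma tame_class_H0 (R : realType) (S : topSemigroupType) : class_H0 S -> tame S.
Proof.
elim=> [I F {}S _ tF SF|T G s _ tT _ _|T HT _].
- exact: tame_embeds SF (tame_prod tF).
- exact: tame_semidirect.
- exact: tame_zero_extension (tame_class_H R HT).
Qed.

(** * From tameness to inverse semigroups with zero-dimensional semilattice *)

Lemma clifford_commuting_inverse (S : semigroupType) : clifford S ->
  (forall e f : S, idempotents S e -> idempotents S f -> e * f = f * e) ->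
  inverse_semigroup S.
Proof.
move=> cS cE x; have [e [A [[Ae AM A1 AV] Ax]]] := cS x.
have [y [Ay xy yx]] := AV _ Ax; have [ex xe] := A1 _ Ax; have [ey ye] := A1 _ Ay.
exists y; split; first by rewrite /is_inverse xy ex yx ey.
move=> z [xzx zxz].
have ixz : idempotents S (x * z) by rewrite /idempotents /= mulgA xzx.
have izx : idempotents S (z * x) by rewrite /idempotents /= mulgA zxz.
have ie : idempotents S e by case: (A1 _ Ae).
(* Both [z * x] and [x * z] absorb [e]; commuting [e], written [y * x] or [x * y], past them lets
   [x * z * x = x] collapse the product to [e]. *)
have h1 : z * x = e.
  have <- : (z * x) * e = z * x by rewrite -mulgA xe.
  by rewrite (cE _ _ izx ie) -yx -mulgA [x * (z * x)]mulgA xzx.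
have h2 : x * z = e.
  have <- : e * (x * z) = x * z by rewrite mulgA ex.
  by rewrite (cE _ _ ie ixz) -xy mulgA xzx.
by rewrite -ye -h2 mulgA yx -h1 zxz.
Qed.

Lemma inverse_continuous (S : topSemigroupType) : hausdorff_space S ->
  compact [set: S] -> inverse_semigroup S -> topological_inverse_semigroup S.
Proof.
move=> hS cS iS; split=> //.
have /choice[inv invP] : forall x : S, exists y : S, is_inverse x y.
  by move=> x; have [y [xy _]] := iS x; exists y.
exists inv => //; apply: closed_graph_continuous => //.
(* By uniqueness of inverses the graph is cut out by two equations, so it is closed. *)
have -> : [set p : S * S | inv p.1 = p.2] =
    [set p | p.1 * p.2 * p.1 = p.1] `&` [set p | p.2 * p.1 * p.2 = p.2].
  rewrite eqEsubset; split=> [[x y] /= <-|[x y] /= [xyx yxy]]; first exact: invP.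
  have [z [_ zU]] := iS x.
  by rewrite -(zU _ (invP x)) (zU y).
have c1 := @continuous_fst S S; have c2 := @continuous_snd S S.
by apply: closedI; apply: closed_equalizer => //; do ?[apply: continuous_mulg => //].
Qed.

Lemma tame_clifford (S : topSemigroupType) : hausdorff_space S ->
  compact [set: S] -> clifford S -> tame S ->
  topological_inverse_semigroup S /\ has_clopen_base (idempotents S).
Proof.
move=> hS cS clS tS.
have cE e f : idempotents S e -> idempotents S f -> e * f = f * e.
  move=> ee ff; have [u [A [uA Aef]]] := clS (e * f).
  by apply: (tame_commute tS (u := u)) => //; exists A.
split; first by apply: inverse_continuous => //; exact: clifford_commuting_inverse.
have clE : closed (idempotents S).
  apply: (closed_equalizer (f := fun e => e * e) (g := id) hS).
    by apply: continuous_mulg => x; exact: cvg_id.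
  by move=> x; exact: cvg_id.
have cpE : compact (idempotents S) by exact: subclosed_compact cS _.
apply: totally_disconnected_clopen_base.
- exact: compact_set_type.
- apply: hausdorff_injective hS _ _; first exact: continuous_set_val.
  exact: set_val_inj.
move=> Q coQ x y Qx Qy; apply: set_val_inj.
pose P := connected_component (idempotents S) (set_val x).
have Px : idempotents S (set_val x) by exact: set_valP.
have QP : set_val @` Q `<=` P.
  apply: connected_component_max; [by exists x| |].
    by move=> _ [z _ <-]; exact: set_valP.
  by apply: connected_image => //; exact: continuous_set_val.
apply: (tame_connected tS (Q := P)).
- by apply: subclosed_compact cpE _; [exact: component_closed|exact: connected_component_sub].
- exact: component_connected.
- move=> a b Pa Pb; have PE := @connected_component_sub _ (idempotents S) (set_val x).
  have ia := PE _ Pa.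
  (* Left translation by [a] carries the component to a connected set of idempotents through
     [a * a = a]. *)
  rewrite /P (same_connected_component Pa).
  suff : (fun c => a * c) @` P `<=` connected_component (idempotents S) a.
    by apply; exists b.
  apply: connected_component_max.
  + by exists a.
  + move=> _ [c /PE ic <-]; rewrite /idempotents /=.
    by rewrite mulgA -[a * c * a]mulgA (cE c a)// mulgA ia -mulgA ic.
  + apply: connected_image; last exact: component_connected.
    apply: (@continuous_mulg _ _ (cst a) id); first exact: cst_continuous.
    by move=> c; exact: cvg_id.
- exact: connected_component_sub.
- by apply: QP; exists x.
- by apply: QP; exists y.
Qed.

(** * Inverse Clifford semigroups *)

Lemma hausdorff_separated (X : topologicalType) :
  (forall x y : X, x <> y -> exists (Y : topologicalType) (f : X -> Y),
    [/\ hausdorff_space Y, continuous f & f x <> f y]) -> hausdorff_space X.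
Proof.
move=> sX; apply/hausdorff_openP => x y /sX[Y [f [/hausdorff_openP hY cf fxy]]].
have [A [B [oA oB Ax By AB]]] := hY _ _ fxy.
exists (f @^-1` A), (f @^-1` B); split=> //; last by move=> z; exact: AB.
  by apply: open_comp => // z _; exact: cf.
by apply: open_comp => // z _; exact: cf.
Qed.

Lemma prod_hausdorff (I : Type) (F : I -> topologicalType) :
  (forall i, hausdorff_space (F i)) -> hausdorff_space (prod_topology F).
Proof.
move=> hF; apply: hausdorff_separated => x y xy.
have [i xyi] : exists i, x i <> y i.
  by apply/existsNP => xyE; apply: xy; exact: functional_extensionality_dep.
by exists (F i), (fun f => f i); split=> //; exact: continuous_proj.
Qed.

Lemma zero_extension_hausdorff (T : topSemigroupType) :
  hausdorff_space T -> hausdorff_space (zero_extension T).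
Proof.
move=> hT; have sN (t : T) : exists (Y : topologicalType) (f : zero_extension T -> Y),
    [/\ hausdorff_space Y, continuous f & f (Some t) <> f None].
  exists bool, (fun x : zero_extension T => if x is Some _ then true else false); split=> //.
    exact: discrete_hausdorff.
  by apply: (@continuous_zero_out T bool (cst true) false); exact: cst_continuous.
apply: hausdorff_separated => -[a|] [b|] ab; last by [].
- exists T, (fun x : zero_extension T => if x is Some t then t else a); split=> //.
    by apply: (continuous_zero_out (h := id)) => x; exact: cvg_id.
  by move=> abE; apply: ab; rewrite abE.
- exact: sN.
- have [Y [f [hY cf fb]]] := sN b; exists Y, f; split=> // fE.
  by apply: fb; rewrite -fE.
Qed.

Lemma maxsubgroup_hausdorff (S : topSemigroupType) (e : S) :
  hausdorff_space S -> hausdorff_space (maxsubgroup e).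
Proof.
move=> hS; have := @hausdorff_injective _ _ (set_val : maximal_subgroup e -> S) hS.
by apply; [exact: continuous_set_val|exact: set_val_inj].
Qed.

Section inverse.
Variable S : semigroupType.
Hypotheses (iS : inverse_semigroup S) (clS : clifford S).
Variable inv : S -> S.
Hypothesis invP : forall x, is_inverse x (inv x).
Implicit Types x y e f : S.

(** In a Clifford inverse semigroup, the identity of the maximal subgroup containing [x];
    [left_unitV] identifies it with the right unit. *)
Definition left_unit x := x * inv x.

Lemma is_inverse_unique x y z : is_inverse x y -> is_inverse x z -> y = z.
Proof. by have [w [_ wU]] := iS x => /wU <- /wU. Qed.

Lemma idempotent_inverse e : idempotents S e -> is_inverse e e.
Proof. by move=> ee; rewrite /is_inverse !ee. Qed.

(** If [x] is the inverse of [e * f], then so is [f * x * e]; equality makes [x] idempotent, hence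
    its own inverse, and then [e * f = x]. *)
Lemma idempotentM e f : idempotents S e -> idempotents S f -> idempotents S (e * f).
Proof.
move=> ee ff; have [h1 h2] := invP (e * f); set x := inv (e * f) in h1 h2.
(* The relations carry a left context [z] so that they rewrite inside left-associated products. *)
have eR z : z * e * e = z * e by rewrite -mulgA ee.
have fR z : z * f * f = z * f by rewrite -mulgA ff.
have h2R z : z * x * e * f * x = z * x by rewrite -[in RHS]h2 !mulgA.
have xE : f * x * e = x.
  apply: (is_inverse_unique (x := e * f)); last by split.
  by split; rewrite !mulgA ?fR ?eR ?fR ?h2R//; move: h1; rewrite !mulgA.
have ix : idempotents S x.
  have : (f * x * e) * (f * x * e) = f * x * e by rewrite !mulgA h2R.
  by rewrite xE.
have -> // : e * f = x.
apply: (is_inverse_unique (x := x)); first by split.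
exact: idempotent_inverse.
Qed.

(** The idempotent [e * f] is its own inverse, and [f * e] is an inverse of it too. *)
Lemma idempotentC e f : idempotents S e -> idempotents S f -> e * f = f * e.
Proof.
move=> ee ff; have ief := idempotentM ee ff; have ife := idempotentM ff ee.
have eR z : z * e * e = z * e by rewrite -mulgA ee.
have fR z : z * f * f = z * f by rewrite -mulgA ff.
apply: (is_inverse_unique (x := e * f)); first exact: idempotent_inverse.
split; rewrite !mulgA ?fR ?eR ?fR; [move: ief|move: ife];
  by rewrite /idempotents /= !mulgA.
Qed.

Lemma left_unitV x : inv x * x = left_unit x.
Proof.
have [e [A [[Ae AM A1 AV] Ax]]] := clS x.
have [y [Ay xy yx]] := AV _ Ax; have [ex xe] := A1 _ Ax; have [ey ye] := A1 _ Ay.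
have <- : y = inv x by apply: is_inverse_unique (invP x); rewrite /is_inverse xy ex yx ey.
by rewrite /left_unit yx; have -> : inv x = y by apply: is_inverse_unique (invP x) _; rewrite /is_inverse xy ex yx ey.
Qed.

Lemma left_unitK x : left_unit x * x = x.
Proof. by have [] := invP x. Qed.

Lemma right_unitK x : x * left_unit x = x.
Proof. by rewrite -left_unitV mulgA; have [] := invP x. Qed.

Lemma left_unit_idempotent x : idempotents S (left_unit x).
Proof. by rewrite /idempotents /left_unit /= mulgA; have [-> _] := invP x. Qed.

(** Left and right units of [e * x] agree. As its inverse is [inv x * e], this reads
    [inv x * e * x = x * inv x * e], and multiplication by [x] on the left gives the claim. *)
Lemma idempotent_central e x : idempotents S e -> e * x = x * e.
Proof.
move=> ee; have [xyx yxy] := invP x.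
have := idempotentC ee (left_unit_idempotent x); have := right_unitK x.
have := left_unitV (e * x); rewrite /left_unit; set y := inv x in xyx yxy *.
move=> + xxy; rewrite !mulgA => + fC.
have eR z : z * e * e = z * e by rewrite -mulgA ee.
have xR z : z * x * y * x = z * x by rewrite -!mulgA [x * (y * x)]mulgA xyx.
have fR z : z * e * x * y = z * x * y * e by rewrite -!mulgA [e * (x * y)]mulgA fC !mulgA.
have -> : inv (e * x) = y * e.
  apply: is_inverse_unique (invP _) _; split; rewrite !mulgA eR.
    by rewrite fC eR -fC xR.
  by rewrite fR eR yxy.
rewrite !mulgA eR fC eR => U2.
have : x * (y * e * x) = e * x by rewrite !mulgA -fC xR.
by rewrite U2 !mulgA -[x * x * y]mulgA xxy => ->.
Qed.

Lemma inverseM x y : inv (x * y) = inv y * inv x.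
Proof.
apply: is_inverse_unique (invP _) _; have [x1 x2] := invP x; have [y1 y2] := invP y.
have C : y * inv y * (inv x * x) = inv x * x * (y * inv y).
  exact: idempotent_central (left_unit_idempotent y).
split.
  have -> : x * y * (inv y * inv x) * (x * y) = x * ((y * inv y) * (inv x * x)) * y.
    by rewrite !mulgA.
  rewrite C; have -> : x * (inv x * x * (y * inv y)) * y = (x * inv x * x) * (y * inv y * y).
    by rewrite !mulgA.
  by rewrite x1 y1.
have -> : inv y * inv x * (x * y) * (inv y * inv x) = inv y * ((inv x * x) * (y * inv y)) * inv x.
  by rewrite !mulgA.
rewrite -C; have -> : inv y * (y * inv y * (inv x * x)) * inv x = (inv y * y * inv y) * (inv x * x * inv x).
  by rewrite !mulgA.
by rewrite x2 y2.
Qed.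

(** Centrality of idempotents makes [left_unit] a homomorphic retraction onto the semilattice. *)
Lemma left_unitM x y : left_unit (x * y) = left_unit x * left_unit y.
Proof.
rewrite /left_unit inverseM.
have -> : x * y * (inv y * inv x) = x * ((y * inv y) * inv x) by rewrite !mulgA.
by rewrite (idempotent_central _ (left_unit_idempotent y)) mulgA.
Qed.

Lemma left_unit_id e : idempotents S e -> left_unit e = e.
Proof.
move=> ee; rewrite /left_unit.
by rewrite -(is_inverse_unique (idempotent_inverse ee) (invP e)) ee.
Qed.

Lemma maximal_subgroup_left_unit e x : idempotents S e -> left_unit x = e ->
  maximal_subgroup e x.
Proof.
move=> ee xe; apply/maximal_subgroupE; split=> //.
- by rewrite -xe left_unitK.
- by rewrite -xe right_unitK.
exists (inv x); rewrite left_unitV xe; split=> //; have [h1 h2] := invP x.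
  by rewrite -xe -left_unitV.
by rewrite -xe /left_unit mulgA.
Qed.

End inverse.

(** * Embedding into the product of the [H_e^0] *)

Section embedding.
Variable S : topSemigroupType.
Hypotheses (hS : hausdorff_space S) (cS : compact [set: S]) (clS : clifford S).
Hypotheses (iS : inverse_semigroup S) (bE : has_clopen_base (idempotents S)).
Variable inv : S -> S.
Hypotheses (invP : forall x, is_inverse x (inv x)) (cinv : continuous inv).
Implicit Types x y e f : S.

Local Notation phi := (left_unit inv).

Let phiE x : idempotents S (phi x). Proof. exact: left_unit_idempotent. Qed.
Let phiM x y : phi (x * y) = phi x * phi y. Proof. exact: left_unitM. Qed.
Let phi_id e : idempotents S e -> phi e = e. Proof. exact: left_unit_id. Qed.
Let EC e f : idempotents S e -> idempotents S f -> e * f = f * e.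
Proof. exact: (idempotentC iS invP). Qed.
Let EM e f : idempotents S e -> idempotents S f -> idempotents S (e * f).
Proof. exact: (idempotentM iS invP). Qed.

Let cid : continuous (id : S -> S). Proof. by move=> x; exact: cvg_id. Qed.

Let cphi : continuous phi. Proof. exact: continuous_mulg. Qed.

Definition unit_retraction x : idempotents S := exist _ (phi x) (mem_set (phiE x)).

Lemma continuous_unit_retraction : continuous unit_retraction.
Proof. exact: continuous_comp_initial. Qed.

(** A clopen set of idempotents is pulled back along [phi] to a clopen [V] in [S]. The idempotents
    congruent to [f] form a compact semilattice [A]; its least element [e] is below [f], and it lies
    in [O] because congruent elements agree on membership in [V]. *)
Lemma open_idempotent_near f (O : set S) : idempotents S f -> nbhs f O ->
  exists e, [/\ idempotents S e, e * f = e, O e & open [set x | e * phi x = e]].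
Proof.
move=> ff Of; pose fE : idempotents S := exist _ f (mem_set ff).
have OE : nbhs fE (set_val @^-1` O) by exact: (@continuous_set_val _ _ fE).
have [U [[oU clU] Uf] UO] := bE.2 fE _ OE.
pose V := unit_retraction @^-1` U.
have oV : open V by apply: open_comp => // x _; exact: continuous_unit_retraction.
have clV : open (~` V).
  have -> : ~` V = unit_retraction @^-1` (~` U) by [].
  apply: open_comp; last exact: closed_openC.
  by move=> x _; exact: continuous_unit_retraction.
have Vphi x y : phi x = phi y -> V x -> V y.
  move=> xy; rewrite /V /=; suff -> : unit_retraction x = unit_retraction y by [].
  exact: set_val_inj.
have Vf : V f by rewrite /V /=; suff -> : unit_retraction f = fE by []; apply: set_val_inj; exact: phi_id.
have VO e : idempotents S e -> V e -> O e.
  by move=> ee /UO; rewrite /= set_valE /= phi_id.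
have VC x y : V (x * y) -> V (y * x) by apply: Vphi; rewrite !phiM EC.
(* The syntactic congruence of [V] on [S]: its classes are open by compactness. *)
pose sim x y := (V x <-> V y) /\ forall z, V (z * x) <-> V (z * y).
have simC x y : sim x y -> sim y x.
  by move=> [h1 h2]; split=> [|z]; [rewrite h1|rewrite h2].
have simT y x z : sim x y -> sim y z -> sim x z.
  by move=> [h1 h2] [h3 h4]; split=> [|w]; [rewrite h1|rewrite h2].
have sim_phi x y : phi x = phi y -> sim x y.
  move=> xy; split=> [|z]; split; apply: Vphi => //; by rewrite !phiM xy.
have simM z x y : sim x y -> sim (z * x) (z * y).
  by move=> [h1 h2]; split=> // w; rewrite !mulgA.
have simMr z x y : sim x y -> sim (x * z) (y * z).
  move=> xy; apply: (@simT (z * x)); first by apply: sim_phi; rewrite !phiM EC.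
  by apply: (simT _ _ _ (simM z _ _ xy)); apply: sim_phi; rewrite !phiM EC.
have Vnear (X : topologicalType) (g h : X -> S) (p : X) : continuous g -> continuous h ->
    g p = h p -> nbhs p [set q | V (g q) <-> V (h q)].
  move=> cg ch gh; have [Vg|Vg] := pselect (V (g p)).
    have n1 : nbhs p (g @^-1` V) by apply: cg; exact: open_nbhs_nbhs.
    have n2 : nbhs p (h @^-1` V) by apply: ch; apply: open_nbhs_nbhs; rewrite -gh.
    by apply: filterS (filterI n1 n2) => q [/= ? ?]; split.
  have n1 : nbhs p (g @^-1` (~` V)) by apply: cg; exact: open_nbhs_nbhs.
  have n2 : nbhs p (h @^-1` (~` V)) by apply: ch; apply: open_nbhs_nbhs; rewrite -gh.
  by apply: filterS (filterI n1 n2) => q [/= ? ?]; split.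
have sim_near x : nbhs x (sim x).
  have n1 : nbhs x [set y | V x <-> V y].
    by apply: (Vnear _ (cst x) id) => //; exact: cst_continuous.
  have n2 : nbhs x [set y | forall z, setT z -> (V (z * x) <-> V (z * y))].
    apply: near_compact cS _ => z _.
    apply: (Vnear _ (fun p : S * S => p.2 * x) (fun p : S * S => p.2 * p.1)) => //.
      by apply: continuous_mulg; [exact: continuous_snd|exact: cst_continuous].
    by apply: continuous_mulg; [exact: continuous_snd|exact: continuous_fst].
  by apply: filterS (filterI n1 n2) => y [h1 h2]; split=> // z; exact: h2.
pose A := [set y | idempotents S y /\ sim f y].
have Af : A f by split=> //; exact: sim_phi.
have AM y z : A y -> A z -> A (y * z).
  move=> [yy fy] [zz fz]; split; first exact: EM.
  apply: (@simT (f * z)); last exact: simMr.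
  by apply: (@simT (f * f)); [rewrite ff; exact: sim_phi|exact: simM].
have cA : compact A.
  apply: subclosed_compact cS _ => //; apply: closedI.
    by apply: closed_equalizer => //; exact: continuous_mulg.
  rewrite -[X in closed X]setCK; apply: open_closedC; rewrite openE => y fy.
  apply: filterS (sim_near y) => z yz fz; apply: fy; exact: simT fz (simC _ _ yz).
(* Lower sets in [A]; they form a filter base because [a * b] is below both factors. A cluster point
   is below every [a], since [y * a = y] is a closed condition. *)
pose D a := [set y | A y /\ y * a = y].
have DP : ProperFilter (filter_from A D).
  apply: filter_from_proper; last by move=> a Aa; exists a; split=> //; case: Aa.
  apply: filter_from_filter; first by exists f.
  move=> a b Aa Ab; exists (a * b); first exact: AM.
  have [aa _] := Aa; have [bb _] := Ab.
  have aba : a * b * a = a * b by rewrite (EC aa bb) -mulgA aa.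
  have abb : a * b * b = a * b by rewrite -mulgA bb.
  by move=> y [Ay yab]; split; split=> //; rewrite -[in LHS]yab -mulgA ?aba ?abb yab.
have DA : filter_from A D A by exists f => // y [].
have [e [[ee fe] cle]] := cA _ DP DA.
have emin a : A a -> e * a = e.
  move=> Aa; have cDa : closed [set y | y * a = y].
    by apply: closed_equalizer => //; apply: continuous_mulg => //; exact: cst_continuous.
  apply: cDa => N Ne; have [|y [[_ ya] Ny]] := cle (D a) N _ Ne; last by exists y.
  by exists a.
exists e; split=> //; first exact: emin.
  exact: VO ee (fe.1.1 Vf).
(* For [y] congruent to [x], [e * phi y] is congruent to [e * phi x = e], so it belongs to [A], and
   minimality of [e] gives [e * phi y = e]. *)
rewrite openE => x /= ex; apply: filterS (sim_near x) => y xy /=.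
have pxy : sim (phi x) (phi y).
  apply: (@simT x); first by apply: sim_phi; rewrite (phi_id (phiE x)).
  by apply: (simT _ _ _ xy); apply: sim_phi; rewrite (phi_id (phiE y)).
have := simM e _ _ pxy; rewrite ex => exy.
have : A (e * phi y) by split; [exact: EM|exact: simT fe exy].
by move=> /emin; rewrite mulgA ee.
Qed.

Definition open_unit e := open [set x | e * phi x = e].

Lemma unit_translate_subproof e x : idempotents S e -> e * phi x = e ->
  e * x \in maximal_subgroup e.
Proof.
move=> ee ex; apply/mem_set; apply: (maximal_subgroup_left_unit iS clS invP) => //.
by rewrite phiM phi_id.
Qed.

(** Constantly zero when [e] is not an open unit, so that there is a continuous homomorphism for
    every idempotent and the product can run over all of them. *)
Definition unit_translate (e : idempotents S) x :
    zero_extension (maxsubgroup (set_val e)) :=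
  match pselect (open_unit (set_val e) /\ set_val e * phi x = set_val e) with
  | left h => Some (exist _ (set_val e * x) (unit_translate_subproof (set_valP e) h.2))
  | right _ => None
  end.

Lemma unit_translate_some (e : idempotents S) x :
  open_unit (set_val e) -> set_val e * phi x = set_val e ->
  exists2 t, unit_translate e x = Some t & set_val t = set_val e * x.
Proof.
move=> oe ex; rewrite /unit_translate; case: pselect => [h|[]//].
by eexists; first by [].
Qed.

Lemma unit_translate_none (e : idempotents S) x :
  ~ (open_unit (set_val e) /\ set_val e * phi x = set_val e) ->
  unit_translate e x = None.
Proof. by rewrite /unit_translate; case: pselect. Qed.

(** [e] is below [phi (x * y)] exactly when it is below both [phi x] and [phi y], so products vanish
    where they should; elsewhere centrality of [e] applies. *)
Lemma unit_translateM (e : idempotents S) :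
  {morph unit_translate e : x y / x * y}.
Proof.
move=> x y; have ee := set_valP e; set d := set_val e in ee *.
have [oe|oe] := pselect (open_unit d); last by rewrite !unit_translate_none// => -[].
have [ex|ex] := pselect (d * phi x = d); last first.
  rewrite (unit_translate_none (x := x)); last by case.
  rewrite unit_translate_none// => -[_]; rewrite phiM => dxy; apply: ex.
  have : d * (phi x * phi y) * phi x = d * (phi x * phi y).
    rewrite -mulgA; congr (_ * _).
    by rewrite (EC (phiE x) (phiE y)) -mulgA (phiE x).
  by rewrite dxy.
have [t -> tE] := unit_translate_some oe ex.
have [ey|ey] := pselect (d * phi y = d); last first.
  rewrite (unit_translate_none (x := y)); last by case.
  by rewrite unit_translate_none// => -[_]; rewrite phiM mulgA ex.
have [u -> uE] := unit_translate_some oe ey.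
have [|v -> vE] := @unit_translate_some e (x * y) oe; first by rewrite phiM mulgA ex.
congr Some; apply: set_val_inj; rewrite vE.
change (set_val e * (x * y) = set_val t * set_val u).
rewrite tE uE mulgA -[RHS]mulgA [x * (_ * _)]mulgA -(idempotent_central iS clS invP x ee).
by rewrite !mulgA ee.
Qed.

(** For an open unit the support of the map is open by assumption and closed as an equaliser, so the
    two cases of the definition do not interfere. *)
Lemma continuous_unit_translate (e : idempotents S) : continuous (unit_translate e).
Proof.
have [oe|oe] := pselect (open_unit (set_val e)); last first.
  have -> : unit_translate e = cst None.
    by apply/funext => x; apply: unit_translate_none => -[].
  exact: cst_continuous.
move=> x; have [ex|ex] := pselect (set_val e * phi x = set_val e).
  have [t tS tE] := unit_translate_some oe ex; rewrite /continuous_at tS => U /nbhs_zero_Some.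
  move=> [_ [[W oW <-] /= Wt] WU].
  have n1 : nbhs x [set y | set_val e * phi y = set_val e] by exact: open_nbhs_nbhs.
  have n2 : nbhs x [set y | W (set_val e * y)].
    have := @continuous_mulg _ _ (cst (set_val e)) id (@cst_continuous _ _ _) cid x.
    by apply; apply: open_nbhs_nbhs; split=> //; rewrite /cst /= -tE.
  apply: filterS (filterI n1 n2) => y [/= ey Wy].
  have [u uS uE] := unit_translate_some oe ey; rewrite /= uS.
  by apply: WU; rewrite /= uE.
rewrite /continuous_at (unit_translate_none (x := x)); last by case.
move=> U /nbhs_zero_None UN.
have cl : closed [set y | set_val e * phi y = set_val e].
  apply: closed_equalizer => //; last exact: cst_continuous.
  by apply: continuous_mulg => //; exact: cst_continuous.
have n1 : nbhs x (~` [set y | set_val e * phi y = set_val e]).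
  by apply: open_nbhs_nbhs; split=> //; exact: closed_openC.
by apply: filterS n1 => y ey; rewrite /= unit_translate_none//; case.
Qed.

Lemma embeds_zero_product : embeds S (prod_topology (fun e : idempotents S =>
  zero_extension (maxsubgroup (set_val e)))).
Proof.
pose F (x : S) : prod_topology (fun e : idempotents S =>
  zero_extension (maxsubgroup (set_val e))) := fun e : idempotents S => unit_translate e x.
exists F; first by move=> x y; apply/functional_extensionality_dep => d; exact: unit_translateM.
apply: compact_embedding => //.
- apply: prod_hausdorff => e; apply: zero_extension_hausdorff.
  exact: maxsubgroup_hausdorff.
- by apply: continuous_prod => e; exact: continuous_unit_translate.
(* By symmetry [x = phi x * y] puts [phi x] and [phi y] below each other; they coincide, and then
   [x = phi y * y = y]. *)
suff half x y : (forall d, unit_translate d x = unit_translate d y) -> x = phi x * y.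
  move=> x y xyF; have xy d : unit_translate d x = unit_translate d y.
    exact: (congr1 (fun k => k d) xyF).
  have xE := half x y xy; have yE := half y x (fun d => esym (xy d)).
  have phixy : phi x = phi y.
    rewrite {1}xE phiM (phi_id (phiE x)) (EC (phiE x) (phiE y)).
    by rewrite [in RHS]yE phiM (phi_id (phiE y)).
  by rewrite xE phixy (left_unitK invP).
move=> xy; have cl : closed [set z | z * x = z * y].
  by apply: closed_equalizer => //; apply: continuous_mulg => //; exact: cst_continuous.
(* [phi x] is a limit of open units [e] below it, and the coordinate at such an [e] says
   [e * x = e * y]. *)
have clf : [set z | z * x = z * y] (phi x).
  apply: cl => N Nx; have [e [ee ex Ne oe]] := open_idempotent_near (phiE x) Nx.
  exists e; split=> //=; pose d : idempotents S := exist _ e (mem_set ee).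
  have [t tS tE] := @unit_translate_some d x oe ex.
  have := xy d; rewrite tS /unit_translate; case: pselect => // h [tE'].
  by rewrite -[e * x]tE tE'.
by rewrite -[LHS](left_unitK invP).
Qed.

End embedding.

(** * Products of maximal groups *)

(** [maxsubgroup e] is a group only for idempotent [e], so the group data travel as a record instead
    of instances on the type. *)
Record group_structure (T : topSemigroupType) := GroupStructure {
  gs_one : T;
  gs_inv : T -> T;
  gs_mul1 : left_id gs_one *%g;
  gs_1mul : right_id gs_one *%g;
  gs_mulV : left_inverse gs_one gs_inv *%g;
  gs_Vmul : right_inverse gs_one gs_inv *%g;
  gs_inv_continuous : continuous gs_inv
}.

Section doubled.
Variable T : topSemigroupType.

(* The product of [T] with the group of order two, which makes it nontrivial. *)
Definition doubled (g : group_structure T) : Type := (T * bool)%type.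

Variable g : group_structure T.

HB.instance Definition _ := Topological.copy (doubled g) (T * bool)%type.

Definition doubled_mul (x y : doubled g) : doubled g := (x.1 * y.1, x.2 (+) y.2).
Definition doubled_one : doubled g := (gs_one g, false).
Definition doubled_inv (x : doubled g) : doubled g := (gs_inv g x.1, x.2).

Lemma doubled_mulA : associative doubled_mul.
Proof. by move=> x y z; rewrite /doubled_mul /= mulgA addbA. Qed.

HB.instance Definition _ := isSemigroup.Build (doubled g) doubled_mulA.

Lemma doubled_mul1 : left_id doubled_one *%g.
Proof. by move=> [x b]; congr (_, _); exact: gs_mul1. Qed.

Lemma doubled_1mul : right_id doubled_one *%g.
Proof. by move=> [x b]; congr (_, _); [exact: gs_1mul|exact: addbF]. Qed.

Lemma doubled_mulV : left_inverse doubled_one doubled_inv *%g.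
Proof. by move=> [x b]; congr (_, _); [exact: gs_mulV|exact: addbb]. Qed.

Lemma doubled_Vmul : right_inverse doubled_one doubled_inv *%g.
Proof. by move=> [x b]; congr (_, _); [exact: gs_Vmul|exact: addbb]. Qed.

HB.instance Definition _ :=
  Semigroup_isMonoid.Build (doubled g) doubled_mul1 doubled_1mul.
HB.instance Definition _ := hasInv.Build (doubled g) doubled_inv.
HB.instance Definition _ :=
  Monoid_isGroup.Build (doubled g) doubled_mulV doubled_Vmul.

Let c1 : continuous (fst : doubled g -> T). Proof. exact: (@continuous_fst T bool). Qed.
Let c2 : continuous (snd : doubled g -> bool). Proof. exact: (@continuous_snd T bool). Qed.

Lemma continuous_doubled (X : topologicalType) (f : X -> T) (b : X -> bool) :
  continuous f -> continuous b -> continuous (fun x => (f x, b x) : doubled g).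
Proof.
by move=> cf cb x; apply: (@cvg_pair _ _ _ _ (nbhs _) (nbhs _)); [exact: cf|exact: cb].
Qed.

Lemma doubled_mul_continuous :
  continuous (fun xy : doubled g * doubled g => xy.1 * xy.2).
Proof.
have cf : continuous (fun xy : doubled g * doubled g => xy.1.1 * xy.2.1).
  by apply: continuous_mulg => x; [exact: (continuous_comp (@continuous_fst _ _ x) (@c1 _))
    |exact: (continuous_comp (@continuous_snd _ _ x) (@c1 _))].
have cadd : continuous (fun p : bool * bool => p.1 (+) p.2).
  move=> [a b] U /= Uab; exists ([set a], [set b]); first by split; exact: discrete_set1.
  by move=> [c d] [/= -> ->]; exact: nbhs_singleton Uab.
have cb : continuous (fun xy : doubled g * doubled g => xy.1.2 (+) xy.2.2); last first.
  exact: (continuous_doubled cf cb).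
move=> x; apply: (@continuous_comp _ _ _ (fun xy : doubled g * doubled g =>
  (xy.1.2, xy.2.2)) (fun p : bool * bool => p.1 (+) p.2)); last exact: cadd.
apply: (@cvg_pair _ _ _ _ (nbhs _) (nbhs _)).
  exact: (continuous_comp (@continuous_fst _ _ x) (@c2 _)).
exact: (continuous_comp (@continuous_snd _ _ x) (@c2 _)).
Qed.

HB.instance Definition _ :=
  Semigroup_isTopological.Build (doubled g) doubled_mul_continuous.

Lemma doubled_inv_continuous : continuous (fun x : doubled g => x^-1).
Proof.
have cf : continuous (fun x : doubled g => gs_inv g x.1); last first.
  exact: (continuous_doubled cf c2).
by move=> x; exact: (continuous_comp (@c1 x) (@gs_inv_continuous _ g _)).
Qed.

HB.instance Definition _ :=
  Group_isTopological.Build (doubled g) doubled_inv_continuous.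

Definition doubled_in (t : T) : doubled g := (t, false).

Lemma doubled_inM : {morph doubled_in : x y / x * y}.
Proof. by []. Qed.

Lemma doubled_in_inj : injective doubled_in.
Proof. by move=> x y []. Qed.

Lemma continuous_doubled_in : continuous doubled_in.
Proof.
by apply: continuous_doubled => x; [exact: cvg_id|exact: cvg_cst].
Qed.

Lemma doubled_compact : compact [set: T] -> compact [set: doubled g].
Proof.
by move=> cT; rewrite -[setT](@setXTT T bool); apply: compact_setX => //; exact: bool_compact.
Qed.

Lemma doubled_hausdorff : hausdorff_space T -> hausdorff_space (doubled g).
Proof.
move=> hT; apply: hausdorff_separated => -[x b] [y c] xy.
have [xyE|xyN] := pselect (x = y); last by exists T, fst; split=> //; exact: c1.
exists bool, snd; split; [exact: discrete_hausdorff|exact: c2|].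
by move=> /= bc; apply: xy; rewrite xyE bc.
Qed.

End doubled.

Lemma compact_tychonoff (T : topologicalType) : compact [set: T] ->
  hausdorff_space T -> tychonoff_space T.
Proof.
move=> cT hT; split=> //; apply: (@normal_completely_regular Rdefinitions.R).
  exact: compact_normal.
exact: hausdorff_accessible.
Qed.

(** * Singletons and cylinders in hypersemigroups *)

Section singletons.
Variable G : topGroupType.

Lemma hyper1_subproof (x : G) : [set x] \in [set K : set G | compact K /\ K !=set0].
Proof. by apply/mem_set; split; [exact: compact_set1|exists x]. Qed.

Definition hyper1 (x : G) : hypersemigroup G := exist (fun K => K \in _) _ (hyper1_subproof x).

Lemma hyper_set1 x : hyper_set (hyper1 x) = [set x].
Proof. by rewrite /hyper_set set_valE. Qed.

Lemma hyper1_inj : injective hyper1.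
Proof.
move=> x y /(congr1 (@hyper_set G)); rewrite !hyper_set1 => xy.
by have : [set y] x by rewrite -xy.
Qed.

Lemma hyper1M : {morph hyper1 : x y / x * y}.
Proof.
move=> x y; apply: hyper_inj; rewrite hyper_setM !hyper_set1 eqEsubset.
by split=> [_ ->|_ [_ -> [_ -> <-]]//]; exists x => //; exists y.
Qed.

Lemma continuous_hyper1 : continuous hyper1.
Proof.
move=> x; apply: vietoris_cvg => _ [] [U oU <-] /=; rewrite hyper_set1.
  move=> /(_ x erefl) Ux; have : nbhs x U by exact: open_nbhs_nbhs.
  by apply: filterS => y Uy; rewrite /= hyper_set1 => _ ->.
move=> [_ [-> Ux]]; have : nbhs x U by exact: open_nbhs_nbhs.
by apply: filterS => y Uy; rewrite /= hyper_set1; exists y.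
Qed.

End singletons.

Section cylinders.
Variables (I : choiceType) (T : I -> topSemigroupType).
Variable g : forall i, group_structure (T i).
Hypotheses (cT : forall i, compact [set: T i]) (hT : forall i, hausdorff_space (T i)).

Local Notation D := (prod_topology (fun i => doubled (g i))).
Local Notation Z := (prod_topology (fun i => zero_extension (T i))).

Lemma prod_doubled_compact : compact [set: D].
Proof.
have := @tychonoff I (fun i => doubled (g i)) (fun i => setT)
  (fun i => @doubled_compact _ (g i) (@cT i)).
by congr compact; rewrite -subTset => x _ i.
Qed.

Definition zero_fill i (z : zero_extension (T i)) (d : doubled (g i)) : doubled (g i) :=
  if z is Some t then doubled_in (g i) t else d.

Lemma continuous_zero_fill i :
  continuous (fun p : zero_extension (T i) * doubled (g i) => zero_fill p.1 p.2).
Proof.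
move=> [[t|] d] U /= Ud.
  exists ([set z : zero_extension (T i) | if z is Some t' then U (doubled_in (g i) t') else False], setT).
    split; last exact: filterT.
    by apply/nbhs_zero_Some; exact: (@continuous_doubled_in _ (g i) t U Ud).
  by move=> [[t'|] d'] [].
exists ([set None], U); first by split=> //; exact/nbhs_zero_None.
by move=> [z d'] [/= -> Ud'].
Qed.

(* The cylinder of all points agreeing with [z] where [z] is nonzero. *)
Definition cylinder (z : Z) : set D := [set d | forall i, zero_fill (z i) (d i) = d i].

Lemma closed_cylinder : closed [set p : Z * D | cylinder p.1 p.2].
Proof.
move=> p clp i; have : closed [set p : Z * D | zero_fill (p.1 i) (p.2 i) = p.2 i].
  apply: closed_equalizer; first exact/doubled_hausdorff/hT.
    move=> q; apply: (@continuous_comp _ _ _ (fun q : Z * D => (q.1 i, q.2 i))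
      (fun p : zero_extension (T i) * doubled (g i) => zero_fill p.1 p.2)); last first.
      exact: continuous_zero_fill.
    apply: (@cvg_pair _ _ _ _ (nbhs _) (nbhs _)).
      exact: (continuous_comp (@continuous_fst _ _ q) (@continuous_proj _ _ i _)).
    exact: (continuous_comp (@continuous_snd _ _ q) (@continuous_proj _ _ i _)).
  by move=> q; exact: (continuous_comp (@continuous_snd _ _ q) (@continuous_proj _ _ i _)).
by apply; apply: closureS clp => q; exact.
Qed.

Lemma cylinder_subproof z : cylinder z \in [set K : set D | compact K /\ K !=set0].
Proof.
apply/mem_set; split.
  apply: subclosed_compact prod_doubled_compact _ => //.
  apply: (@closed_comp D (Z * D)%type (fun d => (z, d)) [set p | cylinder p.1 p.2]).
    move=> d _; apply: (@continuous_pair D Z D (cst z) id); first exact: cst_continuous.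
    by move=> ?; exact: cvg_id.
  exact: closed_cylinder.
by exists (fun i => zero_fill (z i) 1) => i; rewrite /zero_fill; case: (z i).
Qed.

Definition hyper_cylinder z : hypersemigroup D :=
  exist (fun K => K \in _) _ (cylinder_subproof z).

Lemma hyper_set_cylinder z : hyper_set (hyper_cylinder z) = cylinder z.
Proof. by rewrite /hyper_set set_valE. Qed.

Lemma hyper_cylinder_inj : injective hyper_cylinder.
Proof.
move=> x y /(congr1 (@hyper_set _)); rewrite !hyper_set_cylinder => xy.
have half (u v : Z) i t : cylinder u = cylinder v -> u i = Some t -> v i = Some t.
  move=> uv ui; pose w : D := fun k => zero_fill (v k) (gs_one (g k), true).
  (* At every free coordinate [w] carries the flag [true], which no [doubled_in] value has; so a
     coordinate prescribed by [u] must be prescribed by [v] as well. Here the order-two factor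
     distinguishes zero from nonzero. *)
  have : cylinder u w.
    by rewrite uv => k; rewrite /w /zero_fill; case: (v k).
  move=> /(_ i); rewrite ui /w /=; case: (v i) => [t'|] /=.
    by move=> /doubled_in_inj ->.
  by case.
apply/functional_extensionality_dep => i.
case E : (x i) => [t|]; first by rewrite (half x y i t).
by case F : (y i) => [t|] //; rewrite (half y x i t) // in E.
Qed.

Lemma hyper_cylinderM : {morph hyper_cylinder : x y / x * y}.
Proof.
move=> x y; apply: hyper_inj; rewrite hyper_setM !hyper_set_cylinder eqEsubset.
split=> [k kxy|_ [a ax [b by_ <-]] i]; last first.
  have := ax i; have := by_ i; rewrite /zero_fill.
  change ((x * y) i) with (x i * y i); change ((a * b) i) with (a i * b i).
  by case: (x i) => [t|]; case: (y i) => [u|] //= <- <-.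
(* Factorisation of [k]: where only [y] is nonzero, [a] is chosen so that [a^-1 * k] takes the value
   prescribed by [y]; where both vanish any value would do. *)
pose a : D := fun i => if x i is Some t then doubled_in (g i) t
  else if y i is Some u then k i * (doubled_in (g i) u)^-1 else 1.
exists a; first by move=> i; rewrite /a /zero_fill; case: (x i).
exists (a^-1 * k); last by rewrite mulVKg.
move=> i; have := kxy i; change ((x * y) i) with (x i * y i).
change ((a^-1 * k) i) with ((a i)^-1 * k i); rewrite /a /zero_fill.
case: (x i) => [t|]; case: (y i) => [u|] //=.
  by move=> <-; rewrite doubled_inM mulKg.
by move=> _; rewrite invgM invgK mulgVK.
Qed.

Lemma continuous_hyper_cylinder : continuous hyper_cylinder.
Proof.
move=> z; apply: (vietoris_cvg (fmap_filter _ (nbhs_filter z))) => _ [] [U oU <-] /=;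
  rewrite hyper_set_cylinder.
  (* Upper half of the Vietoris topology: the cylinder relation is closed and the complement of [U]
     is compact. *)
  move=> zU; have : nbhs z [set z' | forall d, (~` U) d -> ~ cylinder z' d].
    apply: near_compact.
      by apply: subclosed_compact prod_doubled_compact _ => //; exact: open_closedC.
    move=> d Ud; have := closed_openC closed_cylinder; rewrite openE; apply.
    by move=> /zU.
  apply: filterS => z' hz; rewrite /= hyper_set_cylinder => d z'd.
  by apply: contrapT => /hz.
(* Lower half: [sel z'] is a point of the cylinder of [z'] that varies continuously and equals [d]
   at [z]. *)
move=> [d [zd Ud]]; pose sel (z' : Z) : D := fun i => zero_fill (z' i) (d i).
have csel : continuous sel.
  apply: continuous_prod => i z'.
  apply: (@continuous_comp _ _ _ (fun z' : Z => (z' i, d i))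
    (fun p : zero_extension (T i) * doubled (g i) => zero_fill p.1 p.2)).
    apply: (@continuous_pair Z _ _ (fun z' => z' i) (cst (d i))); first exact: continuous_proj.
    exact: cst_continuous.
  exact: continuous_zero_fill.
have selz : sel z = d by apply/functional_extensionality_dep => i; exact: zd.
have : nbhs z (sel @^-1` U) by apply: csel; rewrite selz; exact: open_nbhs_nbhs.
apply: filterS => z' Uz'; rewrite /= hyper_set_cylinder; exists (sel z'); split=> //.
by move=> i; rewrite /sel /zero_fill; case: (z' i).
Qed.

End cylinders.

Section compact_semigroup.
Variable S : topSemigroupType.
Hypotheses (hS : hausdorff_space S) (cS : compact [set: S]).

(** The pairs of mutually inverse elements form a closed subset of [S * S], and the maximal subgroup
    is its projection. *)
Lemma maximal_subgroup_compact (e : S) : idempotents S e -> compact (maximal_subgroup e).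
Proof.
move=> ee; pose P := [set p : S * S | e * p.1 = p.1 /\ p.1 * e = p.1] `&`
  [set p | e * p.2 = p.2 /\ p.2 * e = p.2] `&` [set p | p.1 * p.2 = e /\ p.2 * p.1 = e].
have -> : maximal_subgroup e = fst @` P.
  rewrite eqEsubset; split=> [x /maximal_subgroupE[_ ex xe [y [ey ye xy yx]]]|x].
    by exists (x, y).
  by move=> [[z y] [[[/= ex xe] [ey ye]] [xy yx]] <-]; apply/maximal_subgroupE; split=> //; exists y.
apply: compact_image; first exact: continuous_fst.
have c1 := @continuous_fst S S; have c2 := @continuous_snd S S.
have ce : continuous (fun _ : S * S => e) by exact: cst_continuous.
have cSS : compact [set: S * S] by rewrite -setXTT; exact: compact_setX.
apply: subclosed_compact cSS _ => //.
have clE (f h : S * S -> S) : continuous f -> continuous h -> closed [set p | f p = h p].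
  exact: closed_equalizer.
by do ?[apply: closedI]; apply: clE => //; exact: continuous_mulg.
Qed.

Lemma maxsubgroup_compact (e : S) : idempotents S e -> compact [set: maxsubgroup e].
Proof. by move=> ee; apply: compact_set_type; exact: maximal_subgroup_compact. Qed.

(** The conclusion is inhabitation, phrased in [Prop]. Inversion is continuous because its graph is
    the closed set of pairs with product [one]. *)
Lemma maxsubgroup_group (e : S) : idempotents S e ->
  exists g : group_structure (maxsubgroup e), True.
Proof.
move=> ee; have eH : e \in maximal_subgroup e.
  by apply/mem_set/maximal_subgroupE; split=> //; exists e.
pose one : maxsubgroup e := exist _ e eH.
have val_eq (x y : maxsubgroup e) : set_val x = set_val y -> x = y by exact: set_val_inj.
have valP (x : maxsubgroup e) : maximal_subgroup e (set_val x) by exact: set_valP.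
have valM (x y : maxsubgroup e) : set_val (x * y) = set_val x * set_val y by [].
have mul1 : left_id one *%g.
  by move=> x; apply: val_eq; have /maximal_subgroupE[] := valP x.
have mulr1 : right_id one *%g.
  by move=> x; apply: val_eq; have /maximal_subgroupE[] := valP x.
have /choice[inv invP] (x : maxsubgroup e) : exists y : maxsubgroup e, x * y = one /\ y * x = one.
  have /maximal_subgroupE[_ ex xe [y [ey ye xy yx]]] := valP x.
  have yH : y \in maximal_subgroup e.
    by apply/mem_set/maximal_subgroupE; split=> //; exists (set_val x).
  by exists (exist _ y yH); split; exact: val_eq.
have hH := @maxsubgroup_hausdorff S e hS.
have cinv : continuous inv.
  apply: closed_graph_continuous; first exact: maxsubgroup_compact.
  have -> : [set p : maxsubgroup e * maxsubgroup e | inv p.1 = p.2] =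
      [set p | p.1 * p.2 = one].
    rewrite eqEsubset; split=> [[x y] /= <-|[x y] /= xy]; first by case: (invP x).
    by rewrite -[inv x]mulr1 -xy mulgA (invP x).2 mul1.
  apply: closed_equalizer => //; first exact: mulg_continuous.
  exact: cst_continuous.
have mulV : left_inverse one inv *%g by move=> x; case: (invP x).
have Vmul : right_inverse one inv *%g by move=> x; case: (invP x).
by exists (GroupStructure mul1 mulr1 mulV Vmul cinv).
Qed.

End compact_semigroup.

Lemma doubled_tychonoff (T : topSemigroupType) (g : group_structure T) :
  compact [set: T] -> hausdorff_space T -> tychonoff_space (doubled g).
Proof.
by move=> cT hT; apply: compact_tychonoff; [exact: doubled_compact|exact: doubled_hausdorff].
Qed.

Lemma class_H_compact_group (T : topSemigroupType) (g : group_structure T) :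
  compact [set: T] -> hausdorff_space T -> class_H T.
Proof.
move=> cT hT; exists (doubled g); first exact: doubled_tychonoff.
exists (fun t => hyper1 (doubled_in g t)).
  by move=> x y; rewrite doubled_inM hyper1M.
apply: compact_embedding => //.
- by apply: hyper_hausdorff; exact: doubled_hausdorff.
- move=> t; apply: (@continuous_comp _ _ _ (doubled_in g) (@hyper1 (doubled g))).
    exact: continuous_doubled_in.
  exact: continuous_hyper1.
- by move=> x y /hyper1_inj /doubled_in_inj.
Qed.

Theorem theorem3 (S : topSemigroupType) :
  hausdorff_space S -> compact [set: S] -> clifford S ->
  [<-> class_H S;
       class_H0 S;
       topological_inverse_semigroup S /\ has_clopen_base (idempotents S);
       embeds S (prod_topology (fun e : idempotents S =>
         zero_extension (maxsubgroup (set_val e))));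
       exists Ht : idempotents S -> topGroupType,
         (forall e, [/\ tychonoff_space (Ht e), compact [set: Ht e],
                        (exists x : Ht e, x != 1) &
                        embeds (maxsubgroup (set_val e)) (Ht e)]) /\
         embeds S (hypersemigroup (prod_topology Ht))].
Proof.
move=> hS cS clS.
have hH (e : idempotents S) : hausdorff_space (maxsubgroup (set_val e)).
  exact: maxsubgroup_hausdorff.
have cH (e : idempotents S) : compact [set: maxsubgroup (set_val e)].
  exact: maxsubgroup_compact (set_valP e).
have [g _] : exists g : forall e : idempotents S, group_structure (maxsubgroup (set_val e)), True.
  exists (fun e => projT1 (cid (maxsubgroup_group hS cS (set_valP e)))); exact: Logic.I.
have embed4 : topological_inverse_semigroup S /\ has_clopen_base (idempotents S) ->
    embeds S (prod_topology (fun e : idempotents S =>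
      zero_extension (maxsubgroup (set_val e)))).
  by move=> [[iS [inv invP cinv]] bE]; exact: embeds_zero_product cinv.
tfae.
(* Tameness leads through the third condition to the fourth, which presents [S] as a subdirect
   product of compact groups with zero attached. *)
- move=> /(tame_class_H Rdefinitions.R) /(tame_clifford hS cS clS) /embed4.
  apply: class_H0_subdirect => e; apply: class_H0_zero; last exact: cH.
  exact: (class_H_compact_group (g e) (@cH e) (@hH e)).
- by move=> /(tame_class_H0 Rdefinitions.R); exact: tame_clifford.
- exact: embed4.
- move=> [f fM fE]; exists (fun e => doubled (g e)); split=> [e|].
    split.
    + by apply: doubled_tychonoff; [exact: cH|exact: hH].
    + by apply: doubled_compact; exact: cH.
    + by exists (gs_one (g e), true); apply/eqP => -[].
    + exists (doubled_in (g e)); first exact: doubled_inM.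
      apply: compact_embedding; [exact: cH|by apply: doubled_hausdorff; exact: hH| |].
        exact: continuous_doubled_in.
      exact: doubled_in_inj.
  exists (fun x => hyper_cylinder g cH hH (f x)).
    by move=> x y; rewrite fM hyper_cylinderM.
  apply: compact_embedding => //.
  + by apply: hyper_hausdorff; apply: prod_hausdorff => e; apply: doubled_hausdorff; exact: hH.
  + move=> x; apply: (@continuous_comp _ _ _ f (hyper_cylinder g cH hH)).
      exact: embedding_continuous.
    exact: continuous_hyper_cylinder.
  + by move=> x y /hyper_cylinder_inj; exact: fE.1.
- move=> [Ht [HtP SHt]]; exists (prod_topology Ht) => //; apply: compact_tychonoff.
    have := @tychonoff _ Ht (fun i => setT) (fun i => let: And4 _ c _ _ := HtP i in c).
    by congr compact; rewrite -subTset => x _ i.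
  by apply: prod_hausdorff => e; have [[]] := HtP e.
Qed.
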